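(* Let $k$ be a field, $R$ a $k$-algebra and $w\in R$ such that $R$ is essentially of finite type over $k$, equidimensional of dimension $n$, the module of Kähler differentials $\Omega_{R/k}$ is locally free of rank $n$, and the restriction of the zero locus of $dw\in\Omega_{R/k}$ to $\operatorname{Spec}(R/w)$ is a $0$-dimensional scheme supported on a unique closed point $\mathfrak s$ of $\operatorname{Spec}(R/w)$ with residue field $k$. Then the localization functor $$\operatorname{MF}^\infty(R,w)\to\operatorname{MF}^\infty(R_{\mathfrak s},w),\qquad X\mapsto R_{\mathfrak s}\otimes_RX,$$ is a quasi-equivalence.
   Context: For a ring $R$ and $w\in R$, $\operatorname{MF}^\infty(R,w)$ is the differential $\mathbb Z/2$-graded category whose objects are pairs $(X,d)$ with $X=X^0\oplus X^1$ a $\mathbb Z/2$-graded projective $R$-module of possibly infinite rank and $d$ an odd $R$-linear endomorphism with $d^2=w\,\mathrm{id}_X$ (over a local ring the components are free). The morphism complex is the $\mathbb Z/2$-graded module of $R$-linear maps with differential $d(f)=d_{X'}\circ f-(-1)^{|f|}f\circ d_X$. A dg functor is a quasi-equivalence if it induces quasi-isomorphisms on morphism complexes and an essentially surjective functor on homotopy categories (obtained by applying $H^0$ to morphism complexes). *)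

(* Defs.v *)
From HB Require Import structures.
From mathcomp Require Import all_boot all_order all_algebra.
From mathcomp Require Import ring.
From mathcomp Require Import boolp.

Set Implicit Arguments.
Unset Strict Implicit.
Unset Printing Implicit Defensive.

Import GRing.Theory.
Local Open Scope ring_scope.
Local Open Scope quotient_scope.

Section LinearZmod.
Variables (R : pzRingType) (U V : lmodType R).
Implicit Types f g h : {linear U -> V}.

HB.instance Definition _ := gen_eqMixin {linear U -> V}.
HB.instance Definition _ := gen_choiceMixin {linear U -> V}.

Lemma linearP_ext f g : (forall x, f x = g x) -> f = g.
Proof.
case: f g => f [[f1] [f2]] [g [[g1] [g2]]] /= /funext efg.
move: g1 g2; rewrite -efg => g1 g2.
by rewrite (Prop_irrelevance f1 g1) (Prop_irrelevance f2 g2).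
Qed.

Definition lin0 : {linear U -> V} := \0.
Definition linN f : {linear U -> V} := \- f.
Definition linD f g : {linear U -> V} := f \+ g.

Fact linDA : associative linD.
Proof. by move=> f g h; apply: linearP_ext => x /=; rewrite addrA. Qed.
Fact linDC : commutative linD.
Proof. by move=> f g; apply: linearP_ext => x /=; rewrite addrC. Qed.
Fact lin0D : left_id lin0 linD.
Proof. by move=> f; apply: linearP_ext => x /=; rewrite add0r. Qed.
Fact linND : left_inverse lin0 linN linD.
Proof. by move=> f; apply: linearP_ext => x /=; rewrite addNr. Qed.

HB.instance Definition _ :=
  GRing.isZmodule.Build {linear U -> V} linDA linDC lin0D linND.

Lemma lin0E x : (0 : {linear U -> V}) x = 0. Proof. by []. Qed.
Lemma linDE f g x : (f + g) x = f x + g x. Proof. by []. Qed.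
Lemma linNE f x : (- f) x = - f x. Proof. by []. Qed.

End LinearZmod.

Section Presentation.
Variables (R : pzRingType) (G : choiceType).
Variable rel : seq (R * G) -> seq (R * G) -> Prop.

(* A list [:: (a1, g1); ...; (an, gn)] stands for a1 [g1] + ... + an [gn]. *)
Definition fscale (a : R) (s : seq (R * G)) := [seq (a * u.1, u.2) | u <- s].

Inductive preq : seq (R * G) -> seq (R * G) -> Prop :=
| preq_refl s : preq s s
| preq_sym s t : preq s t -> preq t s
| preq_trans s t u : preq s t -> preq t u -> preq s u
| preq_cat s s' t t' : preq s s' -> preq t t' -> preq (s ++ t) (s' ++ t')
| preq_catC s t : preq (s ++ t) (t ++ s)
| preq_add a b g : preq [:: (a + b, g)] [:: (a, g); (b, g)]
| preq_zero g : preq [:: (0, g)] [::]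
| preq_rel a s t : rel s t -> preq (fscale a s) (fscale a t).

Definition preqb s t := `[< preq s t >].

Fact preqb_refl : reflexive preqb.
Proof. by move=> s; apply/asboolP/preq_refl. Qed.
Fact preqb_sym : symmetric preqb.
Proof. by move=> s t; apply/asbool_equiv_eq; split; apply: preq_sym. Qed.
Fact preqb_trans : transitive preqb.
Proof.
by move=> t s u /asboolP st /asboolP tu; apply/asboolP/(preq_trans st).
Qed.
Canonical preqb_equiv := EquivRel preqb preqb_refl preqb_sym preqb_trans.

Definition presented := {eq_quot preqb}.
HB.instance Definition _ : EqQuotient _ preqb presented :=
  EqQuotient.on presented.
HB.instance Definition _ := Choice.on presented.

Definition comb (s : seq (R * G)) : presented := \pi s.

Lemma combP s t : comb s = comb t <-> preq s t.
Proof.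
split=> [/eqmodP/asboolP //|st]; apply/eqmodP; exact/asboolP.
Qed.

Lemma combK (x : presented) : comb (repr x) = x. Proof. exact: reprK. Qed.

Lemma preq_repr s : preq (repr (comb s)) s.
Proof. by apply/combP; rewrite combK. Qed.

Lemma presented_ind (P : presented -> Prop) :
  (forall s, P (comb s)) -> forall x, P x.
Proof. by move=> H x; rewrite -(combK x). Qed.

Lemma fscaleA a b s : fscale a (fscale b s) = fscale (a * b) s.
Proof. by rewrite /fscale -map_comp; apply: eq_map => u /=; rewrite mulrA. Qed.

Lemma preq_scale a s t : preq s t -> preq (fscale a s) (fscale a t).
Proof.
elim=> {s t} [s|s t _|s t u _ st _|s s' t t' _ IHs _ IHt|s t|b c g|g|b s t rst].
- exact: preq_refl.
- exact: preq_sym.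
- exact: preq_trans.
- by rewrite /fscale !map_cat; apply: preq_cat.
- by rewrite /fscale !map_cat; apply: preq_catC.
- by rewrite /= mulrDr; apply: preq_add.
- by rewrite /= mulr0; apply: preq_zero.
- by rewrite !fscaleA; apply: preq_rel.
Qed.

Lemma preq_scaleDl a b s : preq (fscale (a + b) s) (fscale a s ++ fscale b s).
Proof.
elim: s => [|[c g] s IHs] /=; first exact: preq_refl.
rewrite mulrDl -cat1s -[_ :: _ ++ _]cat1s -[X in _ ++ (_ ++ X)]cat1s.
apply: (preq_trans (preq_cat (preq_add _ _ _) IHs)).
rewrite -[[:: _; _]]cat1s -!catA; apply: preq_cat; first exact: preq_refl.
rewrite !catA; apply: preq_cat; last exact: preq_refl.
exact: preq_catC.
Qed.

Lemma preq_scale0 s : preq (fscale 0 s) [::].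
Proof.
elim: s => [|[c g] s IHs] /=; first exact: preq_refl.
rewrite mul0r -cat1s -[[::]]cats0; exact: preq_cat (preq_zero g) IHs.
Qed.

Lemma fscale1 s : fscale 1 s = s.
Proof. by rewrite -[RHS]map_id; apply: eq_map => -[b g]; rewrite /= mul1r. Qed.

Definition padd (x y : presented) := comb (repr x ++ repr y).
Definition pscale a (x : presented) := comb (fscale a (repr x)).

Lemma paddE s t : padd (comb s) (comb t) = comb (s ++ t).
Proof. by apply/combP/preq_cat; apply: preq_repr. Qed.
Lemma pscaleE a s : pscale a (comb s) = comb (fscale a s).
Proof. exact/combP/preq_scale/preq_repr. Qed.

Fact paddA : associative padd.
Proof.
elim/presented_ind=> s; elim/presented_ind=> t; elim/presented_ind=> u.
by rewrite !paddE catA.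
Qed.
Fact paddC : commutative padd.
Proof.
elim/presented_ind=> s; elim/presented_ind=> t.
by rewrite !paddE; apply/combP/preq_catC.
Qed.
Fact padd0 : left_id (comb [::]) padd.
Proof. by elim/presented_ind=> s; rewrite paddE. Qed.
Fact paddN : left_inverse (comb [::]) (pscale (-1)) padd.
Proof.
elim/presented_ind=> s; rewrite pscaleE paddE -{2}(fscale1 s); apply/combP.
apply: preq_trans (preq_sym (preq_scaleDl _ _ _)) _.
by rewrite addNr; apply: preq_scale0.
Qed.

HB.instance Definition _ :=
  GRing.isZmodule.Build presented paddA paddC padd0 paddN.

Fact pscaleA a b x : pscale a (pscale b x) = pscale (a * b) x.
Proof. by elim/presented_ind: x => s; rewrite !pscaleE fscaleA. Qed.
Fact pscale1 : left_id 1 pscale.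
Proof. by elim/presented_ind=> s; rewrite pscaleE fscale1. Qed.
Fact pscaleDr : right_distributive pscale +%R.
Proof.
move=> a; elim/presented_ind=> s; elim/presented_ind=> t.
by rewrite -[_ + _]/(padd _ _) paddE !pscaleE -[RHS]/(padd _ _) paddE
   /fscale map_cat.
Qed.
Fact pscaleDl x : {morph pscale^~ x : a b / a + b}.
Proof.
move=> a b; elim/presented_ind: x => s; rewrite !pscaleE -[RHS]/(padd _ _) paddE.
exact/combP/preq_scaleDl.
Qed.

HB.instance Definition _ :=
  GRing.Zmodule_isLmodule.Build R presented pscaleA pscale1 pscaleDr pscaleDl.

Definition gen (g : G) : presented := comb [:: (1, g)].

Lemma combD s t : comb (s ++ t) = comb s + comb t.
Proof. by rewrite -[RHS]/(padd _ _) paddE. Qed.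
Lemma combZ a s : comb (fscale a s) = a *: comb s.
Proof. by rewrite -[RHS]/(pscale _ _) pscaleE. Qed.

Lemma combE s : comb s = \sum_(u <- s) u.1 *: gen u.2.
Proof.
elim: s => [|[a g] s IHs]; first by rewrite big_nil.
by rewrite big_cons -IHs -combZ -combD /= mulr1.
Qed.

Lemma comb_rel s t : rel s t -> comb s = comb t.
Proof.
by move=> st; apply/combP; rewrite -(fscale1 s) -(fscale1 t); apply: preq_rel.
Qed.

Section Lift.
Variables (M : lmodType R) (f : G -> M).
Definition feval (s : seq (R * G)) : M := \sum_(u <- s) u.1 *: f u.2.
Hypothesis frel : forall s t, rel s t -> feval s = feval t.

Lemma fevalZ a s : feval (fscale a s) = a *: feval s.
Proof.
by rewrite /feval big_map scaler_sumr; apply: eq_bigr => u _; rewrite scalerA.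
Qed.

Lemma feval_preq s t : preq s t -> feval s = feval t.
Proof.
elim=> {s t} [//|s t _ -> //|s t u _ -> _ //|s s' t t' _ IHs _ IHt|s t|b c g|g|b s t rst].
- by rewrite /feval !big_cat -/(feval _) -/(feval _) IHs IHt.
- by rewrite /feval !big_cat /= addrC.
- by rewrite /feval big_seq1 !big_cons big_nil addr0 scalerDl.
- by rewrite /feval big_seq1 big_nil scale0r.
- by rewrite !fevalZ (frel rst).
Qed.

Definition plift (x : presented) : M := feval (repr x).

Lemma plift_comb s : plift (comb s) = feval s.
Proof. exact/feval_preq/preq_repr. Qed.

Lemma plift_linear : linear plift.
Proof.
move=> a; elim/presented_ind=> s; elim/presented_ind=> t.
by rewrite -combZ -combD !plift_comb -fevalZ /feval big_cat.
Qed.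

Lemma plift_gen g : plift (gen g) = f g.
Proof. by rewrite plift_comb /feval big_seq1 scale1r. Qed.

End Lift.

Lemma presented_ext (M : lmodType R) (f1 f2 : {linear presented -> M}) :
  (forall g, f1 (gen g) = f2 (gen g)) -> forall x, f1 x = f2 x.
Proof.
move=> H; elim/presented_ind=> s; rewrite combE !linear_sum.
by apply: eq_bigr => u _; rewrite !linearZ H.
Qed.

End Presentation.

Definition restr (R S : comPzRingType) (phi : {rmorphism R -> S})
  (N : lmodType S) : Type := N.

Section ExtensionOfScalars.
Variables (R S : comPzRingType) (phi : {rmorphism R -> S}).

(* [:: (a1, x1); ...; (an, xn)] stands for a1 (x) x1 + ... + an (x) xn in the
   tensor product of S and X over R. *)
Inductive tens_rel (X : lmodType R) : seq (S * X) -> seq (S * X) -> Prop :=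
| tens_relD a x y : tens_rel [:: (a, x + y)] [:: (a, x); (a, y)]
| tens_relZ a r x : tens_rel [:: (a, r *: x)] [:: (a * phi r, x)].

Definition ext (X : lmodType R) : lmodType S := presented (@tens_rel X).

Definition tens (X : lmodType R) (a : S) (x : X) : ext X :=
  comb (@tens_rel X) [:: (a, x)].

Lemma tensE (X : lmodType R) a (x : X) : tens a x = a *: tens 1 x.
Proof. by rewrite /tens -combZ /= mulr1. Qed.

Lemma tensDr (X : lmodType R) a (x y : X) : tens a (x + y) = tens a x + tens a y.
Proof. by rewrite /tens -combD /=; apply/comb_rel/tens_relD. Qed.

Lemma tensZr (X : lmodType R) a r (x : X) : tens a (r *: x) = tens (a * phi r) x.
Proof. exact/comb_rel/tens_relZ. Qed.

Section Restr.
Variable N : lmodType S.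
HB.instance Definition _ := GRing.Zmodule.on (restr phi N).
Definition rscale (r : R) (x : restr phi N) : restr phi N := phi r *: (x : N).
Fact rscaleA a b x : rscale a (rscale b x) = rscale (a * b) x.
Proof. by rewrite /rscale scalerA rmorphM. Qed.
Fact rscale1 : left_id 1 rscale.
Proof. by move=> x; rewrite /rscale rmorph1 scale1r. Qed.
Fact rscaleDr : right_distributive rscale +%R.
Proof. by move=> a x y; rewrite /rscale scalerDr. Qed.
Fact rscaleDl x : {morph rscale^~ x : a b / a + b}.
Proof. by move=> a b; rewrite /rscale rmorphD scalerDl. Qed.
HB.instance Definition _ :=
  GRing.Zmodule_isLmodule.Build R (restr phi N) rscaleA rscale1 rscaleDr rscaleDl.
End Restr.

Section Adjunction.
Variables (X : lmodType R) (N : lmodType S) (f : {linear X -> restr phi N}).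

Fact ext_lift_rel s t : tens_rel s t ->
  feval (f : X -> N) s = feval (f : X -> N) t.
Proof.
case=> [a x y|a r x]; rewrite /feval ?big_cons !big_nil !addr0 /=.
  by rewrite linearD scalerDr.
by rewrite linearZ /= [X in _ *: X]/(phi r *: (f x : N)) scalerA.
Qed.

Definition ext_lift : ext X -> N := plift (f : X -> N).
HB.instance Definition _ :=
  GRing.isLinear.Build S (ext X) N *:%R ext_lift (plift_linear ext_lift_rel).

Lemma ext_lift_tens a x : ext_lift (tens a x) = a *: (f x : N).
Proof.
rewrite tensE linearZ /=; congr (_ *: _); exact: (plift_gen ext_lift_rel).
Qed.
End Adjunction.

Lemma ext_eq (X : lmodType R) (N : lmodType S) (f1 f2 : {linear ext X -> N}) :
  (forall x, f1 (tens 1 x) = f2 (tens 1 x)) -> f1 = f2.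
Proof. by move=> H; apply/linearP_ext/presented_ext => x; apply: H. Qed.

Definition ext_unit (X : lmodType R) (x : X) : restr phi (ext X) := tens 1 x.
Fact ext_unit_linear X : linear (@ext_unit X).
Proof.
move=> a x y; rewrite /ext_unit tensDr tensZr mul1r tensE.
by [].
Qed.
HB.instance Definition _ X :=
  GRing.isLinear.Build R X (restr phi (ext X)) *:%R (@ext_unit X)
    (@ext_unit_linear X).

Definition ext_map (X Y : lmodType R) (f : {linear X -> Y}) :
    {linear ext X -> ext Y} :=
  ext_lift (@ext_unit Y \o f).

Lemma ext_mapE (X Y : lmodType R) (f : {linear X -> Y}) a x :
  ext_map f (tens a x) = tens a (f x).
Proof. by rewrite /ext_map /= ext_lift_tens /= [RHS]tensE. Qed.

End ExtensionOfScalars.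

Section Localization.
Variables (R : comPzRingType) (S : mulrClosed R).

Definition denominator := {s : R | s \in S}.
Implicit Types (x y z : R * denominator) (s t : denominator).

(* The pair (a, s) stands for the fraction a / s. *)
Definition loc_eq x y :=
  `[< exists2 u, u \in S & u * (x.1 * sval y.2) = u * (y.1 * sval x.2) >].

Fact loc_eq_refl : reflexive loc_eq.
Proof. by move=> x; apply/asboolP; exists 1; rewrite ?rpred1. Qed.
Fact loc_eq_sym : symmetric loc_eq.
Proof. by move=> x y; apply/asbool_equiv_eq; split=> -[u Su e]; exists u. Qed.
Fact loc_eq_trans : transitive loc_eq.
Proof.
move=> y x z /asboolP[u Su e1] /asboolP[v Sv e2]; apply/asboolP.
exists (u * v * sval y.2); first by rewrite !rpredM //; apply: valP.
transitivity (v * sval z.2 * (u * (x.1 * sval y.2))); first by ring.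
rewrite e1; transitivity (u * sval x.2 * (v * (y.1 * sval z.2))); first by ring.
by rewrite e2; ring.
Qed.
Canonical loc_equiv := EquivRel loc_eq loc_eq_refl loc_eq_sym loc_eq_trans.

Definition loc := {eq_quot loc_eq}.
HB.instance Definition _ : EqQuotient _ loc_eq loc := EqQuotient.on loc.
HB.instance Definition _ := Choice.on loc.

Definition den1 : denominator := exist _ 1 (rpred1 S).
Definition denM s t : denominator :=
  exist _ (sval s * sval t) (rpredM (valP s) (valP t)).

Definition frac x : loc := \pi x.

Lemma fracP x y : frac x = frac y <->
  exists2 u, u \in S & u * (x.1 * sval y.2) = u * (y.1 * sval x.2).
Proof.
by split=> [/eqmodP/asboolP //|xy]; apply/eqmodP/asboolP.
Qed.

Lemma frac_eq x y : x.1 * sval y.2 = y.1 * sval x.2 -> frac x = frac y.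
Proof. by move=> e; apply/fracP; exists 1; rewrite ?rpred1 ?e. Qed.

Lemma frac_ind (P : loc -> Prop) : (forall x, P (frac x)) -> forall a, P a.
Proof. by move=> H a; rewrite -[a]reprK; apply: H. Qed.

Lemma frac_repr x : exists2 u, u \in S &
  u * ((repr (frac x)).1 * sval x.2) = u * (x.1 * sval (repr (frac x)).2).
Proof. by apply/fracP; rewrite [LHS]reprK. Qed.

Definition loc_add (a b : loc) : loc :=
  let x := repr a in let y := repr b in
  frac (x.1 * sval y.2 + y.1 * sval x.2, denM x.2 y.2).
Definition loc_mul (a b : loc) : loc :=
  let x := repr a in let y := repr b in frac (x.1 * y.1, denM x.2 y.2).
Definition loc_opp (a : loc) : loc := let x := repr a in frac (- x.1, x.2).

Lemma loc_addE x y :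
  loc_add (frac x) (frac y) = frac (x.1 * sval y.2 + y.1 * sval x.2, denM x.2 y.2).
Proof.
have [u Su eu] := frac_repr x; have [v Sv ev] := frac_repr y.
rewrite /loc_add; move: (repr (frac x)) (repr (frac y)) eu ev => x' y' eu ev.
apply/fracP; exists (u * v); rewrite ?rpredM //=.
transitivity (v * (sval y.2 * sval y'.2) * (u * (x'.1 * sval x.2))
   + u * (sval x.2 * sval x'.2) * (v * (y'.1 * sval y.2))); first by ring.
by rewrite eu ev; ring.
Qed.

Lemma loc_mulE x y : loc_mul (frac x) (frac y) = frac (x.1 * y.1, denM x.2 y.2).
Proof.
have [u Su eu] := frac_repr x; have [v Sv ev] := frac_repr y.
rewrite /loc_mul; move: (repr (frac x)) (repr (frac y)) eu ev => x' y' eu ev.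
apply/fracP; exists (u * v); rewrite ?rpredM //=.
transitivity (u * (x'.1 * sval x.2) * (v * (y'.1 * sval y.2))); first by ring.
by rewrite eu ev; ring.
Qed.

Lemma loc_oppE x : loc_opp (frac x) = frac (- x.1, x.2).
Proof.
have [u Su eu] := frac_repr x; rewrite /loc_opp; move: (repr _) eu => x' eu.
by apply/fracP; exists u => //=; rewrite !mulNr !mulrN eu.
Qed.

Definition loc0 := frac (0, den1).
Definition loc1 := frac (1, den1).

Fact loc_addA : associative loc_add.
Proof.
elim/frac_ind=> x; elim/frac_ind=> y; elim/frac_ind=> z; rewrite !loc_addE.
by apply: frac_eq => /=; ring.
Qed.
Fact loc_addC : commutative loc_add.
Proof.
elim/frac_ind=> x; elim/frac_ind=> y; rewrite !loc_addE.
by apply: frac_eq => /=; ring.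
Qed.
Fact loc_add0 : left_id loc0 loc_add.
Proof. by elim/frac_ind=> x; rewrite loc_addE; apply: frac_eq => /=; ring. Qed.
Fact loc_addN : left_inverse loc0 loc_opp loc_add.
Proof.
by elim/frac_ind=> x; rewrite loc_oppE loc_addE; apply: frac_eq => /=; ring.
Qed.
HB.instance Definition _ :=
  GRing.isZmodule.Build loc loc_addA loc_addC loc_add0 loc_addN.

Fact loc_mulA : associative loc_mul.
Proof.
elim/frac_ind=> x; elim/frac_ind=> y; elim/frac_ind=> z; rewrite !loc_mulE.
by apply: frac_eq => /=; ring.
Qed.
Fact loc_mulC : commutative loc_mul.
Proof.
elim/frac_ind=> x; elim/frac_ind=> y; rewrite !loc_mulE.
by apply: frac_eq => /=; ring.
Qed.
Fact loc_mul1 : left_id loc1 loc_mul.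
Proof. by elim/frac_ind=> x; rewrite loc_mulE; apply: frac_eq => /=; ring. Qed.
Fact loc_mulDl : left_distributive loc_mul loc_add.
Proof.
elim/frac_ind=> x; elim/frac_ind=> y; elim/frac_ind=> z.
by rewrite !(loc_mulE, loc_addE); apply: frac_eq => /=; ring.
Qed.
HB.instance Definition _ :=
  GRing.Zmodule_isComPzRing.Build loc loc_mulA loc_mulC loc_mul1 loc_mulDl.

Definition loc_in (a : R) : loc := frac (a, den1).
Fact loc_in_additive : zmod_morphism loc_in.
Proof.
move=> a b; rewrite -[RHS]/(loc_add _ (loc_opp _)) loc_oppE loc_addE.
by apply: frac_eq => /=; ring.
Qed.
Fact loc_in_multiplicative : monoid_morphism loc_in.
Proof.
split=> // a b; rewrite -[RHS]/(loc_mul _ _) loc_mulE.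
by apply: frac_eq => /=; ring.
Qed.
HB.instance Definition _ :=
  GRing.isZmodMorphism.Build R loc loc_in loc_in_additive.
HB.instance Definition _ :=
  GRing.isMonoidMorphism.Build R loc loc_in loc_in_multiplicative.

End Localization.

Definition powers (R : comPzRingType) (f : R) : {pred R} :=
  fun x => `[< exists m, x = f ^+ m >].
Fact powers_mulr_closed (R : comPzRingType) (f : R) : mulr_closed (powers f).
Proof.
split=> [|x y /asboolP[m ->] /asboolP[m' ->]]; apply/asboolP.
  by exists 0%N; rewrite expr0.
by exists (m + m')%N; rewrite exprD.
Qed.
HB.instance Definition _ (R : comPzRingType) (f : R) :=
  GRing.isMulClosed.Build R (powers f) (powers_mulr_closed f).

Definition compl (R : comNzRingType) (p : prime_idealr R) : {pred R} :=
  fun x => x \notin p.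
Fact compl_mulr_closed (R : comNzRingType) (p : prime_idealr R) :
  mulr_closed (compl p).
Proof.
split=> [|x y Px Py]; first by rewrite -[_ \in _]/(1 \notin p) idealr1.
rewrite -[_ \in _]/(x * y \notin p) prime_idealrM negb_or.
by apply/andP.
Qed.
HB.instance Definition _ (R : comNzRingType) (p : prime_idealr R) :=
  GRing.isMulClosed.Build R (compl p) (compl_mulr_closed p).

Section Spectrum.
Variable R : comNzRingType.
Implicit Types p q : prime_idealr R.

Definition points := prime_idealr R -> Prop.
Implicit Types Z : points.

Definition closure_pt p : points := fun q => {subset p <= q}.

Definition minimal_prime p := forall q, {subset q <= p} -> q =i p.
Definition maximal_prime p := forall q, {subset p <= q} -> q =i p.

Definition prime_chain Z (d : nat) := exists p : 'I_d.+1 -> prime_idealr R,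
  (forall i, Z (p i)) /\
  (forall i j : 'I_d.+1, (i < j)%N ->
     {subset p i <= p j} /\ ~ {subset p j <= p i}).

(* For closed Z: the irreducible closed subsets of Z are the closures of its
   points, so this is the Krull dimension of Z. *)
Definition krull_dim Z (d : nat) :=
  prime_chain Z d /\ forall e, prime_chain Z e -> (e <= d)%N.

(* The irreducible components of Spec R are the V(p) with p a minimal prime;
   all of them are required to have dimension n. *)
Definition equidimensional (n : nat) :=
  forall p, minimal_prime p -> krull_dim (closure_pt p) n.

(* Spec (R / w), as a closed subset of Spec R. *)
Definition spec_quot (w : R) : points := fun p => w \in p.

(* The zero scheme of a section m of M is cut out by the ideal
   { f m | f : M -> R linear }, the image of the map M^* -> R dual to m. *)
Definition zero_locus (M : lmodType R) (m : M) : points :=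
  fun p => forall f : {linear M -> R^o}, (f m : R) \in p.

Definition free_of_rank (A : comPzRingType) (n : nat) (M : lmodType A) :=
  exists f : {linear 'rV[A]_n -> M}, bijective f.

Definition locally_free (n : nat) (M : lmodType R) :=
  forall p, exists2 f, f \notin p &
    free_of_rank n (ext (@loc_in R (powers f)) M).

End Spectrum.

Section Algebra.
Variables (k : fieldType) (R : comAlgType k).

Definition finite_type (A : comAlgType k) := exists s : seq A,
  forall P : {pred A}, GRing.subalg_closed P -> {subset s <= P} ->
    forall x, x \in P.

Definition essentially_of_finite_type :=
  exists (A : comAlgType k) (S : mulrClosed A) (f : {rmorphism loc S -> R}),
    [/\ finite_type A, bijective f & forall c : k, f (loc_in S c%:A) = c%:A].

(* In the module of differentials the generator [a] stands for da. *)
Inductive kahler_rel : seq (R * R) -> seq (R * R) -> Prop :=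
| kahlerD a b : kahler_rel [:: (1, a + b)] [:: (1, a); (1, b)]
| kahlerM a b : kahler_rel [:: (1, a * b)] [:: (a, b); (b, a)]
| kahlerC (c : k) : kahler_rel [:: (1, c%:A)] [::].

Definition kahler : lmodType R := presented kahler_rel.
Definition kahler_d (a : R) : kahler := gen kahler_rel a.

Definition residue_field_is_base (p : prime_idealr R) :=
  bijective (fun c : k => \pi_({ideal_quot p}) c%:A).

(* The zero locus of dw, restricted to Spec (R / w), is 0-dimensional and
   supported on the closed point s, whose residue field is k. *)
Definition isolated_critical_point (w : R) (s : prime_idealr R) :=
  let Z := fun p => spec_quot w p /\ zero_locus (kahler_d w) p in
  [/\ krull_dim Z 0, forall p, Z p <-> p =i s, maximal_prime s
    & residue_field_is_base s].

End Algebra.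

Definition dcast (H : bool -> zmodType) i j (e : i = j) (u : H i) : H j :=
  ecast l (H l) e u.

(* Degrees in Z/2 are booleans, with sum (+) and successor ~~. *)
Record dgcat := DgCat {
  dg_ob :> Type;
  dg_hom : dg_ob -> dg_ob -> bool -> zmodType;
  dg_d : forall x y i, {additive dg_hom x y i -> dg_hom x y (~~ i)};
  dg_id : forall x, dg_hom x x false;
  dg_comp : forall x y z i j,
    dg_hom y z i -> dg_hom x y j -> dg_hom x z (i (+) j);
  dg_dd : forall x y i (f : dg_hom x y i), dg_d x y (~~ i) (dg_d x y i f) = 0;
  dg_d_id : forall x, dg_d x x false (dg_id x) = 0;
  dg_compDl : forall x y z i j (f f' : dg_hom y z i) (g : dg_hom x y j),
    dg_comp (f + f') g = dg_comp f g + dg_comp f' g;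
  dg_compDr : forall x y z i j (f : dg_hom y z i) (g g' : dg_hom x y j),
    dg_comp f (g + g') = dg_comp f g + dg_comp f g';
  dg_comp_idl : forall x y i (f : dg_hom x y i), dg_comp (dg_id y) f = f;
  dg_comp_idr : forall x y i (f : dg_hom x y i),
    dcast (addbF i) (dg_comp f (dg_id x)) = f;
  dg_compA : forall x y z t i j l
      (f : dg_hom z t i) (g : dg_hom y z j) (h : dg_hom x y l),
    dcast (addbA i j l) (dg_comp f (dg_comp g h)) = dg_comp (dg_comp f g) h;
  dg_leibniz : forall x y z i j (f : dg_hom y z i) (g : dg_hom x y j),
    dg_d x z (i (+) j) (dg_comp f g) =
      dcast (addNb i j) (dg_comp (dg_d y z i f) g) +
      (let v := dcast (addbN i j) (dg_comp f (dg_d x y j g)) in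
       if i then - v else v)
}.

Arguments dg_d {d x y i}.
Arguments dg_id {d} x.

Section Homotopy.
Variable C : dgcat.

(* Every degree of Z/2 is of the form ~~ i. *)
Definition cohomologous (x y : C) i (f g : dg_hom x y (~~ i)) :=
  exists h : dg_hom x y i, dg_d h = f - g.

(* Isomorphism in the homotopy category, whose morphisms are the classes in
   H^0 of the morphism complexes. *)
Definition homotopy_iso (x y : C) :=
  exists (f : dg_hom x y false) (g : dg_hom y x false),
    [/\ dg_d f = 0, dg_d g = 0,
        cohomologous (i := true) (dg_comp g f) (dg_id x)
      & cohomologous (i := true) (dg_comp f g) (dg_id y)].

End Homotopy.

Record dgfunctor (C D : dgcat) := DgFunctor {
  fun_ob :> C -> D;
  fun_hom : forall (x y : C) i,
    {additive dg_hom x y i -> dg_hom (fun_ob x) (fun_ob y) i};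
  fun_d : forall (x y : C) i (f : dg_hom x y i),
    fun_hom x y (~~ i) (dg_d f) = dg_d (fun_hom x y i f);
  fun_id : forall x : C, fun_hom x x false (dg_id x) = dg_id (fun_ob x);
  fun_comp : forall (x y z : C) i j (f : dg_hom y z i) (g : dg_hom x y j),
    fun_hom x z (i (+) j) (dg_comp f g) =
      dg_comp (fun_hom y z i f) (fun_hom x y j g)
}.

Arguments fun_hom {C D} F {x y i} : rename.

Section QuasiEquivalence.
Variables (C D : dgcat) (F : dgfunctor C D).

(* The map induced by F on the cohomology of dg_hom x y is bijective in each
   degree. *)
Definition quasi_iso_on (x y : C) := forall i,
  (forall f g : dg_hom x y (~~ i), dg_d f = 0 -> dg_d g = 0 ->
     cohomologous (fun_hom F f) (fun_hom F g) -> cohomologous f g) /\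
  (forall g : dg_hom (F x) (F y) (~~ i), dg_d g = 0 ->
     exists2 f : dg_hom x y (~~ i), dg_d f = 0 & cohomologous (fun_hom F f) g).

Definition quasi_equivalence :=
  (forall x y : C, quasi_iso_on x y) /\
  (forall y : D, exists x : C, homotopy_iso (F x) y).

End QuasiEquivalence.

Definition projective (R : pzRingType) (P : lmodType R) :=
  forall (M N : lmodType R) (g : {linear M -> N}) (f : {linear P -> N}),
    (forall y, exists x, g x = y) ->
    exists h : {linear P -> M}, forall x, g (h x) = f x.

(* X = X^0 (+) X^1 with X^0 = mf_mod false and X^1 = mf_mod true; the odd
   endomorphism d is given by its components mf_d0 and mf_d1. *)
Record mf (R : comPzRingType) (w : R) := MF {
  mf_mod :> bool -> lmodType R;
  mf_proj : forall i, projective (mf_mod i);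
  mf_d0 : {linear mf_mod false -> mf_mod true};
  mf_d1 : {linear mf_mod true -> mf_mod false};
  mf_d10 : forall x, mf_d1 (mf_d0 x) = w *: x;
  mf_d01 : forall x, mf_d0 (mf_d1 x) = w *: x
}.

Definition lcomp (R : pzRingType) (U V W : lmodType R)
  (g : {linear V -> W}) (f : {linear U -> V}) : {linear U -> W} := g \o f.

Definition lid (R : pzRingType) (U : lmodType R) : {linear U -> U} := idfun.

Section MF.
Variables (R : comPzRingType) (w : R).
Implicit Types X Y Z T : mf w.

(* A homogeneous map of degree i is given by its restrictions
   X^0 -> Y^i and X^1 -> Y^(i + 1). *)
Definition mf_hom X Y (i : bool) : zmodType :=
  ({linear X false -> Y i} * {linear X true -> Y (~~ i)})%type.

Definition mf_id X : mf_hom X X false := (lid (X false), lid (X true)).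

Definition mf_comp X Y Z (i j : bool) :
    mf_hom Y Z i -> mf_hom X Y j -> mf_hom X Z (i (+) j) :=
  match i, j return mf_hom Y Z i -> mf_hom X Y j -> mf_hom X Z (i (+) j) with
  | false, false => fun f g => (lcomp f.1 g.1, lcomp f.2 g.2)
  | true, false => fun f g => (lcomp f.1 g.1, lcomp f.2 g.2)
  | false, true => fun f g => (lcomp f.2 g.1, lcomp f.1 g.2)
  | true, true => fun f g => (lcomp f.2 g.1, lcomp f.1 g.2)
  end.

(* d f = d \o f - (-1)^|f| f \o d *)
Definition mf_d X Y (i : bool) : mf_hom X Y i -> mf_hom X Y (~~ i) :=
  match i return mf_hom X Y i -> mf_hom X Y (~~ i) with
  | false => fun f => (lcomp (mf_d0 Y) f.1 - lcomp f.2 (mf_d0 X),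
                       lcomp (mf_d1 Y) f.2 - lcomp f.1 (mf_d1 X))
  | true => fun f => (lcomp (mf_d1 Y) f.1 + lcomp f.2 (mf_d0 X),
                      lcomp (mf_d0 Y) f.2 + lcomp f.1 (mf_d1 X))
  end.

Lemma mf_hom_ext X Y i (f g : mf_hom X Y i) :
  f.1 =1 g.1 -> f.2 =1 g.2 -> f = g.
Proof.
case: f g => [f1 f2] [g1 g2] /= e1 e2.
by congr (_, _); apply: linearP_ext.
Qed.

Lemma dcastE (H : bool -> zmodType) i (e : i = i) (u : H i) : dcast e u = u.
Proof. by rewrite /dcast (eq_irrelevance e erefl). Qed.

Fact mf_d_additive X Y i : zmod_morphism (@mf_d X Y i).
Proof.
by case: i => f g; apply: mf_hom_ext => x;
  rewrite /= linearB !opprD ?opprK (AC (2*2) ((1*3)*(2*4))).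
Qed.
HB.instance Definition _ X Y i :=
  GRing.isZmodMorphism.Build (mf_hom X Y i) (mf_hom X Y (~~ i)) (@mf_d X Y i)
    (@mf_d_additive X Y i).

Fact mf_dd X Y i (f : mf_hom X Y i) : mf_d (mf_d f) = 0.
Proof.
by case: i f => f; apply: mf_hom_ext => x;
  rewrite /= ?(linearB, linearD) /= ?(mf_d10, mf_d01) linearZ /= addrA
    ?(addrK, subrK) addrN.
Qed.

Fact mf_d_id X : mf_d (mf_id X) = 0.
Proof. by apply: mf_hom_ext => x; rewrite /= addrN. Qed.

Fact mf_compDl X Y Z i j (f f' : mf_hom Y Z i) (g : mf_hom X Y j) :
  mf_comp (f + f') g = mf_comp f g + mf_comp f' g.
Proof. by case: i j f f' g => -[] f f' g; apply: mf_hom_ext. Qed.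

Fact mf_compDr X Y Z i j (f : mf_hom Y Z i) (g g' : mf_hom X Y j) :
  mf_comp f (g + g') = mf_comp f g + mf_comp f g'.
Proof.
by case: i j f g g' => -[] f g g'; apply: mf_hom_ext => x; rewrite /= linearD.
Qed.

Fact mf_comp_idl X Y i (f : mf_hom X Y i) : mf_comp (mf_id Y) f = f.
Proof. by case: i f => f; apply: mf_hom_ext. Qed.

Fact mf_comp_idr X Y i (f : mf_hom X Y i) :
  dcast (addbF i) (mf_comp f (mf_id X)) = f.
Proof. by case: i f => f; rewrite dcastE; apply: mf_hom_ext. Qed.

Fact mf_compA X Y Z T i j l
    (f : mf_hom Z T i) (g : mf_hom Y Z j) (h : mf_hom X Y l) :
  dcast (addbA i j l) (mf_comp f (mf_comp g h)) = mf_comp (mf_comp f g) h.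
Proof.
by case: i j l f g h => -[] [] f g h; rewrite dcastE; apply: mf_hom_ext.
Qed.

Fact mf_leibniz X Y Z i j (f : mf_hom Y Z i) (g : mf_hom X Y j) :
  mf_d (mf_comp f g) =
    dcast (addNb i j) (mf_comp (mf_d f) g) +
    (let v := dcast (addbN i j) (mf_comp f (mf_d g)) in if i then - v else v).
Proof.
by case: i j f g => -[] f g /=; rewrite !dcastE; apply: mf_hom_ext => x;
  rewrite /= ?(linearB, linearD) /= ?opprK addrA ?(addrK, subrK).
Qed.

Definition mf_dgcat : dgcat :=
  @DgCat (mf w) mf_hom (fun X Y i => @mf_d X Y i) mf_id mf_comp
    mf_dd mf_d_id mf_compDl mf_compDr mf_comp_idl mf_comp_idr mf_compA
    mf_leibniz.

End MF.

Section BaseChange.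
Variables (R S : comPzRingType) (phi : {rmorphism R -> S}) (w : R).

Lemma ext_projective (P : lmodType R) : projective P -> projective (ext phi P).
Proof.
move=> projP M N g f gsurj.
pose g' : restr phi M -> restr phi N := g.
have g'lin : linear g' by move=> a x y; rewrite /g' linearD;
    congr (_ + _); exact: (linearZ_LR g (phi a) x).
pose gL := GRing.isLinear.Build R (restr phi M) (restr phi N) *:%R g' g'lin.
pose g'' : {linear restr phi M -> restr phi N} := HB.pack g' gL.
pose f' : P -> restr phi N := fun x => f (tens phi 1 x).
have f'lin : linear f'.
  move=> a x y; rewrite /f' tensDr tensZr mul1r tensE linearD; congr (_ + _).
  exact: (linearZ_LR f (phi a) (tens phi 1 x)).
pose fL := GRing.isLinear.Build R P (restr phi N) *:%R f' f'lin.
pose f'' : {linear P -> restr phi N} := HB.pack f' fL.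
have [h hP] := projP _ _ g'' f'' gsurj.
exists (ext_lift h) => x; rewrite -[LHS]/((lcomp g (ext_lift h)) x).
congr (GRing.Linear.sort _ x); apply: ext_eq => y /=.
by rewrite ext_lift_tens scale1r; apply: hP.
Qed.

Lemma ext_map_comp (X Y Z : lmodType R) (g : {linear Y -> Z})
  (f : {linear X -> Y}) :
  ext_map phi (lcomp g f) = lcomp (ext_map phi g) (ext_map phi f).
Proof. by apply: ext_eq => x; rewrite /= !ext_mapE. Qed.

Lemma ext_map_id (X : lmodType R) : ext_map phi (lid X) = lid (ext phi X).
Proof. by apply: ext_eq => x; rewrite /= ext_mapE. Qed.

Fact ext_map_additive (X Y : lmodType R) : zmod_morphism (@ext_map R S phi X Y).
Proof.
move=> f g; apply: ext_eq => x; rewrite /= !ext_mapE /=.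
exact: (linearB (@ext_unit _ _ phi Y)).
Qed.

Lemma ext_mapD (X Y : lmodType R) (f g : {linear X -> Y}) :
  ext_map phi (f + g) = ext_map phi f + ext_map phi g.
Proof.
apply: ext_eq => x; rewrite /= !ext_mapE /=.
exact: (linearD (@ext_unit _ _ phi Y)).
Qed.

Section Objects.
Variable X : mf w.

Definition ext_mod (i : bool) : lmodType S := ext phi (X i).

Fact ext_d10 (x : ext_mod false) :
  ext_map phi (mf_d1 X) (ext_map phi (mf_d0 X) x) = phi w *: x.
Proof.
rewrite -[LHS]/(lcomp (ext_map phi (mf_d1 X)) (ext_map phi (mf_d0 X)) x).
rewrite -ext_map_comp; elim/presented_ind: x => s.
rewrite combE scaler_sumr linear_sum; apply: eq_bigr => -[a x] _ /=.
rewrite linearZ /= scalerA mulrC -scalerA; congr (_ *: _).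
rewrite -[gen _ x]/(tens phi 1 x) ext_mapE /= mf_d10 tensZr mul1r.
exact: tensE.
Qed.
Fact ext_d01 (x : ext_mod true) :
  ext_map phi (mf_d0 X) (ext_map phi (mf_d1 X) x) = phi w *: x.
Proof.
rewrite -[LHS]/(lcomp (ext_map phi (mf_d0 X)) (ext_map phi (mf_d1 X)) x).
rewrite -ext_map_comp; elim/presented_ind: x => s.
rewrite combE scaler_sumr linear_sum; apply: eq_bigr => -[a x] _ /=.
rewrite linearZ /= scalerA mulrC -scalerA; congr (_ *: _).
rewrite -[gen _ x]/(tens phi 1 x) ext_mapE /= mf_d01 tensZr mul1r.
exact: tensE.
Qed.

Definition mf_ext : mf (phi w) :=
  @MF S (phi w) ext_mod (fun i => ext_projective (@mf_proj _ _ X i))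
    (ext_map phi (mf_d0 X)) (ext_map phi (mf_d1 X)) ext_d10 ext_d01.
End Objects.

Definition mf_ext_hom (X Y : mf w) (i : bool) (f : mf_hom X Y i) :
    mf_hom (mf_ext X) (mf_ext Y) i :=
  (ext_map phi f.1, ext_map phi f.2).

Fact mf_ext_hom_additive X Y i : zmod_morphism (@mf_ext_hom X Y i).
Proof. by move=> f g; congr (_, _); apply: ext_map_additive. Qed.
HB.instance Definition _ X Y i :=
  GRing.isZmodMorphism.Build (mf_hom X Y i) (mf_hom (mf_ext X) (mf_ext Y) i)
    (@mf_ext_hom X Y i) (@mf_ext_hom_additive X Y i).

Fact mf_ext_d X Y i (f : mf_hom X Y i) :
  mf_ext_hom (mf_d f) = mf_d (mf_ext_hom f).
Proof.
by case: i f => f; congr (_, _);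
  rewrite (ext_map_additive, ext_mapD) !ext_map_comp.
Qed.

Fact mf_ext_id X : mf_ext_hom (mf_id X) = mf_id (mf_ext X).
Proof. by congr (_, _); apply: ext_map_id. Qed.

Fact mf_ext_comp X Y Z i j (f : mf_hom Y Z i) (g : mf_hom X Y j) :
  mf_ext_hom (mf_comp f g) = mf_comp (mf_ext_hom f) (mf_ext_hom g).
Proof. by case: i j f g => -[] f g; congr (_, _); apply: ext_map_comp. Qed.

Definition mf_base_change : dgfunctor (mf_dgcat w) (mf_dgcat (phi w)) :=
  @DgFunctor (mf_dgcat w) (mf_dgcat (phi w)) mf_ext (fun X Y i => @mf_ext_hom X Y i)
    mf_ext_d mf_ext_id mf_ext_comp.

End BaseChange.

(* Main.v *)
(* Let I be the ideal generated by w and the D(w), D a k-derivation of R. Every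
   element of I is null-homotopic on every matrix factorization X, over R and
   over R_s: for a connection nabla along D on X, the map [nabla, d] is linear
   and [[nabla, d], d] = D(w). The point s is generated by finitely many x_i,
   because its residue field is k, and c_i := x_i^(N_i) lies in I because s is
   the only prime containing I. So every t outside s is invertible modulo
   (c_1, ..., c_m).

   Morphisms. If M is a curved R-module with M_s = 0, then Hom(X, M) is acyclic,
   by induction on the number of c_i that do not kill M: by the induction
   hypothesis for the kernel and the cokernel of c_i on M, multiplication by c_i
   on Hom(X, M) is a quasi-isomorphism, but it is null-homotopic. Apply this to
   the kernel and the cokernel of Y -> Y_s.

   Objects. Let Y live over R_s, with underlying module L_s, L free over R. The
   map of Koszul complexes K(c; L) -> K(c; L_s) is a quasi-isomorphism of bounded
   complexes of R-modules with projective source, so the differential of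
   K(c; L_s) (x) Y is carried, by an automorphism congruent to 1 for the Koszul
   filtration, to one defined over R. As the c_i are null-homotopic on Y, this
   makes Y a retract of some X_s. Finally, an Eilenberg swindle realizes Y itself. *)

Require Import Defs.
From mathcomp Require Import all_boot all_order all_algebra.
From HB Require Import structures.
From mathcomp Require Import ring.
From mathcomp Require Import boolp classical_sets.

Set Implicit Arguments.
Unset Strict Implicit.
Unset Printing Implicit Defensive.

Import GRing.Theory.
Local Open Scope ring_scope.
Local Open Scope quotient_scope.

(** The obstacle is infinite rank. A map into a localized module has no common denominator, so that
    Hom(X, Y)_s need not be Hom(X_s, Y_s), and no single t clears the denominators of a differential
    over R_s. Torsion of unbounded exponent has to be faced. What makes it harmless is that Hom(X,
    -) is exact for projective X, while the c_i act on it as zero up to homotopy and generate the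
    unit ideal together with any t outside s.

    For objects the Koszul complex plays the same part: a class in the homology of the cone of K(c;
    L) -> K(c; L_s) is killed by the c_i and by some t outside s, hence is zero. The bounded grading
    leaves finitely many obstructions to transferring the differential, and exactness of the cone
    removes each of them. The retract cannot be split directly over R, because its projector lifts
    only up to homotopy; the swindle replaces its image by the cone of a map between countable sums,
    which makes sense over R for any lift. *)

(** * Modules and projectivity *)

(* The square-zero extension of A by M makes [ring] decide identities in M. *)
Definition sqz (A : comPzRingType) (M : lmodType A) : Type := (A * M)%type.

Section SquareZero.
Variables (A : comPzRingType) (M : lmodType A).
HB.instance Definition _ := GRing.Zmodule.on (sqz M).
Implicit Types x y z : sqz M.

Definition sqz_one : sqz M := (1, 0).
Definition sqz_mul x y : sqz M := (x.1 * y.1, x.1 *: y.2 + y.1 *: x.2).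

Fact sqz_mulC : commutative sqz_mul.
Proof. by move=> x y; congr (_, _); rewrite /= 1?mulrC // addrC. Qed.
Fact sqz_mulA : associative sqz_mul.
Proof.
move=> x y z; congr (_, _); rewrite /= ?mulrA //.
by rewrite !scalerDr !scalerA addrA [z.1 * _]mulrC [z.1 * _]mulrC.
Qed.
Fact sqz_mul1 : left_id sqz_one sqz_mul.
Proof. by case=> a m; congr (_, _); rewrite /= ?mul1r // scale1r scaler0 addr0. Qed.
Fact sqz_mulDl : left_distributive sqz_mul +%R.
Proof.
move=> x y z; congr (_, _); rewrite /= ?mulrDl //.
by rewrite scalerDl scalerDr addrACA.
Qed.
HB.instance Definition _ :=
  GRing.Zmodule_isComPzRing.Build (sqz M) sqz_mulA sqz_mulC sqz_mul1 sqz_mulDl.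

Definition sqz_in (m : M) : sqz M := (0, m).
Definition sqz_scal (a : A) : sqz M := (a, 0).

Lemma sqz_in_inj (m n : M) : sqz_in m = sqz_in n -> m = n.
Proof. by case. Qed.
Lemma sqz_in0 : sqz_in 0 = 0. Proof. by []. Qed.
Lemma sqz_inD m n : sqz_in (m + n) = sqz_in m + sqz_in n.
Proof. by congr (_, _); rewrite /= addr0. Qed.
Lemma sqz_inN m : sqz_in (- m) = - sqz_in m.
Proof. by congr (_, _); rewrite /= oppr0. Qed.
Lemma sqz_inZ a m : sqz_in (a *: m) = sqz_scal a * sqz_in m.
Proof. by congr (_, _); rewrite /= ?mulr0 // scale0r addr0. Qed.
Lemma sqz_scal1 : sqz_scal 1 = 1. Proof. by []. Qed.
Lemma sqz_scal0 : sqz_scal 0 = 0. Proof. by []. Qed.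
Lemma sqz_scalD a b : sqz_scal (a + b) = sqz_scal a + sqz_scal b.
Proof. by congr (_, _); rewrite /= addr0. Qed.
Lemma sqz_scalN a : sqz_scal (- a) = - sqz_scal a.
Proof. by congr (_, _); rewrite /= oppr0. Qed.
Lemma sqz_scalM a b : sqz_scal (a * b) = sqz_scal a * sqz_scal b.
Proof. by congr (_, _); rewrite /= !scaler0 addr0. Qed.
End SquareZero.

Definition sqzE := (sqz_in0, sqz_inD, sqz_inN, sqz_inZ,
  sqz_scal1, sqz_scal0, sqz_scalD, sqz_scalN, sqz_scalM).

Ltac module := apply: sqz_in_inj; rewrite ?sqzE; ring.

Section LinearMaps.
Variable A : comPzRingType.
Implicit Types U V W : lmodType A.

Definition mklin U V (f : U -> V) (flin : linear f) : {linear U -> V} :=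
  HB.pack f (GRing.isLinear.Build A U V *:%R f flin).

Definition lscale U V (a : A) (f : {linear U -> V}) : {linear U -> V}.
Proof. by refine (@mklin U V (fun x => a *: f x) _) => b x y; rewrite linearP;
  module. Defined.

Definition lpair U V W (f : {linear U -> V}) (g : {linear U -> W}) :
  {linear U -> (V * W)%type}.
Proof. by refine (mklin (f := fun x => (f x, g x)) _) => b x y; rewrite !linearP. Defined.

Definition lcase U V W (f : {linear U -> W}) (g : {linear V -> W}) :
  {linear (U * V)%type -> W}.
Proof.
by refine (mklin (f := fun x => f x.1 + g x.2) _) => b x y; rewrite !linearP /=; module.
Defined.

Definition linl U V : {linear U -> (U * V)%type} := lpair (lid U) \0.
Definition linr U V : {linear V -> (U * V)%type} := lpair \0 (lid V).
Definition lfst U V : {linear (U * V)%type -> U}.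
Proof. by refine (mklin (f := fst) _). Defined.
Definition lsnd U V : {linear (U * V)%type -> V}.
Proof. by refine (mklin (f := snd) _). Defined.

End LinearMaps.

Section Selection.
Variables (A : comPzRingType) (U V : lmodType A) (G : U -> V -> Prop).
Definition linear_relation :=
  G 0 0 /\ forall a x y x' y', G x y -> G x' y' -> G (a *: x + x') (a *: y + y').
Hypothesis Glin : linear_relation.

Definition graph : {pred (U * V)%type} := fun u => `[< G u.1 u.2 >].
Fact graph_closed : submod_closed graph.
Proof.
split=> [|a u v /asboolP Gu /asboolP Gv]; apply/asboolP; first exact: Glin.1.
exact: Glin.2.
Qed.
HB.instance Definition _ :=
  GRing.isSubmodClosed.Build A (U * V)%type graph (@GRing.submod_closed_semi _ _ _
    graph_closed).
HB.instance Definition _ :=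
  GRing.isOppClosed.Build _ graph (GRing.zmod_closedN (GRing.submod_closedB
    graph_closed)).
Record graph_of := GraphOf { graph_val : (U * V)%type; _ : graph_val \in graph }.
HB.instance Definition _ := [isSub for graph_val].
HB.instance Definition _ := gen_eqMixin graph_of.
HB.instance Definition _ := [Choice of graph_of by <:].
HB.instance Definition _ := [SubChoice_isSubLmodule of graph_of by <:].

(** The graph of a total linear relation is a submodule of [U * V] that surjects onto [U], and a
    splitting of this surjection makes the choice linear. Lifting problems with side conditions,
    such as equations or membership in submodules, all take this form. *)
Lemma linear_selection : projective U -> (forall x, exists y, G x y) ->
  exists h : {linear U -> V}, forall x, G x (h x).
Proof.
move=> projU tot.
have p1lin : linear (fun u : graph_of => (val u).1) by move=> a u v; rewrite linearP.
have p2lin : linear (fun u : graph_of => (val u).2) by move=> a u v; rewrite linearP.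
have [|h hE] := projU _ _ (mklin p1lin) (lid U).
  by move=> x; have [y /asboolP Gxy] := tot x; exists (GraphOf (Gxy : (x, y) \in graph)).
exists (lcomp (mklin p2lin) h) => x.
by have /asboolP := valP (h x); rewrite -[(val (h x)).1]/(mklin p1lin (h x)) hE.
Qed.
End Selection.

Section Projective.
Variable A : comPzRingType.
Implicit Types U V W : lmodType A.

Lemma proj_lift U V W (g : {linear V -> W}) (f : {linear U -> W}) :
  projective U -> (forall x, exists y, g y = f x) ->
  exists h : {linear U -> V}, forall x, g (h x) = f x.
Proof.
move=> projU fg; apply: (@linear_selection A U V (fun x y => g y = f x)) => //.
by split=> [|a x y x' y' exy exy']; rewrite ?linear0 // !linearP exy exy'.
Qed.

Lemma projective_prod U V : projective U -> projective V -> projective (U * V)%type.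
Proof.
move=> projU projV M N g f gsurj.
have [h1 h1E] := projU M N g (lcomp f (linl U V)) gsurj.
have [h2 h2E] := projV M N g (lcomp f (linr U V)) gsurj.
exists (lcase h1 h2) => -[x y]; rewrite /= linearD h1E h2E /= -linearD.
by congr (f (_, _)); rewrite /= ?addr0 ?add0r.
Qed.

Definition norel (G : Type) (s t : seq (A * G)) := False.
Definition free_mod (G : choiceType) : lmodType A := presented (@norel G).
Definition fgen (G : choiceType) (g : G) : free_mod G := gen (@norel G) g.

Fact free_map_ex (G : choiceType) V (f : G -> V) :
  exists h : {linear free_mod G -> V}, forall g, h (fgen g) = f g.
Proof.
have frel s t : @norel G s t -> feval f s = feval f t by [].
by exists (mklin (plift_linear frel)) => g; apply: (plift_gen frel).
Qed.

Definition free_map (G : choiceType) V (f : G -> V) : {linear free_mod G -> V} :=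
  sval (cid (free_map_ex f)).

Lemma free_mapE (G : choiceType) V (f : G -> V) g : free_map f (fgen g) = f g.
Proof. exact: (svalP (cid (free_map_ex f))). Qed.

Lemma free_projective (G : choiceType) : projective (free_mod G).
Proof.
move=> M N g f gsurj; have [s sE] := choice gsurj.
exists (free_map (fun x : G => s (f (fgen x)))) => x.
rewrite -[LHS]/(lcomp g (free_map _) x); move: x; apply: presented_ext => x.
by rewrite -[gen _ _]/(fgen _) /= free_mapE sE.
Qed.

Definition coordf (G : choiceType) (g : G) : {linear free_mod G -> A^o} :=
  free_map (fun g' => (g' == g)%:R : A^o).

(** Finiteness of the support is what later lets one element of [S] annihilate all coordinates at
    once. A word may repeat a generator, so its coefficients are collected over the list without
    duplicates. *)
Lemma free_coordE (G : choiceType) (x : free_mod G) :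
  exists2 s : seq G, uniq s & x = \sum_(g <- s) (coordf g x : A) *: fgen g.
Proof.
elim/presented_ind: x => s; rewrite combE.
exists (undup [seq u.2 | u <- s]); first exact: undup_uniq.
have ss : {subset [seq u.2 | u <- s] <= undup [seq u.2 | u <- s]}.
  by move=> g; rewrite mem_undup.
transitivity (\sum_(g <- undup [seq u.2 | u <- s]) \sum_(u <- s)
   (u.1 * (u.2 == g)%:R) *: fgen g); last first.
  apply: eq_bigr => g _; rewrite linear_sum /= scaler_suml; apply: eq_bigr => u _.
  by rewrite linearZ /= -[gen _ _]/(fgen _) free_mapE.
rewrite exchange_big /=; apply: eq_big_seq => u us.
rewrite (bigD1_seq u.2) ?undup_uniq //=; last by apply/ss/map_f.
rewrite eqxx mulr1 big1 ?addr0 // => g gu.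
by rewrite eq_sym (negPf gu) mulr0 scale0r.
Qed.

End Projective.

(** * Localization of modules *)

(** An elementwise characterization of localization at [S]. The homological arguments rest on it
    alone and never see the construction by fractions. *)
Record is_localization (A B : comPzRingType) (phi : {rmorphism A -> B})
    (S : A -> Prop) : Prop := IsLocalization {
  locz1 : S 1;
  loczM : forall s t, S s -> S t -> S (s * t);
  locz_inv : forall t, S t -> exists b, b * phi t = 1;
  locz_frac : forall b, exists t a, S t /\ phi t * b = phi a;
  locz_ker : forall a, phi a = 0 -> exists2 t, S t & t * a = 0
}.

Lemma linear_inverse (A : pzRingType) (U V : lmodType A) (f : {linear U -> V}) :
  injective f -> (forall y, exists x, f x = y) ->
  exists g : {linear V -> U}, cancel f g /\ cancel g f.
Proof.
move=> finj fsurj; have [g gK] := choice fsurj.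
have glin : linear g by move=> a x y; apply: finj; rewrite linearP !gK.
pose gL := GRing.isLinear.Build A V U *:%R g glin.
pose g' : {linear V -> U} := HB.pack g gL.
by exists g'; split=> x //=; apply: finj; rewrite gK.
Qed.

Section Localization.
Variables (A B : comPzRingType) (phi : {rmorphism A -> B}) (S : A -> Prop).
Hypothesis locS : is_localization phi S.
Local Notation ext := (ext phi).
Local Notation tens := (tens phi).
Implicit Types (X Y : lmodType A) (V W : lmodType B).

Definition restr_map V W (f : {linear V -> W}) : {linear restr phi V -> restr phi W}.
Proof. by refine (mklin (f := f : restr phi V -> restr phi W) _) => a x y;
  rewrite linearD; congr (_ + _); rewrite (linearZ_LR f). Defined.

Lemma restrZ V (a : A) (v : restr phi V) : a *: v = phi a *: (v : V).
Proof. by []. Qed.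

Lemma locz_scaleI V t (v w : V) : S t -> phi t *: v = phi t *: w -> v = w.
Proof.
move=> St e; have [b bt] := locz_inv locS St.
by rewrite -[v]scale1r -[w]scale1r -bt -!scalerA e.
Qed.

Lemma locz_unscale V t (v : V) : S t -> exists w, phi t *: w = v.
Proof.
move=> St; have [b bt] := locz_inv locS St.
by exists (b *: v); rewrite scalerA mulrC bt scale1r.
Qed.

Lemma tens0r X a : tens a (0 : X) = 0.
Proof. by rewrite -(scale0r 0) tensZr rmorph0 mulr0 tensE scale0r. Qed.

Lemma ext_dense X (v : ext X) : exists t x, S t /\ phi t *: v = tens 1 x.
Proof.
elim/presented_ind: v => s; rewrite combE; elim: s => [|[b x] s [t [y [St e]]]].
  exists 1, 0; split; first exact: locz1 locS.
  by rewrite big_nil scaler0 tens0r.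
have [u [a [Su eu]]] := locz_frac locS b.
exists (u * t), (t *: (a *: x) + u *: y); split; first exact: (loczM locS).
rewrite big_cons scalerDr tensDr !tensZr !mul1r; congr (_ + _).
  rewrite -[gen _ _]/(tens 1 x) /= scalerA [RHS]tensE; congr (_ *: _).
  by rewrite rmorphM -eu; ring.
by rewrite rmorphM -scalerA e -tensE.
Qed.

(** [l] exhibits [V] as the localization of [X]. Since [V] is a [B]-module, [S] already acts
    invertibly on it, and only the kernel and the denominators remain to be controlled. *)
Definition is_loc_map X V (l : {linear X -> restr phi V}) :=
  (forall x, l x = 0 -> exists2 t, S t & t *: x = 0) /\
  (forall v : V, exists t x, S t /\ phi t *: v = l x).

(** The kernel is computed in the free module on the elements of [X], of which [X] is a retract:
    each coordinate functional extends to [B], so [tens 1 y = 0] makes the finitely many coordinates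
    of [y] vanish in [B], and the product of the elements of [S] that kill them kills [y]. *)
Lemma ext_unit_loc X : projective X -> is_loc_map (@ext_unit _ _ phi X).
Proof.
move=> projX; split; last exact: ext_dense.
pose q : {linear free_mod A X -> X} := free_map (fun x : X => x).
have qs x : exists y, q y = lid X x by exists (fgen A x); rewrite free_mapE.
have [j jE] := proj_lift projX qs.
move=> x x0; pose y := j x; have {x0} y0 : tens 1 y = 0.
  by rewrite -(ext_mapE phi j) -[tens 1 x]/(ext_unit phi x) x0 linear0.
suff [t St ty] : exists2 t, S t & t *: y = 0.
  exists t => //; have := congr1 q ty; rewrite linear0 linearZ /= => <-.
  by rewrite [q _]jE.
have coord g : phi (coordf A g y) = 0.
  pose f1 : free_mod A X -> restr phi B^o := fun z => phi (coordf A g z).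
  have f1lin : linear f1.
    by move=> a u v; rewrite /f1 linearP rmorphD rmorphM.
  have := congr1 (ext_lift (mklin f1lin)) y0.
  by rewrite ext_lift_tens linear0 scale1r.
have [s us sE] := free_coordE y.
have {us} [t St tE] : exists2 t, S t & forall g, g \in s -> t * coordf A g y = 0.
  elim: s {us sE} => [|g s [t St tE]]; first by exists 1 => //; apply: locz1 locS.
  have [u Su uE] := locz_ker locS (coord g).
  exists (u * t); first exact: (loczM locS).
  move=> g'; rewrite inE => /predU1P[->|/tE e]; last by rewrite -mulrA e mulr0.
  by rewrite [u * t]mulrC -mulrA uE mulr0.
exists t => //; rewrite [X in t *: X]sE scaler_sumr big1_seq // => g gs.
by rewrite scalerA tE ?scale0r.
Qed.

Lemma loc_map_iso X V (l : {linear X -> restr phi V}) : is_loc_map l ->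
  exists g : {linear V -> ext X}, cancel (ext_lift l) g /\ cancel g (ext_lift l).
Proof.
move=> [lker lden]; apply: linear_inverse.
  apply: raddf_inj => v v0; have [t [x [St e]]] := ext_dense v.
  have := congr1 (ext_lift l) e;
    rewrite ext_lift_tens scale1r linearZ_LR v0 [X in X = _](scaler0 V).
  move=> /esym/lker[u Su ux]; apply: (locz_scaleI (loczM locS Su St)).
  rewrite scaler0 rmorphM -scalerA e -[_ *: _]tensE -[X in tens X]mul1r -tensZr ux.
  exact: tens0r.
move=> v; have [t [x [St e]]] := lden v.
have [w wE] := locz_unscale (tens 1 x) St.
exists w; apply: (locz_scaleI St); rewrite -linearZ_LR wE [LHS]ext_lift_tens scale1r.
by rewrite e.
Qed.

End Localization.

(** * Derivations and null-homotopies *)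

Definition derivation (A : comPzRingType) (D : A -> A) :=
  (forall a b, D (a + b) = D a + D b) /\ (forall a b, D (a * b) = a * D b + b * D a).

Section Derivation.
Variables (A : comPzRingType) (D : A -> A).
Hypothesis derD : derivation D.

Lemma der0 : D 0 = 0.
Proof. by apply: (addIr (D 0)); rewrite -derD.1 !add0r. Qed.

Lemma der1 : D 1 = 0.
Proof. by apply: (addIr (D 1)); rewrite add0r -{3}[1]mulr1 derD.2 !mul1r. Qed.

Lemma derN a : D (- a) = - D a.
Proof. by apply: (addIr (D a)); rewrite -derD.1 !addNr der0. Qed.

(** The quotient rule: if [t b = a], then [t D(b) = D(a) - b D(t)]. The relation [G] demands this
    for all representations of [b] at once; one representation provides the value, and [dphi0] shows
    that it serves the others. *)
Lemma der_localization (B : comPzRingType) (phi : {rmorphism A -> B}) (S : A -> Prop) :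
  is_localization phi S ->
  exists2 DB : B -> B, derivation DB & forall a, DB (phi a) = phi (D a).
Proof.
move=> locS.
have cancelS t (b c : B) : S t -> phi t * b = phi t * c -> b = c.
  by move=> St; apply: (@locz_scaleI A B phi S locS B^o t b c St).
(* If [u a = 0], then [u D(a) + a D(u) = 0], and one more factor [u] removes the second term. *)
have dphi0 a : phi a = 0 -> phi (D a) = 0.
  move=> /(locz_ker locS)[u Su ua]; apply: (cancelS (u * u)); first exact: (loczM locS).
  have := congr1 (fun x => phi (u * D x)) ua; rewrite derD.2 der0 mulr0 rmorph0 => e.
  rewrite mulr0 -rmorphM -[RHS]e; congr (phi _).
  transitivity (u * (u * D a) + u * a * D u); last by ring.
  by rewrite ua mul0r addr0 mulrA.
pose G b c := forall t a, S t -> phi t * b = phi a ->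
  phi t * c = phi (D a) - b * phi (D t).
have /choice[DB DBE] : forall b, exists c, G b c.
  move=> b; have [t0 [a0 [St0 e0]]] := locz_frac locS b.
  have [v vt] := locz_inv locS St0.
  exists (v * (phi (D a0) - b * phi (D t0))) => t a St e.
  apply: (cancelS t0) => //.
  have /dphi0 : phi (t * a0 - t0 * a) = 0 by rewrite rmorphB !rmorphM -e -e0; ring.
  rewrite derD.1 derN !derD.2 rmorphB !rmorphD !rmorphM -e -e0 => /eqP.
  rewrite subr_eq0 => /eqP e1.
  transitivity (v * phi t0 * (phi t * (phi (D a0) - b * phi (D t0)))); first by ring.
  rewrite vt mul1r mulrBr; apply/eqP; rewrite mulrBr -subr_eq0; apply/eqP.
  transitivity (phi t * phi (D a0) + phi t0 * b * phi (D t)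
     - (phi t0 * phi (D a) + phi t * b * phi (D t0))); first by ring.
  by rewrite e1 subrr.
exists DB; last first.
  move=> a; have := DBE (phi a) 1 a (locz1 locS).
  by rewrite rmorph1 !mul1r der1 rmorph0 mulr0 subr0; apply.
split=> b b'; have [t [a [St e]]] := locz_frac locS b;
  have [t' [a' [St' e']]] := locz_frac locS b';
  have Stt := loczM locS St St';
  have eb := DBE b t a St e; have eb' := DBE b' t' a' St' e';
  apply: (cancelS (t * t')) => //.
  rewrite (DBE _ (t * t') (t' * a + t * a')) //; last first.
    by rewrite rmorphD !rmorphM -e -e'; ring.
  rewrite derD.1 !derD.2 !rmorphD !rmorphM -e -e'.
  transitivity (phi t' * (phi t * DB b) + phi t * (phi t' * DB b')); last by ring.
  by rewrite eb eb'; ring.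
rewrite (DBE _ (t * t') (a * a')) //; last first.
  by rewrite !rmorphM -e -e'; ring.
rewrite !derD.2 !rmorphD !rmorphM -e -e'.
transitivity (phi t' * b' * (phi t * DB b) + phi t * b * (phi t' * DB b')); last by ring.
by rewrite eb eb'; ring.
Qed.

End Derivation.

(* X (+) X with a(x, y) = (ax, ay + D(a)x): a linear section of the first
   projection is the same as a connection on X along D. *)
Definition jet (A : comPzRingType) (D : A -> A) (derD : derivation D)
  (X : lmodType A) : Type := (X * X)%type.

Section Jet.
Variables (A : comPzRingType) (D : A -> A) (derD : derivation D) (X : lmodType A).
Local Notation J := (jet derD X).
HB.instance Definition _ := GRing.Zmodule.on J.
Definition jet_scale (a : A) (u : J) : J := (a *: u.1, a *: u.2 + D a *: u.1).
Fact jet_scaleA a b u : jet_scale a (jet_scale b u) = jet_scale (a * b) u.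
Proof. by rewrite /jet_scale /=; congr (_, _); rewrite ?derD.2; module. Qed.
Fact jet_scale1 : left_id 1 jet_scale.
Proof. by case=> x y; rewrite /jet_scale (der1 derD) /=; congr (_, _); module. Qed.
Fact jet_scaleDr : right_distributive jet_scale +%R.
Proof. by move=> a u v; congr (_, _) => /=; module. Qed.
Fact jet_scaleDl u : {morph jet_scale^~ u : a b / a + b}.
Proof. by move=> a b; rewrite /jet_scale derD.1; congr (_, _) => /=; module. Qed.
HB.instance Definition _ :=
  GRing.Zmodule_isLmodule.Build A J jet_scaleA jet_scale1 jet_scaleDr jet_scaleDl.

Lemma connection : projective X -> exists2 nabla : X -> X,
  forall x y, nabla (x + y) = nabla x + nabla y &
  forall a x, nabla (a *: x) = a *: nabla x + D a *: x.
Proof.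
move=> projX; have p1lin : linear (fun u : J => u.1) by [].
have [|h hE] := projX _ _ (mklin p1lin) (lid X).
  by move=> x; exists ((x, 0) : J).
have h1 x : (h x).1 = x by apply: hE.
exists (fun x => (h x).2) => [x y|a x]; first by rewrite linearD.
by rewrite linearZ /= h1.
Qed.
End Jet.

Section NullHomotopy.
Variables (A : comPzRingType) (w : A) (X : mf w).

Definition null_homotopic (c : A) :=
  exists (h0 : {linear X false -> X true}) (h1 : {linear X true -> X false}),
    (forall x, mf_d1 X (h0 x) + h1 (mf_d0 X x) = c *: x) /\
    (forall x, mf_d0 X (h1 x) + h0 (mf_d1 X x) = c *: x).

Lemma null_homotopic0 : null_homotopic 0.
Proof. by exists \0, \0; split=> x /=; rewrite linear0 addr0 scale0r. Qed.

Lemma null_homotopicD a b :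
  null_homotopic a -> null_homotopic b -> null_homotopic (a + b).
Proof.
move=> [h0 [h1 [e0 e1]]] [k0 [k1 [f0 f1]]]; exists (h0 \+ k0), (h1 \+ k1).
by split=> x /=; rewrite linearD scalerDl -?(e0, f0) -?(e1, f1); module.
Qed.

Lemma null_homotopicM a b : null_homotopic b -> null_homotopic (a * b).
Proof.
move=> [h0 [h1 [e0 e1]]]; exists (lscale a h0), (lscale a h1).
by split=> x /=; rewrite linearZ /= -scalerDr (e0, e1) scalerA.
Qed.

Lemma null_homotopic_w : null_homotopic w.
Proof.
by exists (mf_d0 X), \0; split=> x /=; rewrite ?linear0 ?mf_d10 ?mf_d01 ?addr0 ?add0r.
Qed.

Lemma null_homotopic_der D : derivation D -> null_homotopic (D w).
Proof.
move=> derD; have [n0 n0D n0Z] := connection derD (@mf_proj _ _ X false).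
have [n1 n1D n1Z] := connection derD (@mf_proj _ _ X true).
have lin0 : linear (fun x => n1 (mf_d0 X x) - mf_d0 X (n0 x)).
  by move=> a x y; rewrite linearP n1D n0D !n1Z n0Z !linearD !linearZ /=; module.
have lin1 : linear (fun x => n0 (mf_d1 X x) - mf_d1 X (n1 x)).
  by move=> a x y; rewrite linearP n0D n1D !n0Z n1Z !linearD !linearZ /=; module.
exists (mklin lin0), (mklin lin1).
split=> x /=; rewrite linearB /= ?(mf_d10, mf_d01) ?(n0Z, n1Z).
  by rewrite /=; module.
by rewrite /=; module.
Qed.

End NullHomotopy.

(** * Morphisms into torsion modules *)

Definition ideal_pred (A : comPzRingType) (P : A -> Prop) :=
  P 0 /\ forall a x y, P x -> P y -> P (a * x + y).

(* Says that t and cs generate the unit ideal, for every t in S. *)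
Definition comaximal (A : comPzRingType) (S : A -> Prop) (cs : seq A) :=
  forall t P, S t -> ideal_pred P -> P t -> (forall c, c \in cs -> P c) -> P 1.

Definition submod (A : comPzRingType) (M : lmodType A) (P : M -> Prop) :=
  P 0 /\ forall a x y, P x -> P y -> P (a *: x + y).

Section Submod.
Variables (A : comPzRingType) (M : lmodType A) (P : M -> Prop).
Hypothesis subP : submod P.
Lemma subD x y : P x -> P y -> P (x + y).
Proof. by move=> Px Py; rewrite -[x]scale1r; apply: subP.2. Qed.
Lemma subZ a x : P x -> P (a *: x).
Proof. by move=> Px; rewrite -[_ *: _]addr0; apply: subP.2 => //; apply: subP.1. Qed.
Lemma subB x y : P x -> P y -> P (x - y).
Proof. by move=> Px Py; rewrite -scaleN1r; apply: subD => //; apply: subZ. Qed.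
End Submod.

(** A subquotient [Q / P] is represented by the pair of submodules, so that no quotient module has
    to be formed. For [P] inside [Q], the pair ([sub_add c P Q], [Q]) stands for the cokernel of [c]
    on [Q / P], and ([P], [sub_ann c P Q]) for its kernel. *)
Definition sub_add (A : comPzRingType) (M : lmodType A) (c : A) (P Q : M -> Prop)
  (x : M) := exists a b, [/\ P a, Q b & x = a + c *: b].
Definition sub_ann (A : comPzRingType) (M : lmodType A) (c : A) (P Q : M -> Prop)
  (x : M) := Q x /\ P (c *: x).

Lemma submod_add (A : comPzRingType) (M : lmodType A) (c : A) (P Q : M -> Prop) :
  submod P -> submod Q -> submod (sub_add c P Q).
Proof.
move=> sP sQ; split=> [|a x y [p [q [Pp Qq ->]]] [p' [q' [Pp' Qq' ->]]]].
  by exists 0, 0; split; [exact: sP.1 | exact: sQ.1 | module].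
exists (a *: p + p'), (a *: q + q'); split; [exact: sP.2 | exact: sQ.2 | module].
Qed.

Lemma submod_ann (A : comPzRingType) (M : lmodType A) (c : A) (P Q : M -> Prop) :
  submod P -> submod Q -> submod (sub_ann c P Q).
Proof.
move=> sP sQ; split=> [|a x y [Qx Px] [Qy Py]].
  by split; [exact: sQ.1 | rewrite scaler0; exact: sP.1].
split; first exact: sQ.2.
have -> : c *: (a *: x + y) = a *: (c *: x) + c *: y by module.
exact: sP.2.
Qed.

Lemma linear_split (A : comPzRingType) (X M : lmodType A) (c : A)
    (P Q : M -> Prop) (g : {linear X -> M}) :
  projective X -> submod P -> submod Q -> (forall x, sub_add c P Q (g x)) ->
  exists a b : {linear X -> M}, [/\ forall x, P (a x), forall x, Q (b x)
    & forall x, g x = a x + c *: b x].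
Proof.
move=> projX sP sQ gE.
have [| |h hE] := @linear_selection A X (M * M)%type
    (fun x u => [/\ P u.1, Q u.2 & g x = u.1 + c *: u.2]) _ projX.
- split=> [|a x u x' u' [Pu Qu e] [Pu' Qu' e']].
    by split; [exact: sP.1 | exact: sQ.1 | rewrite (linear0 g) /= scaler0 addr0].
  rewrite (linearP g) e e'; split; [exact: sP.2 | exact: sQ.2 |].
  by rewrite -[(_ + _).1]/(a *: u.1 + u'.1) -[(_ + _).2]/(a *: u.2 + u'.2); module.
- by move=> x; have [a [b [Pa Qb e]]] := gE x; exists (a, b).
exists (lcomp (lfst M M) h), (lcomp (lsnd M M) h).
by split=> x /=; have [] := hE x.
Qed.

Section Acyclic.
Variables (A : comPzRingType) (w : A) (X0 X1 : lmodType A).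
Variables (d0 : {linear X0 -> X1}) (d1 : {linear X1 -> X0}).
Hypotheses (proj0 : projective X0) (proj1 : projective X1).
Hypotheses (d10 : forall x, d1 (d0 x) = w *: x) (d01 : forall x, d0 (d1 x) = w *: x).
Variables (S : A -> Prop) (cs : seq A).
Hypothesis comax : comaximal S cs.
Hypothesis htpy : forall c, c \in cs -> 
  exists (h0 : {linear X0 -> X1}) (h1 : {linear X1 -> X0}),
    (forall x, d1 (h0 x) + h1 (d0 x) = c *: x) /\
    (forall x, d0 (h1 x) + h0 (d1 x) = c *: x).

(* Induction on the list l of those c in cs that do not kill Q / P: passing from
   (P, Q) to the kernel and to the cokernel of c on Q / P shortens l. *)
Lemma torsion_acyclic_rec (l : seq A) : {subset l <= cs} ->
  forall (M0 M1 : lmodType A) (e0 : {linear M0 -> M1}) (e1 : {linear M1 -> M0})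
    (P0 Q0 : M0 -> Prop) (P1 Q1 : M1 -> Prop) (s : A),
  s * s = 1 ->
  (forall x, e1 (e0 x) = w *: x) -> (forall x, e0 (e1 x) = w *: x) ->
  submod P0 -> submod P1 -> submod Q0 -> submod Q1 ->
  (forall x, P0 x -> P1 (e0 x)) -> (forall x, P1 x -> P0 (e1 x)) ->
  (forall x, Q0 x -> Q1 (e0 x)) -> (forall x, Q1 x -> Q0 (e1 x)) ->
  (forall x, P0 x -> Q0 x) -> (forall x, P1 x -> Q1 x) ->
  (forall x, Q0 x -> exists2 t, S t & P0 (t *: x)) ->
  (forall x, Q1 x -> exists2 t, S t & P1 (t *: x)) ->
  (forall c, c \in cs -> c \notin l ->
    (forall x, Q0 x -> P0 (c *: x)) /\ (forall x, Q1 x -> P1 (c *: x))) ->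
  forall (f0 : {linear X0 -> M0}) (f1 : {linear X1 -> M1}),
  (forall x, Q0 (f0 x)) -> (forall x, Q1 (f1 x)) ->
  (forall x, P1 (e0 (f0 x) - s *: f1 (d0 x))) ->
  (forall x, P0 (e1 (f1 x) - s *: f0 (d1 x))) ->
  exists (y0 : {linear X0 -> M1}) (y1 : {linear X1 -> M0}),
    [/\ forall x, Q1 (y0 x), forall x, Q0 (y1 x),
        forall x, P0 (f0 x - (e1 (y0 x) + s *: y1 (d0 x)))
      & forall x, P1 (f1 x - (e0 (y1 x) + s *: y0 (d1 x)))].
Proof.
elim: l => [|c l IH] sub M0 M1 e0 e1 P0 Q0 P1 Q1 s ss e10 e01 sP0 sP1 sQ0 sQ1
  Pe0 Pe1 Qe0 Qe1 PQ0 PQ1 T0 T1 kill f0 f1 Qf0 Qf1 cl0 cl1.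
  (* If every [c] maps [Q] into [P], then the scalars that send [x] into [P] form an ideal
     containing [cs] and some [t] in [S], hence 1. So [Q / P] is zero, and zero maps solve the
     problem. *)
  have QP (M : lmodType A) (P Q : M -> Prop) (sP : submod P) (sQ : submod Q) x : Q x ->
      (exists2 t, S t & P (t *: x)) -> (forall c, c \in cs -> P (c *: x)) -> P x.
    move=> Qx [t St Ptx] cP; rewrite -[x]scale1r.
    apply: (comax (P := fun a => P (a *: x)) St) => //.
    split=> [|a b b' Pb Pb']; first by rewrite scale0r; apply: sP.1.
    by rewrite scalerDl -scalerA; apply: sP.2.
  exists \0, \0; split=> x /=; do ?[exact: sQ0.1 | exact: sQ1.1].
    rewrite linear0 scaler0 addr0 subr0; apply: (QP _ _ _ sP0 sQ0) => //; first exact: T0.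
    by move=> c ccs; apply: (kill c ccs isT).1.
  rewrite linear0 scaler0 addr0 subr0; apply: (QP _ _ _ sP1 sQ1) => //; first exact: T1.
  by move=> c ccs; apply: (kill c ccs isT).2.
have ccs : c \in cs by apply: sub; rewrite mem_head.
have {}sub : {subset l <= cs} by move=> x xl; apply: sub; rewrite inE xl orbT.
have {}IH := IH sub.
have [h0 [h1 [h10 h01]]] := htpy ccs.
(* [k] is [f] composed with the null-homotopy of [c]. Since [f] is a cycle modulo [P], the boundary
   of [k] is [c f] modulo [P]. *)
pose k0 := lscale s (lcomp f1 h0); pose k1 := lscale s (lcomp f0 h1).
have s1 : 1 - s * s = 0 by rewrite ss subrr.
have kE0 x : P0 (c *: f0 x - (e1 (k0 x) + s *: k1 (d0 x))).
  have := congr1 f0 (h10 x); rewrite linearD linearZ /= => <-.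
  apply: (eq_ind _ P0 (subZ sP0 (- s) (cl1 (h0 x)))); rewrite /= (linearZ_LR e1) /=.
  apply/esym; transitivity (- s *: (e1 (f1 (h0 x)) - s *: f0 (d1 (h0 x)))
    + (1 - s * s) *: (f0 (d1 (h0 x)) + f0 (h1 (d0 x)))); first by module.
  by rewrite s1; module.
have kE1 x : P1 (c *: f1 x - (e0 (k1 x) + s *: k0 (d1 x))).
  have := congr1 f1 (h01 x); rewrite linearD linearZ /= => <-.
  apply: (eq_ind _ P1 (subZ sP1 (- s) (cl0 (h1 x)))); rewrite /= (linearZ_LR e0) /=.
  apply/esym; transitivity (- s *: (e0 (f0 (h1 x)) - s *: f1 (d0 (h1 x)))
    + (1 - s * s) *: (f1 (d0 (h1 x)) + f1 (h0 (d1 x)))); first by module.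
  by rewrite s1; module.
have sA0 := submod_add c sP0 sQ0; have sA1 := submod_add c sP1 sQ1.
have sB0 := submod_ann c sP0 sQ0; have sB1 := submod_ann c sP1 sQ1.
(* As its boundary is [c f], [k] is a cycle modulo [P + c Q], of the opposite parity, whence the
   sign [- s]. By induction on the cokernel of [c] it is there the boundary of some [y], and
   projectivity writes the difference linearly as [a + c m]. *)
have [y0 [y1 [Qy0 Qy1 y0E y1E]]] : exists (y0 : {linear X0 -> M0}) (y1 : {linear X1 ->
  M1}),
    [/\ forall x, Q0 (y0 x), forall x, Q1 (y1 x),
        forall x, sub_add c P1 Q1 (k0 x - (e0 (y0 x) + (- s) *: y1 (d0 x)))
      & forall x, sub_add c P0 Q0 (k1 x - (e1 (y1 x) + (- s) *: y0 (d1 x)))].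
  apply: (IH _ _ e1 e0 _ Q1 _ Q0 (- s)) => //.
  - by rewrite mulrNN.
  - by move=> _ [a [b [Pa Qb ->]]]; exists (e1 a), (e1 b); rewrite linearD linearZ;
      split; auto.
  - by move=> _ [a [b [Pa Qb ->]]]; exists (e0 a), (e0 b); rewrite linearD linearZ;
      split; auto.
  - by move=> _ [a [b [Pa Qb ->]]]; apply: (subD sQ1); [exact: PQ1 | exact: subZ].
  - by move=> _ [a [b [Pa Qb ->]]]; apply: (subD sQ0); [exact: PQ0 | exact: subZ].
  - move=> x /T1[t St Pt]; exists t => //; exists (t *: x), 0.
    by rewrite scaler0 addr0; split=> //; apply: sQ1.1.
  - move=> x /T0[t St Pt]; exists t => //; exists (t *: x), 0.
    by rewrite scaler0 addr0; split=> //; apply: sQ0.1.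
  - move=> c' c'cs c'l; case: (eqVneq c' c) => [->|c'c].
      split=> x Qx; exists 0, x; rewrite add0r; split=> //;
        first [exact: sP1.1|exact: sP0.1].
    have [|K0 K1] := kill c' c'cs; first by rewrite inE negb_or c'c.
    split=> x Qx; [exists (c' *: x), 0|exists (c' *: x), 0]; rewrite scaler0 addr0;
      split; auto; first [exact: sQ1.1|exact: sQ0.1].
  - by move=> x; exact: (subZ sQ1 s (Qf1 (h0 x))).
  - by move=> x; exact: (subZ sQ0 s (Qf0 (h1 x))).
  - move=> x; exists (- (c *: f0 x - (e1 (k0 x) + s *: k1 (d0 x)))), (f0 x); split=> //.
      by rewrite -scaleN1r; apply: (subZ sP0).
    by module.
  - move=> x; exists (- (c *: f1 x - (e0 (k1 x) + s *: k0 (d1 x)))), (f1 x); split=> //.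
      by rewrite -scaleN1r; apply: (subZ sP1).
    by module.
pose g0 : {linear X0 -> M1} := k0 \- (lcomp e0 y0 \+ lscale (- s) (lcomp y1 d0)).
pose g1 : {linear X1 -> M0} := k1 \- (lcomp e1 y1 \+ lscale (- s) (lcomp y0 d1)).
have [a0 [m0 [Pa0 Qm0 g0E]]] := linear_split (g := g0) proj0 sP1 sQ1 y0E.
have [a1 [m1 [Pa1 Qm1 g1E]]] := linear_split (g := g1) proj1 sP0 sQ0 y1E.
have k0E x : k0 x = e0 (y0 x) - s *: y1 (d0 x) + a0 x + c *: m0 x.
  rewrite -addrA -g0E -[g0 x]/(k0 x - (e0 (y0 x) + (- s) *: y1 (d0 x))).
  by move: (k0 x) => k; module.
have k1E x : k1 x = e1 (y1 x) - s *: y0 (d1 x) + a1 x + c *: m1 x.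
  rewrite -addrA -g1E -[g1 x]/(k1 x - (e1 (y1 x) + (- s) *: y0 (d1 x))).
  by move: (k1 x) => k; module.
(* Taking the boundary of [k = d y + a + c m] gives [c (f - d m) = d a] modulo [P], which lies in
   [P]. So [f' = f - d m] takes values in the kernel of [c], where the induction hypothesis applies
   a second time. *)
pose f0' : {linear X0 -> M0} := f0 \- (lcomp e1 m0 \+ lscale s (lcomp m1 d0)).
pose f1' : {linear X1 -> M1} := f1 \- (lcomp e0 m1 \+ lscale s (lcomp m0 d1)).
have f0'E x : f0' x = f0 x - (e1 (m0 x) + s *: m1 (d0 x)) by [].
have f1'E x : f1' x = f1 x - (e0 (m1 x) + s *: m0 (d1 x)) by [].
have Qf0' x : Q0 (f0' x).
  by rewrite f0'E; apply: (subB sQ0) => //; apply: (subD sQ0); [exact: Qe1|exact: subZ].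
have Qf1' x : Q1 (f1' x).
  by rewrite f1'E; apply: (subB sQ1) => //; apply: (subD sQ1); [exact: Qe0|exact: subZ].
have Bf0' x : P0 (c *: f0' x).
  have := subD sP0 (kE0 x) (subD sP0 (Pe1 _ (Pa0 x)) (subZ sP0 s (Pa1 (d0 x)))).
  suff -> : c *: f0 x - (e1 (k0 x) + s *: k1 (d0 x)) + (e1 (a0 x) + s *: a1 (d0 x))
    = c *: f0' x by [].
  rewrite f0'E k0E k1E !(linearD e1, linearN e1,
    linearZ_LR e1) /= e10 d10 (linearZ_LR y0) /=.
  transitivity (c *: f0 x +
    (s * s - 1) *: (w *: y0 x) - c *: e1 (m0 x) - (c * s) *: m1 (d0 x)); first by module.
  by rewrite ss subrr; module.
have Bf1' x : P1 (c *: f1' x).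
  have := subD sP1 (kE1 x) (subD sP1 (Pe0 _ (Pa1 x)) (subZ sP1 s (Pa0 (d1 x)))).
  suff -> : c *: f1 x - (e0 (k1 x) + s *: k0 (d1 x)) + (e0 (a1 x) + s *: a0 (d1 x))
    = c *: f1' x by [].
  rewrite f1'E k0E k1E !(linearD e0, linearN e0,
    linearZ_LR e0) /= e01 d01 (linearZ_LR y1) /=.
  transitivity (c *: f1 x +
    (s * s - 1) *: (w *: y1 x) - c *: e0 (m1 x) - (c * s) *: m0 (d1 x)); first by module.
  by rewrite ss subrr; module.
have [z0 [z1 [Qz0 Qz1 z0E z1E]]] : exists (y0 : {linear X0 -> M1}) (y1 : {linear X1 ->
  M0}),
    [/\ forall x, sub_ann c P1 Q1 (y0 x), forall x, sub_ann c P0 Q0 (y1 x),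
        forall x, P0 (f0' x - (e1 (y0 x) + s *: y1 (d0 x)))
      & forall x, P1 (f1' x - (e0 (y1 x) + s *: y0 (d1 x)))].
  apply: (IH _ _ e0 e1) => //.
  - by move=> x [Qx Px]; split; [exact: Qe0 | rewrite -linearZ; exact: Pe0].
  - by move=> x [Qx Px]; split; [exact: Qe1 | rewrite -linearZ; exact: Pe1].
  - by move=> x Px; split; [exact: PQ0 | exact: subZ].
  - by move=> x Px; split; [exact: PQ1 | exact: subZ].
  - by move=> x [/T0].
  - by move=> x [/T1].
  - move=> c' c'cs c'l; case: (eqVneq c' c) => [->|c'c].
      by split=> x [].
    have [|K0 K1] := kill c' c'cs; first by rewrite inE negb_or c'c.
    by split=> x [Qx _]; auto.
  - move=> x; rewrite f0'E f1'E; have := cl0 x.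
    suff -> : e0 (f0 x - (e1 (m0 x) +
      s *: m1 (d0 x))) - s *: (f1 (d0 x) - (e0 (m1 (d0 x)) + s *: m0 (d1 (d0 x))))
      = e0 (f0 x) - s *: f1 (d0 x) by [].
    rewrite !(linearD e0, linearN e0, linearZ_LR e0) /= e01 d10 (linearZ_LR m0) /=.
    transitivity (e0 (f0 x) - s *: f1 (d0 x) + (s * s - 1) *: (w *: m0 x));
      first by module.
    by rewrite ss subrr; module.
  - move=> x; rewrite f0'E f1'E; have := cl1 x.
    suff -> : e1 (f1 x - (e0 (m1 x) +
      s *: m0 (d1 x))) - s *: (f0 (d1 x) - (e1 (m0 (d1 x)) + s *: m1 (d0 (d1 x))))
      = e1 (f1 x) - s *: f0 (d1 x) by [].
    rewrite !(linearD e1, linearN e1, linearZ_LR e1) /= e10 d01 (linearZ_LR m1) /=.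
    transitivity (e1 (f1 x) - s *: f0 (d1 x) + (s * s - 1) *: (w *: m1 x));
      first by module.
    by rewrite ss subrr; module.
exists (m0 \+ z0), (m1 \+ z1); split=> x /=.
- by apply: (subD sQ1) => //; apply: (Qz0 x).1.
- by apply: (subD sQ0) => //; apply: (Qz1 x).1.
- by have := z0E x; rewrite f0'E (linearD e1); congr (P0 _); module.
- by have := z1E x; rewrite f1'E (linearD e0); congr (P1 _); module.
Qed.

End Acyclic.

(** The recursion starts at [l := cs], where the condition on elements outside [l] is void. The pair
    ([f0], [f1]) is a cycle of Hom(X, Q / P) and the boundary of ([y0], [y1]); [s] stands for
    (-1)^|f|, kept as a square root of 1 so that both parities form one statement. *)
Lemma torsion_acyclic (A : comPzRingType) (w : A) (X0 X1 : lmodType A)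
    (d0 : {linear X0 -> X1}) (d1 : {linear X1 -> X0}) (S : A -> Prop) (cs : seq A) :
  projective X0 -> projective X1 ->
  (forall x, d1 (d0 x) = w *: x) -> (forall x, d0 (d1 x) = w *: x) ->
  comaximal S cs ->
  (forall c, c \in cs ->
    exists (h0 : {linear X0 -> X1}) (h1 : {linear X1 -> X0}),
      (forall x, d1 (h0 x) + h1 (d0 x) = c *: x) /\
      (forall x, d0 (h1 x) + h0 (d1 x) = c *: x)) ->
  forall (M0 M1 : lmodType A) (e0 : {linear M0 -> M1}) (e1 : {linear M1 -> M0})
    (P0 Q0 : M0 -> Prop) (P1 Q1 : M1 -> Prop) (s : A),
  s * s = 1 ->
  (forall x, e1 (e0 x) = w *: x) -> (forall x, e0 (e1 x) = w *: x) ->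
  submod P0 -> submod P1 -> submod Q0 -> submod Q1 ->
  (forall x, P0 x -> P1 (e0 x)) -> (forall x, P1 x -> P0 (e1 x)) ->
  (forall x, Q0 x -> Q1 (e0 x)) -> (forall x, Q1 x -> Q0 (e1 x)) ->
  (forall x, P0 x -> Q0 x) -> (forall x, P1 x -> Q1 x) ->
  (forall x, Q0 x -> exists2 t, S t & P0 (t *: x)) ->
  (forall x, Q1 x -> exists2 t, S t & P1 (t *: x)) ->
  forall (f0 : {linear X0 -> M0}) (f1 : {linear X1 -> M1}),
  (forall x, Q0 (f0 x)) -> (forall x, Q1 (f1 x)) ->
  (forall x, P1 (e0 (f0 x) - s *: f1 (d0 x))) ->
  (forall x, P0 (e1 (f1 x) - s *: f0 (d1 x))) ->
  exists (y0 : {linear X0 -> M1}) (y1 : {linear X1 -> M0}),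
    [/\ forall x, Q1 (y0 x), forall x, Q0 (y1 x),
        forall x, P0 (f0 x - (e1 (y0 x) + s *: y1 (d0 x)))
      & forall x, P1 (f1 x - (e0 (y1 x) + s *: y0 (d1 x)))].
Proof.
move=> pr0 pr1 d10 d01 comax htpy M0 M1 e0 e1 P0 Q0 P1 Q1 s ss e10 e01 *.
apply: (torsion_acyclic_rec pr0 pr1 d10 d01 comax htpy (l := cs)) => //.
by move=> c ->.
Qed.

(** * Acyclicity of the cone of a localization map *)

Section ConeLift.
Variables (A B : comPzRingType) (phi : {rmorphism A -> B}) (S : A -> Prop).
Variables (w : A) (X0 X1 : lmodType A).
Variables (d0 : {linear X0 -> X1}) (d1 : {linear X1 -> X0}).
Hypotheses (proj0 : projective X0) (proj1 : projective X1).
Hypotheses (d10 : forall x, d1 (d0 x) = w *: x) (d01 : forall x, d0 (d1 x) = w *: x).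
Variable cs : seq A.
Hypothesis comax : comaximal S cs.
Hypothesis htpy : forall c, c \in cs ->
  exists (h0 : {linear X0 -> X1}) (h1 : {linear X1 -> X0}),
    (forall x, d1 (h0 x) + h1 (d0 x) = c *: x) /\
    (forall x, d0 (h1 x) + h0 (d1 x) = c *: x).
Variables (N0 N1 : lmodType A) (V0 V1 : lmodType B).
Variables (e0 : {linear N0 -> N1}) (e1 : {linear N1 -> N0}).
Variables (E0 : {linear V0 -> V1}) (E1 : {linear V1 -> V0}).
Hypotheses (e10 : forall x, e1 (e0 x) = w *: x) (e01 : forall x, e0 (e1 x) = w *: x).
Hypotheses (E10 : forall x, E1 (E0 x) = phi w *: x).
Hypotheses (E01 : forall x, E0 (E1 x) = phi w *: x).
Variables (l0 : {linear N0 -> restr phi V0}) (l1 : {linear N1 -> restr phi V1}).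
Hypotheses (loc0 : is_loc_map S l0) (loc1 : is_loc_map S l1).
Hypotheses (le0 : forall x, l1 (e0 x) = E0 (l0 x)) (le1 : forall x,
  l0 (e1 x) = E1 (l1 x)).

(* Acyclicity of Hom(X, cone (N -> V)), obtained from that of Hom(X, V / im N)
   and of Hom(X, ker (N -> V)). *)
Lemma cone_lift (s : A) (b0 : {linear X0 -> restr phi V0})
    (b1 : {linear X1 -> restr phi V1}) (o0 : {linear X0 -> N1}) (o1 : {linear X1 -> N0}) :
  s * s = 1 ->
  (forall x, e1 (o0 x) + s *: o1 (d0 x) = 0) ->
  (forall x, e0 (o1 x) + s *: o0 (d1 x) = 0) ->
  (forall x, l1 (o0 x) = restr_map phi E0 (b0 x) - s *: b1 (d0 x)) ->
  (forall x, l0 (o1 x) = restr_map phi E1 (b1 x) - s *: b0 (d1 x)) ->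
  exists (y0 : {linear X0 -> N0}) (y1 : {linear X1 -> N1})
    (z0 : {linear X0 -> restr phi V1}) (z1 : {linear X1 -> restr phi V0}),
    [/\ forall x, o0 x = e0 (y0 x) - s *: y1 (d0 x),
        forall x, o1 x = e1 (y1 x) - s *: y0 (d1 x),
        forall x, b0 x = l0 (y0 x) + (restr_map phi E1 (z0 x) + s *: z1 (d0 x))
      & forall x, b1 x = l1 (y1 x) + (restr_map phi E0 (z1 x) + s *: z0 (d1 x))].
Proof.
move=> ss oc0 oc1 bo0 bo1.
pose R0 := restr_map phi E0; pose R1 := restr_map phi E1.
have im_sub (N : lmodType A) (V : lmodType B) (l : {linear N -> restr phi V}) :
    submod (fun v => exists y, l y = v).
  split=> [|a _ _ [x <-] [y <-]]; first by exists 0; rewrite linear0.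
  by exists (a *: x + y); rewrite linearP.
have ker_sub (N : lmodType A) (V : lmodType B) (l : {linear N -> restr phi V}) :
    submod (fun x => l x = 0).
  by split=> [|a x y lx ly]; rewrite ?linear0 // linearP lx ly scaler0 addr0.
have T_sub (M : lmodType A) : submod (fun _ : M => True) by [].
have O_sub (M : lmodType A) : submod (fun x : M => x = 0).
  by split=> // a x y -> ->; rewrite scaler0 addr0.
have im_tor (N : lmodType A) (V : lmodType B) (l : {linear N -> restr phi V}) :
    is_loc_map S l -> forall v : restr phi V, True ->
      exists2 t, S t & exists y, l y = t *: v.
  by move=> [_ lden] v _; have [t [y [St e]]] := lden v; exists t => //; exists y.
have [z0 [z1 [_ _ z0E z1E]]] : exists (z0 : {linear X0 -> restr phi V1})
    (z1 : {linear X1 -> restr phi V0}),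
    [/\ forall x : X0, True, forall x : X1, True,
      forall x, exists y, l0 y = b0 x - (R1 (z0 x) + s *: z1 (d0 x))
    & forall x, exists y, l1 y = b1 x - (R0 (z1 x) + s *: z0 (d1 x))].
  apply: (torsion_acyclic proj0 proj1 d10 d01 comax htpy (e0 := R0) (e1 := R1)
    (P0 := fun v => exists y, l0 y = v) (P1 := fun v => exists y, l1 y = v)
    (Q0 := fun=> True) (Q1 := fun=> True) (s := s) ) => //.
  - by move=> _ [y <-]; exists (e0 y); rewrite le0.
  - by move=> _ [y <-]; exists (e1 y); rewrite le1.
  - exact: im_tor.
  - exact: im_tor.
  - by move=> x; exists (o0 x); rewrite bo0.
  - by move=> x; exists (o1 x); rewrite bo1.
pose g0 : {linear X0 -> restr phi V0} := b0 \- (lcomp R1 z0 \+ lscale s (lcomp z1 d0)).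
pose g1 : {linear X1 -> restr phi V1} := b1 \- (lcomp R0 z1 \+ lscale s (lcomp z0 d1)).
have [y0 y0E] := proj_lift (f := g0) proj0 z0E.
have [y1 y1E] := proj_lift (f := g1) proj1 z1E.
have {}y0E x : l0 (y0 x) = b0 x - (R1 (z0 x) + s *: z1 (d0 x)) by rewrite y0E.
have {}y1E x : l1 (y1 x) = b1 x - (R0 (z1 x) + s *: z0 (d1 x)) by rewrite y1E.
have R10 x : R1 (R0 x) = w *: x by exact: E10.
have R01 x : R0 (R1 x) = w *: x by exact: E01.
(* The lift [y] of [b - d z] satisfies [o = d y] only after localization. The error [p] is a cycle
   with values in the kernel of [N -> V], so it bounds some [u] there, and [y + u] is the
   solution. *)
pose p0 : {linear X0 -> N1} := o0 \- (lcomp e0 y0 \+ lscale (- s) (lcomp y1 d0)).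
pose p1 : {linear X1 -> N0} := o1 \- (lcomp e1 y1 \+ lscale (- s) (lcomp y0 d1)).
have p0E x : p0 x = o0 x - (e0 (y0 x) + (- s) *: y1 (d0 x)) by [].
have p1E x : p1 x = o1 x - (e1 (y1 x) + (- s) *: y0 (d1 x)) by [].
have lp0 x : l1 (p0 x) = 0.
  rewrite p0E !(linearD l1, linearN l1, linearZ_LR l1) bo0 le0 y1E.
  rewrite -[E0 (l0 (y0 x))]/(R0 (l0 (y0 x))) y0E !(linearD R0, linearN R0, linearZ_LR R0).
  rewrite -/R0 R01 d10 (linearZ_LR z0).
  by transitivity ((1 - s * s) *: (w *: z0 x)); [module | rewrite ss subrr scale0r].
have lp1 x : l0 (p1 x) = 0.
  rewrite p1E !(linearD l0, linearN l0, linearZ_LR l0) bo1 le1 y0E.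
  rewrite -[E1 (l1 (y1 x))]/(R1 (l1 (y1 x))) y1E !(linearD R1, linearN R1, linearZ_LR R1).
  rewrite -/R1 R10 d01 (linearZ_LR z1).
  by transitivity ((1 - s * s) *: (w *: z1 x)); [module | rewrite ss subrr scale0r].
have [u0 [u1 [lu0 lu1 u0E u1E]]] : exists (u0 : {linear X0 -> N0}) (u1 : {linear X1 ->
  N1}),
    [/\ forall x, l0 (u0 x) = 0, forall x, l1 (u1 x) = 0,
      forall x, p0 x - (e0 (u0 x) + (- s) *: u1 (d0 x)) = 0
    & forall x, p1 x - (e1 (u1 x) + (- s) *: u0 (d1 x)) = 0].
  apply: (torsion_acyclic proj0 proj1 d10 d01 comax htpy (e0 := e1) (e1 := e0)
    (P0 := fun x => x = 0) (P1 := fun x => x = 0) (s := - s) 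
    (Q0 := fun x => l1 x = 0) (Q1 := fun x => l0 x = 0)) => //.
  - by rewrite mulrNN.
  - by move=> x ->; rewrite linear0.
  - by move=> x ->; rewrite linear0.
  - by move=> x x0; rewrite le1 x0 linear0.
  - by move=> x x0; rewrite le0 x0 linear0.
  - by move=> x ->; rewrite linear0.
  - by move=> x ->; rewrite linear0.
  - exact: loc1.1.
  - exact: loc0.1.
  - move=> x; rewrite p0E p1E !(linearD e1, linearN e1,
      linearZ_LR e1) e10 d10 (linearZ_LR y0).
    have /eqP := oc0 x; rewrite addr_eq0 => /eqP ->.
    by transitivity ((s * s - 1) *: (w *: y0 x)); [module | rewrite ss subrr scale0r].
  - move=> x; rewrite p0E p1E !(linearD e0, linearN e0,
      linearZ_LR e0) e01 d01 (linearZ_LR y1).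
    have /eqP := oc1 x; rewrite addr_eq0 => /eqP ->.
    by transitivity ((s * s - 1) *: (w *: y1 x)); [module | rewrite ss subrr scale0r].
exists (y0 \+ u0), (y1 \+ u1), z0, z1; split=> x /=.
- have := u0E x; rewrite p0E => /eqP; rewrite subr_eq0 => /eqP e.
  rewrite (linearD e0);
    transitivity (e0 (y0 x) + - s *: y1 (d0 x) + (o0 x - (e0 (y0 x) + - s *: y1 (d0 x)))).
    by module.
  by rewrite e; module.
- have := u1E x; rewrite p1E => /eqP; rewrite subr_eq0 => /eqP e.
  rewrite (linearD e1);
    transitivity (e1 (y1 x) + - s *: y0 (d1 x) + (o1 x - (e1 (y1 x) + - s *: y0 (d1 x)))).
    by module.
  by rewrite e; module.
- by rewrite (linearD l0) y0E lu0 -/R1; module.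
- by rewrite (linearD l1) y1E lu1 -/R0; module.
Qed.
End ConeLift.
(** * Quasi-full faithfulness *)

Section QuasiFullyFaithful.
Variables (A B : comPzRingType) (phi : {rmorphism A -> B}) (S : A -> Prop).
Hypothesis locS : is_localization phi S.
Variables (w : A) (cs : seq A).
Hypothesis comax : comaximal S cs.

Definition restr_unit (X : lmodType A) (V : lmodType B) (f : {linear ext phi X -> V}) :
  {linear X -> restr phi V} := lcomp (restr_map phi f) (@ext_unit _ _ phi X).

Definition linext (X : lmodType A) (V : lmodType B) (f : {linear X -> restr phi V}) :
  {linear ext phi X -> V} := ext_lift f.

Lemma linextE (X : lmodType A) (V : lmodType B) (f : {linear X -> restr phi V}) x :
  linext f (tens phi 1 x) = f x.
Proof. by rewrite [LHS]ext_lift_tens scale1r. Qed.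

(** Acyclicity of the cone of Hom(X, Y) -> Hom(X_S, Y_S), the target being Hom(X, Y_S) by
    adjunction. Taking for [b] a homotopy gives injectivity on cohomology; taking [b] closed and
    [o = 0] gives surjectivity. *)
Lemma mf_cone_lift (X Y : mf w) i (b : mf_hom (mf_ext phi X) (mf_ext phi Y) i)
    (o : mf_hom X Y (~~ i)) :
  (forall c, c \in cs -> null_homotopic X c) ->
  mf_d o = 0 -> mf_d b = mf_ext_hom phi o ->
  exists (y : mf_hom X Y i) (z : mf_hom (mf_ext phi X) (mf_ext phi Y) (~~ i)),
    mf_d y = o /\ mf_d z = dcast (esym (negbK i)) (b - mf_ext_hom phi y).
Proof.
move=> htpy; have u i' := ext_unit_loc locS (@mf_proj _ _ Y i').
have cone := cone_lift (@mf_proj _ _ X false) (@mf_proj _ _ X true)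
  (@mf_d10 _ _ X) (@mf_d01 _ _ X) comax htpy.
have unitE (X1 Y1 : lmodType A) (f : {linear X1 -> Y1}) x :
  ext_unit phi (f x) = ext_map phi f (ext_unit phi x) by rewrite /ext_unit ext_mapE.
(* For odd [b] the components land in Y^1 and Y^0, so [cone_lift] is used with the halves of [Y]
   exchanged and with the sign -1; for even [b] the halves are in order and the sign is 1. *)
case: i b o => b o od bo.
  have od1 x : mf_d0 Y (o.1 x) - o.2 (mf_d0 X x) = 0.
    exact: (congr1 (fun f : mf_hom X Y true => f.1 x) od).
  have od2 x : mf_d1 Y (o.2 x) - o.1 (mf_d1 X x) = 0.
    exact: (congr1 (fun f : mf_hom X Y true => f.2 x) od).
  have bo1 x := congr1 (fun f : mf_hom (mf_ext phi X) (mf_ext phi Y) false => f.1 (tens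
    phi 1 x)) bo.
  have bo2 x := congr1 (fun f : mf_hom (mf_ext phi X) (mf_ext phi Y) false => f.2 (tens
    phi 1 x)) bo.
  have [|||||||y0 [y1 [z0 [z1 [y0E y1E z0E z1E]]]]] :=
    cone _ phi _ _ _ _ (mf_d1 Y) (mf_d0 Y)
    (mf_d1 (mf_ext phi Y)) (mf_d0 (mf_ext phi Y)) (@mf_d01 _ _ Y) (@mf_d10 _ _ Y)
    (@mf_d01 _ _ (mf_ext phi Y)) (@mf_d10 _ _ (mf_ext phi Y))
    _ _ (u true) (u false) _ _ (-1) (restr_unit b.1) (restr_unit b.2) o.1 o.2.
  - by move=> x; apply: unitE.
  - by move=> x; apply: unitE.
  - by rewrite mulrNN mulr1.
  - by move=> x; rewrite scaleN1r.
  - by move=> x; rewrite scaleN1r.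
  - move=> x; rewrite scaleN1r opprK; move: (bo1 x) => /=; rewrite !ext_mapE => e.
    exact: (esym e).
  - move=> x; rewrite scaleN1r opprK; move: (bo2 x) => /=; rewrite !ext_mapE => e.
    exact: (esym e).
  exists (y0, y1), (linext z0, linext z1); split; rewrite ?dcastE.
    by apply: mf_hom_ext => x; rewrite ?y0E ?y1E /= scaleN1r opprK.
  apply: congr2; apply: ext_eq => x.
    rewrite /= !ext_mapE !linextE.
    have := z0E x; rewrite scaleN1r.
    move=> e; transitivity (b.1 (tens phi 1 x) - tens phi 1 (y0 x)) => //.
    rewrite -[b.1 _]/(restr_unit b.1 x) e.
    by rewrite addrAC addrN add0r.
  rewrite /= !ext_mapE !linextE.
  have := z1E x; rewrite scaleN1r.
  move=> e; transitivity (b.2 (tens phi 1 x) - tens phi 1 (y1 x)) => //.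
  rewrite -[b.2 _]/(restr_unit b.2 x) e.
  by rewrite addrAC addrN add0r.
have od1 x : mf_d1 Y (o.1 x) + o.2 (mf_d0 X x) = 0.
  exact: (congr1 (fun f : mf_hom X Y false => f.1 x) od).
have od2 x : mf_d0 Y (o.2 x) + o.1 (mf_d1 X x) = 0.
  exact: (congr1 (fun f : mf_hom X Y false => f.2 x) od).
have bo1 x := congr1 (fun f : mf_hom (mf_ext phi X) (mf_ext phi Y) true => f.1 (tens
  phi 1 x)) bo.
have bo2 x := congr1 (fun f : mf_hom (mf_ext phi X) (mf_ext phi Y) true => f.2 (tens
  phi 1 x)) bo.
have [|||||||y0 [y1 [z0 [z1 [y0E y1E z0E z1E]]]]] :=
  cone _ phi _ _ _ _ (mf_d0 Y) (mf_d1 Y)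
  (mf_d0 (mf_ext phi Y)) (mf_d1 (mf_ext phi Y)) (@mf_d10 _ _ Y) (@mf_d01 _ _ Y)
  (@mf_d10 _ _ (mf_ext phi Y)) (@mf_d01 _ _ (mf_ext phi Y))
  _ _ (u false) (u true) _ _ 1 (restr_unit b.1) (restr_unit b.2) o.1 o.2.
- by move=> x; apply: unitE.
- by move=> x; apply: unitE.
- by rewrite mulr1.
- by move=> x; rewrite scale1r.
- by move=> x; rewrite scale1r.
- move=> x; rewrite scale1r; move: (bo1 x) => /=; rewrite !ext_mapE => e.
  exact: (esym e).
- move=> x; rewrite scale1r; move: (bo2 x) => /=; rewrite !ext_mapE => e.
  exact: (esym e).
exists (y0, y1), (linext z0, linext z1); split; rewrite ?dcastE.
  by apply: mf_hom_ext => x; rewrite ?y0E ?y1E /= scale1r.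
apply: congr2; apply: ext_eq => x.
  rewrite /= !ext_mapE !linextE.
  have := z0E x; rewrite scale1r.
  move=> e; transitivity (b.1 (tens phi 1 x) - tens phi 1 (y0 x)) => //.
  rewrite -[b.1 _]/(restr_unit b.1 x) e.
  by rewrite addrAC addrN add0r.
rewrite /= !ext_mapE !linextE.
have := z1E x; rewrite scale1r.
move=> e; transitivity (b.2 (tens phi 1 x) - tens phi 1 (y1 x)) => //.
rewrite -[b.2 _]/(restr_unit b.2 x) e.
by rewrite addrAC addrN add0r.
Qed.

Lemma mf_ext_quasi_iso (X Y : mf w) : (forall c, c \in cs -> null_homotopic X c) ->
  @quasi_iso_on (mf_dgcat w) (mf_dgcat (phi w)) (mf_base_change phi w) X Y.
Proof.
move=> htpy i; split=> [f g fd gd [h hE]|g gd].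
  have [| |y [z [yE _]]] := mf_cone_lift (b := h) (o := (f : mf_hom X Y (~~ i)) - g) htpy.
  - by rewrite raddfB; rewrite [X in X - _]fd [X in _ - X]gd subr0.
  - by rewrite [LHS]hE raddfB.
  - by exists y.
have [| |y [z [yE zE]]] := mf_cone_lift (b := g : mf_hom _ _ (~~ i)) (o := 0) htpy.
- by rewrite raddf0.
- by rewrite [LHS]gd raddf0.
exists y => //.
exists (dcast (negbK i) (- z)).
case: i g gd y z yE zE => g gd y z yE; rewrite !dcastE => zE.
  by rewrite [LHS](raddfN (@mf_d _ _ _ _ true)); apply: (etrans (congr1 -%R zE));
    apply: opprB.
by rewrite [LHS](raddfN (@mf_d _ _ _ _ false)); apply: (etrans (congr1 -%R zE));
  apply: opprB.
Qed.

End QuasiFullyFaithful.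

(** * Transfer of differentials *)

Section Grading.
Variable A : comPzRingType.

(** A finite grading is given by its projections rather than by its summands, so that conditions on
    filtrations become equations; [gtop] bounds the degrees that occur. *)
Record grading (M : lmodType A) := Grading {
  gpr :> nat -> {linear M -> M};
  gtop : nat;
  gprK : forall i x, gpr i (gpr i x) = gpr i x;
  gpr_ortho : forall i j x, i != j -> gpr i (gpr j x) = 0;
  gprE : forall x, x = \sum_(i < gtop) gpr i x
}.

Lemma gpr_ge (M : lmodType A) (G : grading M) i x : (gtop G <= i)%N -> G i x = 0.
Proof.
move=> Gi; rewrite (gprE G x) linear_sum big1 // => j _; apply: gpr_ortho.
by apply: contraTneq Gi => ->; rewrite -ltnNge ltn_ord.
Qed.

Lemma gpr_eq0 (M : lmodType A) (G : grading M) x : (forall i, G i x = 0) -> x = 0.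
Proof. by move=> Gx; rewrite (gprE G x) big1. Qed.

Definition gshift_pr (M : lmodType A) (G : grading M) i : {linear M -> M} :=
  if i is j.+1 then G j else \0.

Fact gshiftK M (G : grading M) i x : gshift_pr G i (gshift_pr G i x) = gshift_pr G i x.
Proof. by case: i => [|i] //=; apply: gprK. Qed.
Fact gshift_ortho M (G : grading M) i j x :
  i != j -> gshift_pr G i (gshift_pr G j x) = 0.
Proof. by case: i j => [|i] [|j] //= ij; rewrite ?linear0 ?gpr_ortho. Qed.
Fact gshiftE M (G : grading M) x : x = \sum_(i < (gtop G).+1) gshift_pr G i x.
Proof. by rewrite big_ord_recl /= add0r {1}(gprE G x). Qed.
Definition gshift M (G : grading M) : grading M :=
  Grading (gshiftK G) (@gshift_ortho M G) (gshiftE G).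

Section Prod.
Variables (M N : lmodType A) (G : grading M) (H : grading N).
Definition gprod_pr i : {linear (M * N)%type -> (M * N)%type} :=
  lpair (lcomp (G i) (lfst M N)) (lcomp (H i) (lsnd M N)).
Fact gprodK i x : gprod_pr i (gprod_pr i x) = gprod_pr i x.
Proof. by rewrite /= !gprK. Qed.
Fact gprod_ortho i j x : i != j -> gprod_pr i (gprod_pr j x) = 0.
Proof. by move=> ij; rewrite /= !gpr_ortho. Qed.
Fact gprodE x : x = \sum_(i < maxn (gtop G) (gtop H)) gprod_pr i x.
Proof.
have wide (L : lmodType A) (K : grading L) m y : (gtop K <= m)%N ->
  y = \sum_(i < m) K i y.
  move=> Km; rewrite {1}(gprE K y) (big_ord_widen m (fun i => K i y)) // big_mkcond /=.
  by apply: eq_bigr => i _; case: ltnP => // Ki; rewrite gpr_ge.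
case: x => x y; apply: injective_projections; rewrite /=.
  by rewrite (raddf_sum (lfst M N)) /=; apply: wide; rewrite leq_maxl.
by rewrite (raddf_sum (lsnd M N)) /=; apply: wide; rewrite leq_maxr.
Qed.
Definition gprod : grading (M * N)%type := Grading gprodK gprod_ortho gprodE.
End Prod.

Fact gtriv_prK (M : lmodType A) i (x : M) :
  (if i == 0%N then lid M else \0) ((if i == 0%N then lid M else \0) x)
    = (if i == 0%N then lid M else \0) x :> M.
Proof. by case: i. Qed.
Fact gtriv_ortho (M : lmodType A) i j (x : M) : i != j ->
  (if i == 0%N then lid M else \0) ((if j == 0%N then lid M else \0) x) = 0 :> M.
Proof. by case: i j => [|i] [|j]. Qed.
Fact gtrivE (M : lmodType A) (x : M) :
  x = \sum_(i < 1) (if (i : nat) == 0%N then lid M else \0) x.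
Proof. by rewrite big_ord1. Qed.
Definition gtriv (M : lmodType A) : grading M :=
  @Grading M (fun i => if i == 0%N then lid M else \0) 1%N
    (@gtriv_prK M) (@gtriv_ortho M) (@gtrivE M).

(** A condition on filtrations: degree [i] is sent into degrees at least [i + p]. By contrast,
    [lowers] asks for homogeneity of degree -1. *)
Definition raises (M N : lmodType A) (G : grading M) (H : grading N) (p : nat)
    (f : M -> N) :=
  forall i j x, (j < i + p)%N -> H j (f (G i x)) = 0.

Definition lowers (M : lmodType A) (G : grading M) (f : {linear M -> M}) :=
  forall i x, G i (f x) = f (G i.+1 x).

Section Raises.
Variables (M N L : lmodType A) (G : grading M) (H : grading N) (K : grading L).

Lemma raises_comp p q (f : {linear N -> L}) (g : {linear M -> N}) :
  raises H K p f -> raises G H q g -> raises G K (p + q)%N (lcomp f g).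
Proof.
move=> rf rg i j x jipq /=; rewrite (gprE H (g _)) !linear_sum big1 // => k _.
have [ki|ik] := ltnP k (i + q)%N; first by rewrite rg // !linear0.
by rewrite rf //; apply: leq_trans jipq _; rewrite [(p + q)%N]addnC addnA leq_add2r.
Qed.

Lemma raisesD p (f g : {linear M -> N}) :
  raises G H p f -> raises G H p g -> raises G H p (f \+ g).
Proof. by move=> rf rg i j x ji /=; rewrite linearD rf // rg // addr0. Qed.

Lemma raisesN p (f : {linear M -> N}) : raises G H p f -> raises G H p (\- f).
Proof. by move=> rf i j x ji /=; rewrite (linearN (H j)) rf // oppr0. Qed.

Lemma raisesB p (f g : {linear M -> N}) :
  raises G H p f -> raises G H p g -> raises G H p (f \- g).
Proof. by move=> rf rg i j x ji /=; rewrite linearB rf // rg // subr0. Qed.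

Lemma raisesW p q (f : M -> N) : (q <= p)%N -> raises G H p f -> raises G H q f.
Proof. by move=> qp rf i j x ji; apply: rf; apply: leq_trans ji _; rewrite leq_add2l. Qed.

Lemma raises_eq p (f g : M -> N) : f =1 g -> raises G H p f -> raises G H p g.
Proof. by move=> fg rf i j x ji; rewrite -fg rf. Qed.

Lemma raises_shiftl p (f : {linear M -> N}) :
  raises G H p.+1 f -> raises (gshift G) H p f.
Proof.
move=> rf [|i] j x ji /=; first by rewrite !linear0.
by apply: rf; rewrite addnS.
Qed.

Lemma raises_shiftr p (f : M -> N) :
  raises G (gshift H) p.+1 f -> raises G H p f.
Proof. by move=> rf i j x ji; apply: (rf i j.+1); rewrite addnS. Qed.

Lemma raises_top p (f : {linear M -> N}) :
  raises G H p f -> (gtop H <= p)%N -> forall x, f x = 0.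
Proof.
move=> rf Hp x; rewrite (gprE G x) linear_sum big1 // => i _.
apply: (gpr_eq0 (G := H)) => j; have [jp|pj] := ltnP j (i + p)%N; first exact: rf.
by apply: gpr_ge; apply: leq_trans Hp (leq_trans (leq_addl _ _) pj).
Qed.
End Raises.

Lemma lowers0 (M : lmodType A) (G : grading M) (f : {linear M -> M}) x :
  lowers G f -> f (G 0%N x) = 0.
Proof.
move=> lf; apply: (gpr_eq0 (G := G)) => i; rewrite lf.
by rewrite gpr_ortho // linear0.
Qed.

Section NullHomotopyGraded.
Variables (E C : lmodType A) (G : grading E) (H : grading C).
Variables (dE : {linear E -> E}) (dC : {linear C -> C}).
Hypotheses (projE : projective E) (lE : lowers G dE) (lC : lowers H dC).
Hypotheses (dEE : forall x, dE (dE x) = 0) (dCC : forall x, dC (dC x) = 0).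
Hypothesis exC : forall x, dC x = 0 -> exists y, dC y = x.

(* The usual comparison of a projective complex with an exact one, where f need
   only be a chain map, and the homotopy only work, up to terms of higher degree. *)
Lemma leading_null_homotopy p (f : {linear E -> C}) :
  raises G H p f -> raises G H p (lcomp dC f \+ lcomp f dE) ->
  exists2 s : {linear E -> C}, raises G H p.+1 s &
    raises G H p.+1 (f \- (lcomp dC s \- lcomp s dE)).
Proof.
move=> rf rdf; pose rest s : {linear E -> C} := f \- (lcomp dC s \- lcomp s dE).
suff [s rs rest0] : exists2 s : {linear E -> C}, raises G H p.+1 s &
    forall i j x, (i < gtop G)%N -> (j < i + p.+1)%N -> H j (rest s (G i x)) = 0.
  exists s => // i j x ji; have [iG|Gi] := ltnP i (gtop G); first exact: rest0.
  by rewrite (gpr_ge (G := G)) // !linear0.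
(* The homotopy is built on one source degree at a time; [q] counts the degrees already treated. *)
elim: (gtop G) => [|q [s rs IH]].
  by exists \0 => // i j x _ /=; rewrite linear0.
have rrest : raises G H p (rest s).
  apply: raisesB => //; apply: raisesB.
    move=> i j x ji /=; rewrite lC rs ?linear0 //.
    by rewrite addnS ltnS.
  move=> -[|i] j x ji /=; first by rewrite (lowers0 _ lE) !linear0.
  by rewrite -lE; apply: rs; rewrite addnS -addSn.
have rdrest : raises G H p (lcomp dC (rest s) \+ lcomp (rest s) dE).
  apply: raises_eq rdf => x; rewrite /= !(linearD dC, linearN dC) dCC dEE linear0.
  by module.
(* [u] is the leading part of the error on source degree [q]. It is a cycle, because [dE] leads to
   degree [q - 1], where the error is already of higher order. *)
pose u : {linear E -> C} := lcomp (H (q + p)%N) (lcomp (rest s) (G q)).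
have du x : dC (u x) = 0.
  rewrite /u /=; case eqp : (q + p)%N => [|r]; first exact: lowers0.
  have : H r (dC (rest s (G q x)) + rest s (dE (G q x))) = 0.
    by apply: rdrest; rewrite eqp.
  rewrite -lC (linearD (H r)) => /eqP; rewrite addr_eq0 => /eqP ->.
  apply/eqP; rewrite oppr_eq0; apply/eqP; move: eqp IH {u}; case: (q) => [|q'] eqp IH.
    by rewrite (lowers0 _ lE) !linear0.
  by rewrite -lE; apply: IH => //; rewrite addnS -addSn eqp.
(* Exactness and projectivity lift [u] through [dC]; the lift is then truncated to be homogeneous,
   from degree [q] to degree [q + p + 1]. Thus [v] leaves the earlier degrees untouched. *)
have [v0 v0E] := proj_lift (f := u) projE (fun x => exC (du x)).
pose v : {linear E -> C} := lcomp (H (q + p).+1%N) (lcomp v0 (G q)).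
have dv x : dC (v x) = u x by rewrite /v /= -lC v0E /u /= !gprK.
have vG i x : i != q -> v (G i x) = 0.
  by move=> iq; rewrite /v /= gpr_ortho ?linear0 // eq_sym.
exists (s \+ v).
  apply: raisesD => // i j x ji; have [eiq|iq] := eqVneq i q;
    last by rewrite vG // linear0.
  rewrite {}eiq in ji *; rewrite /v /= gprK gpr_ortho //.
  by apply: contraTneq ji => ->; rewrite addnS ltnn.
have restE x : rest (s \+ v) x = rest s x - (u x - v (dE x)).
  rewrite -[LHS]/(f x - (dC (s x + v x) - (s (dE x) + v (dE x)))) (linearD dC) dv.
  rewrite -[rest s x]/(f x - (dC (s x) - s (dE x))).
  by move: (u x) (v (dE x)) => a b; module.
have vd i x : (i <= q)%N -> v (dE (G i x)) = 0.
  case: i => [|i] iq; first by rewrite (lowers0 _ lE) linear0.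
  by rewrite -lE vG // neq_ltn iq.
move=> i j x; rewrite ltnS => iq ji; rewrite restE vd // subr0 linearB.
have [eiq|iq'] := eqVneq i q; last first.
  rewrite IH //; last by rewrite ltn_neqAle iq'.
  rewrite -[u _]/(H (q + p)%N (rest s (G q (G i x)))) (gpr_ortho G);
    last by rewrite eq_sym.
  by rewrite !linear0 ?subr0 ?addr0.
rewrite {i iq}eiq in ji *; rewrite -[u _]/(H (q + p)%N (rest s (G q (G q x)))) gprK.
have [->|jqp] := eqVneq j (q + p)%N; first by rewrite gprK subrr.
by rewrite [X in _ - X]gpr_ortho // subr0 rrest // ltn_neqAle jqp -ltnS -addnS.
Qed.
End NullHomotopyGraded.
End Grading.

(** * Transfer of a square root of w along a quasi-isomorphism *)

Section Perturbation.
Variables (A : comPzRingType) (w : A) (E F : lmodType A).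
Variables (G : grading E) (H : grading F).
Variables (dE : {linear E -> E}) (dF : {linear F -> F}) (l : {linear E -> F}).
Variable d : {linear F -> F}.
Hypotheses (projE : projective E) (lE : lowers G dE) (lF : lowers H dF).
Hypotheses (dEE : forall x, dE (dE x) = 0) (dFF : forall x, dF (dF x) = 0).
Hypotheses (ld : forall x, l (dE x) = dF (l x)) (lpr : forall i x, H i (l x) = l (G i x)).
Hypotheses (dd : forall x, d (d x) = w *: x) (ddF : forall x, d (dF x) + dF (d x) = 0).
Hypothesis rd : raises H H 0 d.

Definition cone_d : {linear (E * F)%type -> (E * F)%type} :=
  lpair (\- lcomp dE (lfst E F)) (lcase l dF).
Definition cone_grading := gprod (gshift G) H.

Hypothesis exC : forall x, cone_d x = 0 -> exists y, cone_d y = x.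

Let lower_cone : lowers cone_grading cone_d.
Proof.
move=> i [a b]; apply: injective_projections => /=.
  rewrite linearN; congr (- _); case: i => [|i] /=; first by rewrite (lowers0 _ lE).
  exact: lE.
by rewrite linearD lpr lF.
Qed.

Let cone_dd x : cone_d (cone_d x) = 0.
Proof.
case: x => a b; apply: injective_projections => /=.
  by rewrite (linearN dE) dEE !oppr0.
by rewrite (linearN l) (linearD dF) ld dFF addr0 addNr.
Qed.

(* A pair (alpha, g) is encoded as t : E -> E * F; then twist t is the total
   differential on the cone, and t solves the problem iff its square is w. *)
Let twist (t : {linear E -> (E * F)%type}) : {linear (E * F)%type -> (E * F)%type} :=
  lcase t (lpair \0 (dF \+ d)).
Let defect (t : {linear E -> (E * F)%type}) : {linear E -> (E * F)%type} :=
  lcomp (twist t) t \- lscale w (linl E F).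
Let t0 : {linear E -> (E * F)%type} := lpair (\- dE) l.

Let twistE t x : twist t x = t x.1 + (0, dF x.2 + d x.2).
Proof. by []. Qed.

Let twist2 t x : twist t (twist t x) = defect t x.1 + w *: x.
Proof.
case: x => a b; rewrite [twist t (a, b)]twistE (linearD (twist t)).
have -> : twist t (t a) = defect t a + w *: (a, 0).
  by rewrite -[defect t a]/(twist t (t a) - w *: (a, 0)) subrK.
rewrite -addrA; congr (_ + _); rewrite twistE (linear0 t) add0r.
apply: injective_projections => /=; rewrite ?addr0 //.
rewrite scaler0 add0r (linearD dF) (linearD d) dFF dd add0r addrA.
by rewrite [X in X + _]addrC ddF add0r.
Qed.

(** A Bianchi identity: [twist t] commutes with its own square, hence with the defect. To leading
    order it says that the defect is a chain map up to sign, as [leading_null_homotopy] requires. *)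
Let defect_comm t x : twist t (defect t x) = defect t (t x).1.
Proof.
have tx : twist t (x, 0) = t x.
  rewrite twistE !linear0 addr0 -[X in _ + X]/(0 : (E * F)%type).
  by rewrite addr0.
have := congr1 (twist t) (twist2 t (x, 0)); rewrite tx twist2 [RHS]linearD.
by rewrite [X in _ = _ + X]linearZ_LR tx => /addIr/esym.
Qed.

Let rfst (M : lmodType A) (K : grading M) p (f : {linear M -> (E * F)%type}) :
  raises K cone_grading p f -> raises K (gshift G) p (lcomp (lfst E F) f).
Proof. by move=> rf i j x ji /=; have /(congr1 fst) := rf i j x ji. Qed.

(** Obstruction theory: the defect of order [p] is a boundary to leading order because the cone is
    exact, and subtracting the homotopy from [t] raises the order by one. The start [t0] is the cone
    differential itself. *)
Let solve p : exists2 t : {linear E -> (E * F)%type}, raises G cone_grading 1 (t \- t0) &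
  raises G cone_grading p (defect t).
Proof.
elim: p => [|p [t rt rdef]].
  exists t0; first by move=> i j x _; rewrite -[(_ \- _) _]/(t0 _ - t0 _) subrr linear0.
  move=> i j x; rewrite addn0 => ji.
  have -> : defect t0 (G i x) = (- (w *: G i x), d (l (G i x))).
    apply: injective_projections => /=.
      by rewrite (linearN dE) dEE !oppr0 ?add0r ?addr0 ?add0r.
    by rewrite (linearN l) ld scaler0 subr0 addrA addNr add0r.
  apply: injective_projections => /=.
    case: j ji => [|j] //= ji; rewrite linearN linearZ /= gpr_ortho ?scaler0 ?oppr0 //.
    by rewrite neq_ltn (leq_trans _ ji).
  by rewrite -lpr; apply: rd; rewrite addn0.
have rtE : raises G (gshift G) 1 (lcomp (lfst E F) (t \- t0)) by exact: rfst.
have rtE' : raises G G 0 (lcomp (lfst E F) (t \- t0)) by exact: raises_shiftr.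
have rdiff : raises cone_grading cone_grading 0 (cone_d \- twist t).
  have r1 : raises cone_grading cone_grading 0 (lcomp (t \- t0) (lfst E F)).
    apply: (@raises_comp _ _ _ _ _ (gshift G) _ 0 0); first exact: raises_shiftl.
    by move=> i j x; rewrite addn0 => ji /=; rewrite (gpr_ortho (gshift G)) // neq_ltn ji.
  have r2 : raises cone_grading cone_grading 0 (lcomp (linr E F) (lcomp d (lsnd E F))).
    move=> i j x ji; apply: injective_projections => /=; first by rewrite linear0.
    exact: rd.
  apply: raises_eq (raisesN (raisesD r1 r2)) => -[a b].
  by apply: injective_projections => /=; module.
have [|s rs rs'] := leading_null_homotopy projE lE lower_cone dEE cone_dd exC rdef.
  have r1 : raises G cone_grading p _ := raises_comp rdiff rdef.
  have r2 := raises_comp rdef rtE'; rewrite addn0 in r2.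
  apply: raises_eq (raisesD r1 r2) => x.
  have e := defect_comm t x.
  rewrite -[LHS]/(cone_d (defect t x) - twist t (defect t x) +
    defect t ((t x).1 - (t0 x).1)) e.
  rewrite (linearB (defect t)) -[(t0 x).1]/(- dE x) (linearN (defect t)).
  by rewrite -[RHS]/(cone_d (defect t x) + defect t (dE x)); module.
exists (t \- s).
  apply: raises_eq (raisesB rt (raisesW (ltn0Sn p) rs)) => x.
  by rewrite /=; module.
(* The defect of [t - s] is that of [t] minus the boundary of [s], plus three terms of order
   [p + 1]: [cone_d - twist t] preserves the filtration, [t] agrees with [t0] to leading order, and
   the last term is quadratic in [s]. *)
have r1 : raises G cone_grading p.+1 _ := raises_comp rdiff rs.
have r2 := raises_comp rs rtE'; rewrite addn0 in r2.
have r3 := raises_comp (raises_shiftl rs) (rfst rs).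
have {}r3 : raises G cone_grading p.+1 (lcomp s (lcomp (lfst E F) s)).
  by apply: raisesW r3; rewrite leq_addl.
apply: raises_eq (raisesD (raisesD rs' r1) (raisesB r3 r2)) => x.
rewrite -[RHS]/(twist (t \- s) (t x - s x) - w *: (x, 0)).
have twS y : twist (t \- s) y = t y.1 - s y.1 + (0, dF y.2 + d y.2) by [].
rewrite -[LHS]/(defect t x - (cone_d (s x) - s (dE x)) + (cone_d (s x) - twist t (s x))
  + (s (s x).1 - s ((t x).1 - (- dE x)))).
rewrite -[defect t x]/(twist t (t x) - w *: (x, 0)) twS !twistE.
rewrite -[(t x - s x).1]/((t x).1 - (s x).1) -[(t x - s x).2]/((t x).2 - (s x).2).
rewrite !(linearB t) !(linearB s) (linearN s) (linearB dF) (linearB d).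
have -> : (0, dF (t x).2 - dF (s x).2 + (d (t x).2 - d (s x).2)) =
  (0, dF (t x).2 + d (t x).2) - (0, dF (s x).2 + d (s x).2) :> (E * F)%type.
  by apply: injective_projections => /=; module.
by move: (0, _) (0, _) => a b; module.
Qed.

(** A defect of order [gtop cone_grading] is zero. The components of [t] are then [- a] and [g],
    with the sign of the cone. *)
Lemma perturbation : exists (a : {linear E -> E}) (g : {linear E -> F}),
  [/\ forall x, a (a x) = w *: x, forall x, g (a x) = dF (g x) + d (g x)
    & raises G H 1 (g \- l)].
Proof.
have [t rt rdef] := solve (gtop cone_grading).
have def0 x : twist t (t x) = w *: (x, 0).
  by apply/eqP; rewrite -subr_eq0; apply/eqP; apply: (raises_top rdef).
exists (\- lcomp (lfst E F) t), (lcomp (lsnd E F) t).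
have [e1 e2] : (forall x, (t (t x).1).1 = w *: x) /\
    (forall x, (t (t x).1).2 + (dF (t x).2 + d (t x).2) = 0).
  split=> x; have := def0 x; rewrite twistE.
    by move=> /(congr1 fst) /=; rewrite addr0.
  by move=> /(congr1 snd) /=; rewrite scaler0.
split=> [x|x|] /=.
- by rewrite !linearN opprK.
- by rewrite linearN; apply/eqP; rewrite eqr_oppLR -addr_eq0 e2.
- by move=> i j x ji; have /(congr1 snd) := rt i j x ji.
Qed.

End Perturbation.

(** * Koszul complexes *)

Section Koszul.
Variable A : comPzRingType.
Implicit Types (M N : lmodType A) (cs : seq A).

(** Iterated cones: K(c :: cs) is the cone of [c] on K(cs), with the second factor shifted up by one
    degree. *)
Fixpoint kos M cs : lmodType A :=
  if cs is c :: cs' then (kos M cs' * kos M cs')%type else M.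

Fixpoint kos_d M cs : {linear kos M cs -> kos M cs} :=
  if cs is c :: cs' return {linear kos M cs -> kos M cs} then
    lpair (lcase (kos_d M cs') (lscale c (lid (kos M cs'))))
          (\- lcomp (kos_d M cs') (lsnd _ _))
  else \0.

Fixpoint kos_grading M cs : grading (kos M cs) :=
  if cs is c :: cs' return grading (kos M cs) then
    gprod (kos_grading M cs') (gshift (kos_grading M cs'))
  else gtriv M.

Fixpoint kos_map M N (f : {linear M -> N}) cs : {linear kos M cs -> kos N cs} :=
  if cs is c :: cs' return {linear kos M cs -> kos N cs} then
    lpair (lcomp (kos_map f cs') (lfst _ _)) (lcomp (kos_map f cs') (lsnd _ _))
  else f.

(* The extension of an odd operator: (-1)^p f in degree p. *)
Fixpoint kos_odd M (f : {linear M -> M}) cs : {linear kos M cs -> kos M cs} :=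
  if cs is c :: cs' return {linear kos M cs -> kos M cs} then
    lpair (lcomp (kos_odd f cs') (lfst _ _)) (\- lcomp (kos_odd f cs') (lsnd _ _))
  else f.

Fixpoint kos_in M cs : {linear M -> kos M cs} :=
  if cs is c :: cs' return {linear M -> kos M cs} then lpair (kos_in M cs') \0
  else lid M.

Lemma kos_projective M cs : projective M -> projective (kos M cs).
Proof. by move=> projM; elim: cs => //= c cs IH; apply: projective_prod. Qed.

Lemma kos_dd M cs x : kos_d M cs (kos_d M cs x) = 0.
Proof.
elim: cs x => //= c cs IH [x y]; apply: injective_projections => /=.
  by rewrite (linearD (kos_d M cs)) IH (linearZ_LR (kos_d M cs)); module.
by rewrite (linearN (kos_d M cs)) IH oppr0 oppr0.
Qed.

Lemma kos_lowers M cs : lowers (kos_grading M cs) (kos_d M cs).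
Proof.
elim: cs => [|c cs IH] i x /=; first by rewrite linear0.
apply: injective_projections => /=; first by rewrite linearD IH linearZ.
rewrite linearN; congr (- _); case: i => [|i] /=; last exact: IH.
by rewrite (lowers0 _ IH).
Qed.

Lemma kos_odd_d M (f : {linear M -> M}) cs x :
  kos_odd f cs (kos_d M cs x) + kos_d M cs (kos_odd f cs x) = 0.
Proof.
elim: cs x => [|c cs IH] x /=; first by rewrite linear0 addr0.
apply: injective_projections => /=.
  rewrite (linearD (kos_odd f cs)) (linearZ_LR (kos_odd f cs)).
  by transitivity (kos_odd f cs (kos_d M cs x.1) + kos_d M cs (kos_odd f cs x.1));
    [module|].
by rewrite (linearN (kos_odd f cs)) (linearN (kos_d M cs)) !opprK.
Qed.

Lemma kos_oddM M (f g : {linear M -> M}) a cs x :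
  (forall y, f (g y) + g (f y) = a *: y) ->
  kos_odd f cs (kos_odd g cs x) + kos_odd g cs (kos_odd f cs x) = a *: x.
Proof.
move=> fg; elim: cs x => [|c cs IH] x //=; apply: injective_projections => //=.
by rewrite (linearN (kos_odd f cs)) (linearN (kos_odd g cs)) !opprK.
Qed.

Lemma kos_odd2 M (f : {linear M -> M}) a cs x :
  (forall y, f (f y) = a *: y) -> kos_odd f cs (kos_odd f cs x) = a *: x.
Proof.
move=> ff; elim: cs x => [|c cs IH] x //=; apply: injective_projections => //=.
by rewrite (linearN (kos_odd f cs)) opprK.
Qed.

Lemma kos_odd_raises M (f : {linear M -> M}) cs :
  raises (kos_grading M cs) (kos_grading M cs) 0 (kos_odd f cs).
Proof.
elim: cs => [|c cs IH] i j x ji.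
  by case: i j ji => [|i] [|j] //=; rewrite ?linear0.
apply: injective_projections => /=; first exact: IH.
rewrite linearN /=; case: j ji => [|j] /=; first by rewrite oppr0.
by case: i => [|i] //= ji; rewrite IH ?oppr0.
Qed.

Lemma kos_map_d M N (f : {linear M -> N}) cs x :
  kos_map f cs (kos_d M cs x) = kos_d N cs (kos_map f cs x).
Proof.
elim: cs x => [|c cs IH] x /=; first by rewrite linear0.
apply: injective_projections => /=; last by rewrite linearN IH.
by rewrite (linearD (kos_map f cs)) (linearZ_LR (kos_map f cs)) IH.
Qed.

Lemma kos_map_odd M N (f : {linear M -> N}) (g : {linear M -> M}) (h : {linear N -> N})
    cs x : (forall y, f (g y) = h (f y)) ->
  kos_map f cs (kos_odd g cs x) = kos_odd h cs (kos_map f cs x).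
Proof.
move=> fg; elim: cs x => [|c cs IH] x //=.
apply: injective_projections => //=; by rewrite linearN IH.
Qed.

Lemma kos_map_in M N (f : {linear M -> N}) cs x :
  kos_map f cs (kos_in M cs x) = kos_in N cs (f x).
Proof.
by elim: cs => [|c cs IH] //=; apply: injective_projections => //=; rewrite linear0.
Qed.

Lemma kos_in_d M cs x : kos_d M cs (kos_in M cs x) = 0.
Proof.
elim: cs => [|c cs IH] //=; apply: injective_projections => /=.
  by rewrite IH scaler0 addr0.
by rewrite linear0 oppr0.
Qed.

Lemma kos_in_odd M (f : {linear M -> M}) cs x :
  kos_odd f cs (kos_in M cs x) = kos_in M cs (f x).
Proof.
elim: cs => [|c cs IH] //=; apply: injective_projections => //=.
by rewrite linear0 oppr0.
Qed.

(* Each cone of c is split by a homotopy h with d h + h d = c. *)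
Lemma kos_retract M (d : {linear M -> M}) cs :
  (forall c, c \in cs -> exists h : {linear M ->
    M}, forall x, d (h x) + h (d x) = c *: x) ->
  exists r : {linear kos M cs -> M},
    (forall x, r (kos_in M cs x) = x) /\
    forall x, r (kos_d M cs x + kos_odd d cs x) = d (r x).
Proof.
elim: cs => [|c cs IH] htpy.
  by exists (lid M); split=> x //=; rewrite add0r.
have [|r [rin rd]] := IH; first by move=> c' c'cs; apply: htpy; rewrite inE c'cs orbT.
have [h hE] := htpy c (mem_head _ _).
exists (lcase r (lcomp r (kos_odd h cs))); split=> x /=.
  by rewrite rin !linear0 addr0.
case: x => x y /=; rewrite -[X in d X]linearD -rd -[LHS]linearD; congr (r _).
have e1 := kos_odd_d h y; have e2 := kos_oddM y hE.
rewrite !(linearD (kos_odd h cs)) !(linearN (kos_odd h cs)) (linearD (kos_d M cs))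
  (linearD (kos_odd d cs)).
move/eqP: e1; rewrite addrC addr_eq0 => /eqP ->; rewrite -e2.
by module.
Qed.

End Koszul.

Section Restriction.
Variables (A B : comPzRingType) (phi : {rmorphism A -> B}) (S : A -> Prop).
Hypothesis locS : is_localization phi S.

Definition grestr (V : lmodType B) (G : grading V) : grading (restr phi V) :=
  @Grading A (restr phi V) (fun i => restr_map phi (G i)) (gtop G)
    (gprK G) (gpr_ortho G) (gprE G).

Fact loc_pair_linear (K : lmodType A) (W : lmodType B) (f : {linear K -> restr phi W}) :
  linear (fun x : (K * K)%type => (f x.1, f x.2) : restr phi (W * W)%type).
Proof. by move=> a x y; apply: injective_projections => /=; rewrite linearP. Qed.

Definition loc_pair (K : lmodType A) (W : lmodType B) (f : {linear K -> restr phi W}) :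
  {linear (K * K)%type -> restr phi (W * W)%type} := mklin (loc_pair_linear f).

Lemma loc_pair_map (K : lmodType A) (W : lmodType B) (f : {linear K -> restr phi W}) :
  is_loc_map S f -> is_loc_map S (loc_pair f).
Proof.
move=> [ker den]; split=> [x x0|[v v']].
  have [t St tx] : exists2 t, S t & t *: x.1 = 0 by apply: ker; exact: (congr1 fst x0).
  have [u Su ux] : exists2 t, S t & t *: x.2 = 0 by apply: ker; exact: (congr1 snd x0).
  exists (t * u); first exact: (loczM locS).
  apply: injective_projections => /=; last by rewrite -scalerA ux scaler0.
  by rewrite mulrC -scalerA tx scaler0.
have [t [x [St e]]] := den v; have [u [y [Su e']]] := den v'.
exists (t * u), (u *: x, t *: y); split; first exact: (loczM locS).
rewrite rmorphM; apply: injective_projections => /=.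
  transitivity (phi u *: (phi t *: v)); first by rewrite scalerA mulrC.
  by rewrite e [RHS]linearZ_LR.
transitivity (phi t *: (phi u *: v')); first by rewrite scalerA.
by rewrite e' [RHS]linearZ_LR.
Qed.

Variables (M : lmodType A) (V : lmodType B) (l : {linear M -> restr phi V}).

Fixpoint kos_loc (cs : seq A) : {linear kos M cs -> restr phi (kos V (map phi cs))} :=
  if cs is c :: cs' return {linear kos M cs -> restr phi (kos V (map phi cs))} then
    loc_pair (kos_loc cs')
  else l.

Lemma kos_loc_d cs x :
  kos_loc cs (kos_d M cs x) = kos_d V (map phi cs) (kos_loc cs x).
Proof.
elim: cs x => [|c cs IH] x /=; first by rewrite linear0.
apply: injective_projections => /=; last by rewrite linearN IH.
by rewrite (linearD (kos_loc cs)) (linearZ_LR (kos_loc cs)) IH.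
Qed.

Lemma kos_loc_pr cs i x :
  kos_grading V (map phi cs) i (kos_loc cs x) = kos_loc cs (kos_grading M cs i x).
Proof.
elim: cs i x => [|c cs IH] i x /=; first by case: i => //=; rewrite linear0.
by apply: injective_projections => //=; case: i => [|i] //=; rewrite linear0.
Qed.

Lemma kos_loc_map cs : is_loc_map S l -> is_loc_map S (kos_loc cs).
Proof. by move=> ll; elim: cs => //= c cs IH; apply: loc_pair_map. Qed.

(** The homotopy for [c] moves the first factor to the second at the position of [c]. The versions
    over [A] and over [B] are made compatible, so that they act together on the cone. *)
Lemma kos_loc_eps cs c : c \in cs ->
  exists (e : {linear kos M cs -> kos M cs})
         (e' : {linear kos V (map phi cs) -> kos V (map phi cs)}),
  [/\ forall x, kos_d M cs (e x) + e (kos_d M cs x) = c *: x,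
      forall x, kos_d V (map phi cs) (e' x) + e' (kos_d V (map phi cs) x) = phi c *: x
    & forall x, kos_loc cs (e x) = e' (kos_loc cs x)].
Proof.
elim: cs => //= c' cs IH; rewrite inE; case: eqVneq => /= [-> _|_ ccs].
  exists (lpair \0 (lfst _ _)), (lpair \0 (lfst _ _)).
  split=> x; apply: injective_projections => //=;
    rewrite ?linear0 ?addr0 ?add0r ?addKr //.
have {IH ccs} [e [e' [eE e'E le]]] := IH ccs.
exists (lpair (lcomp e (lfst _ _)) (\- lcomp e (lsnd _ _))).
exists (lpair (lcomp e' (lfst _ _)) (\- lcomp e' (lsnd _ _))).
split=> x; apply: injective_projections => //=.
- by rewrite -eE (linearD e) (linearZ_LR e); module.
- by rewrite -eE (linearN (kos_d M cs)) (linearN e) !opprK.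
- by rewrite -e'E (linearD e') (linearZ_LR e'); module.
- by rewrite -e'E (linearN (kos_d V _)) (linearN e') !opprK.
- by rewrite linearN le.
Qed.

(* Up to boundary, cycles of the cone are killed both by cs and by some t in S. *)
Lemma kos_cone_exact cs : is_loc_map S l -> comaximal S cs ->
  let D := cone_d (kos_d M cs) (restr_map phi (kos_d V (map phi cs))) (kos_loc cs) in
  forall x, D x = 0 -> exists y, D y = x.
Proof.
move=> ll comax D x Dx.
have [ker den] := kos_loc_map cs ll.
have DE a b : D (a, b) = (- kos_d M cs a,
  kos_loc cs a + restr_map phi (kos_d V (map phi cs)) b) by [].
pose P a := exists y, D y = a *: x.
have idP : ideal_pred P.
  split=> [|a b c [y ey] [z ez]]; first by exists 0; rewrite linear0 scale0r.
  by exists (a *: y + z); rewrite linearP ey ez scalerDl scalerA.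
have Pc c : c \in cs -> P c.
  move=> /kos_loc_eps[e [e' [eE e'E le]]].
  case: x Dx @P idP => a b Dx P idP; exists (- e a, e' b).
  move: Dx; rewrite !DE => -[/eqP]; rewrite oppr_eq0 => /eqP a0 /eqP.
  rewrite addrC addr_eq0 => /eqP b0.
  apply: injective_projections => /=.
    by rewrite (linearN (kos_d M cs)) opprK -eE a0 linear0 addr0.
  rewrite (linearN (kos_loc cs)) le restrZ -e'E.
  have -> : kos_d V (map phi cs) b = - kos_loc cs a by exact: b0.
  by rewrite (linearN e') addrC.
suff [t St Pt] : exists2 t, S t & P t.
  by have [y yE] := comax t P St idP Pt Pc; exists y; rewrite yE scale1r.
case: x Dx @P idP Pc => a b Dx P _ _.
(* Multiplication by [t] brings the second component from [b']. Then [t a + d b'] dies in the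
   localization, hence under some [u], and [(u b', 0)] has boundary [u t x]. *)
have [t [b' [St e]]] := den b.
move: Dx; rewrite DE => -[/eqP]; rewrite oppr_eq0 => /eqP a0 /eqP.
rewrite addrC addr_eq0 => /eqP b0.
have /ker[u Su uE] : kos_loc cs (t *: a + kos_d M cs b') = 0.
  rewrite linearD linearZ /= kos_loc_d -e restrZ linearZ.
  by rewrite [X in _ + _ *: X]b0 scalerN addrN.
exists (u * t); first exact: (loczM locS).
exists (u *: b', 0); rewrite DE !linear0 addr0; apply: injective_projections => /=.
  move/eqP: uE; rewrite scalerDr addr_eq0 => /eqP uE.
  by rewrite (linearZ_LR (kos_d M cs)) -uE scalerA.
by rewrite (linearZ_LR (kos_loc cs)) -e !restrZ scalerA -rmorphM.
Qed.

End Restriction.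

(** * Realization up to retracts *)

(** [1 + f] is the identity on the associated graded of a finite filtration. Both halves go up the
    degrees, correcting one component at a time. *)
Lemma unipotent_bijective (A : comPzRingType) (M : lmodType A) (G : grading M)
    (f : {linear M -> M}) : raises G G 1 f ->
  (forall x, x + f x = 0 -> x = 0) /\ (forall y, exists x, x + f x = y).
Proof.
move=> rf; split=> [x /eqP|y].
  rewrite addr_eq0 => /eqP xE; apply: (gpr_eq0 (G := G)) => i.
  have [n] := ubnP i; elim: n i => // n IH i; rewrite ltnS => ni.
  rewrite xE linearN {1}(gprE G x) !linear_sum big1 ?oppr0 // => k _ /=.
  have [ki|ik] := ltnP k i; first by rewrite IH ?linear0 // (leq_trans ki).
  by rewrite rf ?oppr0 // addn1 ltnS.
suff [x xE] : exists x, forall i, (i < gtop G)%N -> G i (y - (x + f x)) = 0.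
  exists x; apply/esym/eqP; rewrite -subr_eq0; apply/eqP/(gpr_eq0 (G := G)) => i.
  by have [/xE|/gpr_ge->] := ltnP i (gtop G).
elim: (gtop G) => [|k [x IH]]; first by exists 0.
pose u := G k (y - (x + f x)); exists (x + u) => i; rewrite ltnS => ik.
have -> : y - (x + u + f (x + u)) = y - (x + f x) - u - f u.
  by rewrite linearD; module.
rewrite 2!(linearB (G i)) [G i (f u)]rf ?addn1 // subr0.
have [->|ik'] := eqVneq i k; first by rewrite /u gprK subrr.
rewrite (IH i) ?ltn_neqAle ?ik' // sub0r; apply/eqP; rewrite oppr_eq0; apply/eqP;
  exact: gpr_ortho.
Qed.

Section Realization.
Variables (A B : comPzRingType) (phi : {rmorphism A -> B}) (S : A -> Prop).
Hypothesis locS : is_localization phi S.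

(** Transported along the isomorphism [linext l], the map [linext g] becomes [1 + n], where [n]
    raises the filtration because [g] and [l] agree to leading order. *)
Lemma linext_unipotent (E : lmodType A) (V : lmodType B) (G : grading E) (H : grading V)
    (l g : {linear E -> restr phi V}) :
  is_loc_map S l -> (forall i x, H i (l x) = l (G i x)) ->
  raises G (grestr phi H) 1 (g \- l) ->
  exists k : {linear V -> ext phi E}, cancel (linext g) k /\ cancel k (linext g).
Proof.
move=> ll lG rg; have [k [lk kl]] := loc_map_iso locS ll.
pose n : {linear V -> V} := lcomp (linext g) k \- lid V.
have kE x : k (l x) = tens phi 1 x by rewrite -[l x](linextE l) [LHS]lk.
have nE x : n (l x) = g x - l x by rewrite /n /= [k _]kE linextE.
have rn : raises H H 1 n.
  move=> i j v ji; have [t [x [St e]]] := ll.2 v.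
  apply: (locz_scaleI locS St).
  rewrite scaler0 -!linearZ_LR e lG nE.
  exact: (rg i j x ji).
have [ninj nsurj] := unipotent_bijective rn.
have gE v : linext g v = linext l v + n (linext l v).
  by rewrite /n /= [k _]lk addrC subrK.
apply: linear_inverse.
  apply: raddf_inj => v; rewrite [X in X = 0]gE => /ninj e.
  by rewrite -[v]lk [X in k X]e linear0.
by move=> v; have [x xE] := nsurj v; exists (k x); rewrite gE [linext l _]kl.
Qed.

Variables (w : A) (cs : seq A).
Hypothesis comax : comaximal S cs.

(** [D] squares to [phi w], its two parts anticommuting, and [perturbation] carries it to an
    operator [a] on K(cs; L). Everything happens on one module; the Z/2-grading is restored in
    [mf_realization]. *)
Lemma ungraded_realization (L : lmodType A) (V : lmodType B) (l : {linear L ->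
  restr phi V})
    (d : {linear V -> V}) :
  projective L -> is_loc_map S l -> (forall x, d (d x) = phi w *: x) ->
  let K := kos V (map phi cs) in
  let D x := kos_d V (map phi cs) x + kos_odd d (map phi cs) x in
  exists (E : lmodType A) (a : {linear E -> E}) (f : {linear ext phi E -> K})
      (k : {linear K -> ext phi E}),
    [/\ projective E, forall x, a (a x) = w *: x, cancel f k, cancel k f
      & forall x, f (ext_map phi a x) = D (f x)].
Proof.
move=> projL ll dd K D; pose E := kos L cs.
pose G : grading E := kos_grading L cs.
pose H : grading K := kos_grading V (map phi cs).
have [|||||||||a [g [aa ga rg]]] :=
  @perturbation A w E (restr phi K) G (grestr phi H) (kos_d L cs)
  (restr_map phi (kos_d V (map phi cs))) (kos_loc l cs)
  (restr_map phi (kos_odd d (map phi cs))) (kos_projective projL)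
  (@kos_lowers _ L cs).
- by move=> i x; apply: kos_lowers.
- by move=> x; apply: kos_dd.
- by move=> x; apply: kos_dd.
- by move=> x; apply: kos_loc_d.
- by move=> i x; apply: kos_loc_pr.
- by move=> x; apply: kos_odd2.
- by move=> x; apply: kos_odd_d.
- by move=> i j x ji; apply: kos_odd_raises.
- exact: (kos_cone_exact locS ll comax).
have [k [gk kg]] := linext_unipotent (kos_loc_map locS cs ll) (@kos_loc_pr _ _ phi _ _
  l cs) rg.
exists E, a, (linext g), k; split=> //; first exact: kos_projective.
have Dlin : linear D by move=> b x y; rewrite /D !linearP; module.
have e : lcomp (linext g) (ext_map phi a) = lcomp (mklin Dlin) (linext g).
  by apply: ext_eq => x; rewrite /= ext_mapE !linextE ga.
by move=> x; exact: (congr1 (fun h : {linear _ -> _} => h x) e).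
Qed.

(* With P = Y^0 + Y^1 a summand of a free module F, and p the projection of F
   onto P, the operator (x, y) |-> (d p x + w (1 - p) y, d p y + (1 - p) x) on
   F + F has square w, is defined on a free module, and contains (P, d). *)
Lemma mf_realization (Y : mf (phi w)) :
  (forall c, c \in cs -> null_homotopic Y (phi c)) ->
  exists (X : mf w) (j : mf_hom Y (mf_ext phi X) false)
      (r : mf_hom (mf_ext phi X) Y false),
    [/\ mf_d j = 0, mf_d r = 0 & mf_comp r j = mf_id Y].
Proof.
move=> htpy; pose P : lmodType B := (Y false * Y true)%type.
pose dP : {linear P -> P} :=
  lpair (lcomp (mf_d1 Y) (lsnd _ _)) (lcomp (mf_d0 Y) (lfst _ _)).
have projP : projective P by apply: projective_prod; apply: mf_proj.
have dPP x : dP (dP x) = phi w *: x.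
  by apply: injective_projections; rewrite /= ?mf_d10 ?mf_d01.
pose F := ext phi (free_mod A P).
pose q : {linear F -> P} := linext (free_map (fun x : P => x : restr phi P)).
have [|i qi] := proj_lift (g := q) (f := lid P) projP.
  by move=> x; exists (tens phi 1 (fgen A (x : P))); rewrite linextE free_mapE.
have {}qi x : q (i x) = x by apply: qi.
pose V : lmodType B := (F * F)%type.
pose pi : {linear F -> F} := lcomp i q; pose npi : {linear F -> F} := lid F \- pi.
pose t : {linear F -> F} := lcomp i (lcomp dP q).
pose d : {linear V -> V} :=
  lpair (lcase t (lscale (phi w) npi)) (lcase npi t).
have tt x : t (t x) =
  phi w *: pi x by rewrite -[LHS]/(i (dP (q (i (dP (q x)))))) qi dPP linearZ.
have tn x : t (npi x) =
  0 by rewrite -[LHS]/(i (dP (q (x - i (q x))))) linearB qi subrr !linear0.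
have nt x : npi (t x) = 0 by rewrite -[LHS]/(t x - i (q (i (dP (q x))))) qi subrr.
have nn x : npi (npi x) = x - pi x.
  by rewrite -[LHS]/(x - i (q x) - i (q (x - i (q x)))) linearB qi subrr linear0 subr0.
have dd x : d (d x) = phi w *: x.
  apply: injective_projections.
    rewrite -[LHS]/(t (t x.1 + phi w *: npi x.2) + phi w *: npi (npi x.1 + t x.2)).
    rewrite (linearD t) (linearD npi) (linearZ_LR t) tt tn nt nn -[RHS]/(phi w *: x.1).
    by move: (pi x.1) => z; module.
  rewrite -[LHS]/(npi (t x.1 + phi w *: npi x.2) + t (npi x.1 + t x.2)).
  rewrite (linearD t) (linearD npi) (linearZ_LR npi) tt tn nt nn -[RHS]/(phi w *: x.2).
  by move: (pi x.2) => z; module.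
pose inV : {linear P -> V} := lpair i \0;
  pose outV : {linear V -> P} := lcomp q (lfst F F).
have in_d x : d (inV x) = inV (dP x).
  have nip : npi (i x) = 0 by rewrite -[LHS]/(i x - i (q (i x))) qi subrr.
  have tip : t (i x) = i (dP x) by rewrite -[LHS]/(i (dP (q (i x)))) qi.
  apply: injective_projections.
    by rewrite -[LHS]/(t (i x) + phi w *: npi 0) tip linear0 scaler0 addr0.
  by rewrite -[LHS]/(npi (i x) + t 0) nip linear0 addr0.
have out_d x : outV (d x) = dP (outV x).
  have qn y : q (npi y) = 0 by rewrite -[LHS]/(q (y - i (q y))) linearB qi subrr.
  have qt y : q (t y) = dP (q y) by rewrite -[LHS]/(q (i (dP (q y)))) qi.
  by rewrite -[LHS]/(q (t x.1 + phi w *: npi x.2)) linearD linearZ_LR qn qt scaler0 addr0.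
have out_in x : outV (inV x) = x by rewrite /= qi.
have freeL := @free_projective A P.
have ll := loc_pair_map locS (ext_unit_loc locS freeL).
have [E [a [f [k [projE aa fk kf fa]]]]] :=
  ungraded_realization (projective_prod freeL freeL) ll dd.
(* The null-homotopies are given on [Y], hence on [P] but not on [V]; so the retraction is formed on
   K(cs; P), which K(cs; V) reaches through [outV]. *)
have [|r [rin rd]] := @kos_retract B P dP (map phi cs).
  move=> _ /mapP[c /htpy[h0 [h1 [e0 e1]]] ->].
  exists (lpair (lcomp h1 (lsnd _ _)) (lcomp h0 (lfst _ _))) => x.
  by apply: injective_projections => /=; rewrite ?e0 ?e1.
have ka x : ext_map phi a (k x) =
    k (kos_d V (map phi cs) x + kos_odd d (map phi cs) x).
  by rewrite -[LHS]fk fa kf.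
(* A copy of [E] in each degree restores the grading. The same doubling turns (P, dP) into [Y] plus
   a shifted copy of [Y], of which only [Y] is kept. *)
pose X := MF (fun _ : bool => projE) aa aa.
pose jj : {linear P -> ext phi E} := lcomp k (lcomp (kos_in V (map phi cs)) inV).
pose rr : {linear ext phi E -> P} := lcomp r (lcomp (kos_map outV (map phi cs)) f).
have jd x : ext_map phi a (jj x) = jj (dP x).
  by rewrite /jj /= ka kos_in_d add0r kos_in_odd in_d.
have rrd x : rr (ext_map phi a x) = dP (rr x).
  rewrite /rr -rd /= fa linearD kos_map_d (kos_map_odd _ out_d).
  by [].
have rj x : rr (jj x) = x by rewrite /rr /jj /= kf kos_map_in rin out_in.
exists X, (lcomp jj (linl _ _), lcomp jj (linr _ _)), (lcomp (lfst _ _) rr,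
  lcomp (lsnd _ _) rr).
split; apply: mf_hom_ext => x.
- rewrite -[LHS]/(ext_map phi a (jj (x, 0)) - jj (0, mf_d0 Y x)) jd.
  by rewrite -[dP _]/(mf_d1 Y 0, mf_d0 Y x) linear0 subrr.
- rewrite -[LHS]/(ext_map phi a (jj (0, x)) - jj (mf_d1 Y x, 0)) jd.
  by rewrite -[dP _]/(mf_d1 Y x, mf_d0 Y 0) linear0 subrr.
- by rewrite -[LHS]/(mf_d0 Y (rr x).1 - (rr (ext_map phi a x)).2) rrd subrr.
- by rewrite -[LHS]/(mf_d1 Y (rr x).2 - (rr (ext_map phi a x)).1) rrd subrr.
- by rewrite -[LHS]/(rr (jj (x, 0))).1 rj.
- by rewrite -[LHS]/(rr (jj (0, x))).2 rj.
Qed.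

End Realization.

(** * Splitting retracts *)

Section DirectSum.
Variables (A : comPzRingType) (M : lmodType A).

Inductive dsum_rel : seq (A * (nat * M)) -> seq (A * (nat * M)) -> Prop :=
| dsum_relD n x y : dsum_rel [:: (1, (n, x + y))] [:: (1, (n, x)); (1, (n, y))]
| dsum_relZ n a x : dsum_rel [:: (1, (n, a *: x))] [:: (a, (n, x))].

Definition dsum : lmodType A := presented dsum_rel.

Fact din_linear n : linear (fun x : M => gen dsum_rel (n, x) : dsum).
Proof.
move=> a x y.
rewrite {1}/gen (comb_rel (dsum_relD n (a *: x) y)) -cat1s combD; congr (_ + _).
by rewrite (comb_rel (dsum_relZ n a x)) /gen -combZ /= mulr1.
Qed.
Definition din n : {linear M -> dsum} := mklin (din_linear n).

Fact dlift_ex (N : lmodType A) (f : nat -> {linear M -> N}) :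
  exists h : {linear dsum -> N}, forall n x, h (din n x) = f n x.
Proof.
pose g (u : nat * M) := f u.1 u.2.
have grel s t : dsum_rel s t -> feval g s = feval g t.
  case=> [n x y|n a x]; rewrite /feval !big_cons !big_nil !addr0 /g /= ?scale1r.
    by rewrite linearD.
  by rewrite linearZ.
by exists (mklin (plift_linear grel)) => n x; apply: (plift_gen grel).
Qed.
Definition dlift (N : lmodType A) (f : nat -> {linear M -> N}) : {linear dsum -> N} :=
  sval (cid (dlift_ex f)).
Lemma dliftE (N : lmodType A) (f : nat -> {linear M ->
  N}) n x : dlift f (din n x) = f n x.
Proof. exact: (svalP (cid (dlift_ex f))). Qed.

Lemma dsum_ext (N : lmodType A) (f g : {linear dsum -> N}) :
  (forall n x, f (din n x) = g (din n x)) -> forall x, f x = g x.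
Proof. by move=> fg; apply: presented_ext => -[n x]; apply: fg. Qed.

Lemma dsum_projective : projective M -> projective dsum.
Proof.
move=> projM N1 N2 g f gsurj.
have /choice[h hE] : forall n, exists h : {linear M ->
  N1}, forall x, g (h x) = f (din n x).
  by move=> n; have [h hE] := projM N1 N2 g (lcomp f (din n)) gsurj; exists h.
exists (dlift h) => x; rewrite -[LHS]/(lcomp g (dlift h) x); move: x.
by apply: dsum_ext => n x; rewrite /= dliftE hE.
Qed.

End DirectSum.
Arguments din {A} M n.

(** * Cones of closed even maps *)

Section Cone.
Variables (A : comPzRingType) (w : A) (Z : mf w) (u : mf_hom Z Z false).
Hypotheses (du0 : forall x, mf_d0 Z (u.1 x) = u.2 (mf_d0 Z x)).
Hypotheses (du1 : forall x, mf_d1 Z (u.2 x) = u.1 (mf_d1 Z x)).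

Definition mfcone_mod (i : bool) : lmodType A :=
  if i then ((Z false * Z true)%type : lmodType A) else ((Z true * Z false)%type :
    lmodType A).
Fact mfcone_proj i : projective (mfcone_mod i).
Proof. by case: i; apply: projective_prod; apply: mf_proj. Qed.
Definition mfcone_d0 : {linear mfcone_mod false -> mfcone_mod true} :=
  lpair (\- lcomp (mf_d1 Z) (lfst _ _)) (lcase u.2 (mf_d0 Z)).
Definition mfcone_d1 : {linear mfcone_mod true -> mfcone_mod false} :=
  lpair (\- lcomp (mf_d0 Z) (lfst _ _)) (lcase u.1 (mf_d1 Z)).
Fact mfcone_d10 x : mfcone_d1 (mfcone_d0 x) = w *: x.
Proof.
case: x => a b; apply: injective_projections => /=.
  by rewrite (linearN (mf_d0 Z)) opprK mf_d01.
by rewrite (linearN u.1) (linearD (mf_d1 Z)) mf_d10 du1 addrA addNr add0r.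
Qed.
Fact mfcone_d01 x : mfcone_d0 (mfcone_d1 x) = w *: x.
Proof.
case: x => a b; apply: injective_projections => /=.
  by rewrite (linearN (mf_d1 Z)) opprK mf_d10.
by rewrite (linearN u.2) (linearD (mf_d0 Z)) mf_d01 du0 addrA addNr add0r.
Qed.
Definition mfcone : mf w :=
  MF mfcone_proj mfcone_d10 mfcone_d01.
End Cone.

Section HomotopyEquivalence.
Variables (A : comPzRingType) (w : A).

(** The first of the two equivalences is a strict isomorphism, so its inverse [g] is closed along
    with [f]. *)
Lemma homotopy_iso_trans (X Z Y : mf w) (f : mf_hom X Z false) (g : mf_hom Z X false) :
  mf_d f = 0 -> mf_comp g f = mf_id X -> mf_comp f g = mf_id Z ->
  @homotopy_iso (mf_dgcat w) Z Y -> @homotopy_iso (mf_dgcat w) X Y.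
Proof.
move=> df gf fg [a [b [da db [h hE] [k kE]]]].
have E i (P Q : mf w) (p q : mf_hom P Q i) : p = q ->
  p.1 =1 q.1 /\ p.2 =1 q.2 by move=> ->.
have [df1 df2] := E _ _ _ _ _ df.
have [gf1 gf2] := E _ _ _ _ _ gf; have [fg1 fg2] := E _ _ _ _ _ fg.
have [da1 da2] := E true _ _ _ _ da; have [db1 db2] := E true _ _ _ _ db.
have [h1 h2] := E false _ _ _ _ hE; have [k1 k2] := E false _ _ _ _ kE.
move: df1 df2 => /= df1 df2.
have {}df1 x : f.2 (mf_d0 X x) = mf_d0 Z (f.1 x) by apply/esym/eqP; rewrite -subr_eq0;
  apply/eqP/df1.
have {}df2 x : f.1 (mf_d1 X x) = mf_d1 Z (f.2 x) by apply/esym/eqP; rewrite -subr_eq0;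
  apply/eqP/df2.
have dg1 x : mf_d0 X (g.1 x) = g.2 (mf_d0 Z x).
  by rewrite -[LHS](gf2) /= df1 [X in mf_d0 Z X]fg1.
have dg2 x : mf_d1 X (g.2 x) = g.1 (mf_d1 Z x).
  by rewrite -[LHS](gf1) /= df2 [X in mf_d1 Z X]fg2.
exists (mf_comp (i := false) (j := false) a f), (mf_comp (i := false) (j :=
  false) g b); split.
- apply: mf_hom_ext => x /=; rewrite ?df1 ?df2; [exact: da1 | exact: da2].
- apply: mf_hom_ext => x /=; rewrite ?dg1 ?dg2 -linearB.
    by rewrite [X in g.2 X]db1 linear0.
  by rewrite [X in g.1 X]db2 linear0.
- exists (mf_comp (i := false) (j := true) g (mf_comp (i := true) (j := false) h f)).
  apply: mf_hom_ext => x /=.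
    rewrite dg2 df1 -linearD [X in g.1 X]h1 /= linearB; congr (_ - _); exact: gf1.
  rewrite dg1 df2 -linearD [X in g.2 X]h2 /= linearB; congr (_ - _); exact: gf2.
exists k; apply: mf_hom_ext => x.
  rewrite [LHS]k1 /=; congr (a.1 _ - _); exact/esym/fg1.
rewrite [LHS]k2 /=; congr (a.2 _ - _); exact/esym/fg2.
Qed.

(* The automorphism (a, b) |-> (a, b + h a) carries the cone of uh to that of u,
   where h is the homotopy (H0, H1). *)
Lemma mfcone_cokernel (Z Y : mf w) (uh u v : forall i, {linear Z i -> Z i})
    (dh0 : forall x, mf_d0 Z (uh false x) = uh true (mf_d0 Z x))
    (dh1 : forall x, mf_d1 Z (uh true x) = uh false (mf_d1 Z x))
    (H0 : {linear Z false -> Z true}) (H1 : {linear Z true -> Z false})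
    (rho : forall i, {linear Z i -> Y i}) (sigma : forall i, {linear Y i -> Z i}) :
  (forall x, mf_d0 Z (v false x) = v true (mf_d0 Z x)) ->
  (forall x, mf_d1 Z (v true x) = v false (mf_d1 Z x)) ->
  (forall x, mf_d0 Y (rho false x) = rho true (mf_d0 Z x)) ->
  (forall x, mf_d1 Y (rho true x) = rho false (mf_d1 Z x)) ->
  (forall x, mf_d0 Z (sigma false x) = sigma true (mf_d0 Y x)) ->
  (forall x, mf_d1 Z (sigma true x) = sigma false (mf_d1 Y x)) ->
  (forall i x, v i (u i x) = x) -> (forall i x, u i (v i x) = x - sigma i (rho i x)) ->
  (forall i x, rho i (u i x) = 0) -> (forall i x, rho i (sigma i x) = x) ->
  (forall x, uh false x = u false x + (mf_d1 Z (H0 x) + H1 (mf_d0 Z x))) ->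
  (forall x, uh true x = u true x + (mf_d0 Z (H1 x) + H0 (mf_d1 Z x))) ->
  @homotopy_iso (mf_dgcat w)
    (@mfcone A w Z (uh false, uh true) dh0 dh1) Y.
Proof.
move=> dv0 dv1 dr0 dr1 ds0 ds1 vu uv ru rs uh0 uh1.
(* [p0] and [p1] are the second coordinate after that automorphism. *)
pose p0 : {linear (Z true * Z false)%type -> Z false} := lcase H1 (lid _).
pose p1 : {linear (Z false * Z true)%type -> Z true} := lcase H0 (lid _).
pose f : mf_hom (mfcone (u := (uh false, uh true)) dh0 dh1) Y false :=
  (lcomp (rho false) p0, lcomp (rho true) p1).
pose g : mf_hom Y (mfcone (u := (uh false, uh true)) dh0 dh1) false :=
  (lpair \0 (sigma false), lpair \0 (sigma true)).
(* The contraction [(a, b) |-> (- v b, 0)] of the cone of [u] onto its cokernel, written in the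
   original coordinates. *)
pose K : mf_hom (mfcone (u := (uh false, uh true)) dh0 dh1)
    (mfcone (u := (uh false, uh true)) dh0 dh1) true :=
  (lpair (\- lcomp (v false) p0) (lcomp H0 (lcomp (v false) p0)),
   lpair (\- lcomp (v true) p1) (lcomp H1 (lcomp (v true) p1))).
exists f, g; split.
- apply: mf_hom_ext => -[a b].
    rewrite -[LHS]/(mf_d0 Y (rho false (H1 a + b)) -
      rho true (H0 (- mf_d1 Z a) + (uh true a + mf_d0 Z b))).
    rewrite dr0 uh1 (linearN H0) (linearD (mf_d0 Z)) !(linearD (rho true)) (linearN
      (rho true)) ru.
    by module.
  rewrite -[LHS]/(mf_d1 Y (rho true (H0 a + b)) -
    rho false (H1 (- mf_d0 Z a) + (uh false a + mf_d1 Z b))).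
  rewrite dr1 uh0 (linearN H1) (linearD (mf_d1 Z)) !(linearD (rho false)) (linearN (rho
    false)) ru.
  by module.
- apply: mf_hom_ext => y; apply: injective_projections; rewrite /=.
  + by rewrite !linear0 ?subr0 ?addr0.
  + by rewrite linear0 add0r ds0 subrr.
  + by rewrite !linear0 ?subr0 ?addr0.
  + by rewrite linear0 add0r ds1 subrr.
- exists K; apply: mf_hom_ext => -[a b]; apply: injective_projections.
  + rewrite -[LHS]/(- mf_d0 Z (- v false (H1 a + b))
      - v true (H0 (- mf_d1 Z a) + (uh true a + mf_d0 Z b))).
    rewrite -[RHS]/(0 - a).
    rewrite (linearN (mf_d0 Z)) dv0 uh1 (linearN H0) (linearD (mf_d0 Z)).
    rewrite !(linearD (v true)) (linearN (v true)) vu.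
    by module.
  + rewrite -[LHS]/(uh false (- v false (H1 a + b)) + mf_d1 Z (H0 (v false (H1 a + b)))
      + H1 (v true (H0 (- mf_d1 Z a) + (uh true a + mf_d0 Z b)))).
    rewrite -[RHS]/(sigma false (rho false (H1 a + b)) - b).
    have e : v true (H0 (- mf_d1 Z a) + (uh true a +
      mf_d0 Z b)) = mf_d0 Z (v false (H1 a + b)) + a.
      rewrite dv0 uh1 (linearN H0) (linearD (mf_d0 Z)) !(linearD (v true)) (linearN (v
        true)) vu.
      by module.
    rewrite e (linearN (uh false)) uh0 uv (linearD H1).
    by module.
  + rewrite -[LHS]/(- mf_d1 Z (- v true (H0 a + b))
      - v false (H1 (- mf_d0 Z a) + (uh false a + mf_d1 Z b))).
    rewrite -[RHS]/(0 - a).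
    rewrite (linearN (mf_d1 Z)) dv1 uh0 (linearN H1) (linearD (mf_d1 Z)).
    rewrite !(linearD (v false)) (linearN (v false)) vu.
    by module.
  + rewrite -[LHS]/(uh true (- v true (H0 a + b)) + mf_d0 Z (H1 (v true (H0 a + b)))
      + H0 (v false (H1 (- mf_d0 Z a) + (uh false a + mf_d1 Z b)))).
    rewrite -[RHS]/(sigma true (rho true (H0 a + b)) - b).
    have e : v false (H1 (- mf_d0 Z a) + (uh false a +
      mf_d1 Z b)) = mf_d1 Z (v true (H0 a + b)) + a.
      rewrite dv1 uh0 (linearN H1) (linearD (mf_d1 Z)) !(linearD (v false)) (linearN (v
        false)) vu.
      by module.
    rewrite e (linearN (uh true)) uh1 uv (linearD H0).
    by module.
exists 0; rewrite raddf0; apply/esym/eqP; rewrite subr_eq0; apply/eqP.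
by apply: mf_hom_ext => y; rewrite /= linear0 add0r rs.
Qed.

End HomotopyEquivalence.

(** * The swindle for a retract defined after extension of scalars *)

Section Swindle.
Variables (A B : comPzRingType) (phi : {rmorphism A -> B}).

(** Extension of scalars commutes with direct sums: [ext phi (dsum M)] is used through its universal
    property as a sum of copies of [ext phi M]. *)
Definition ext_din (M : lmodType A) n : {linear ext phi M -> ext phi (dsum M)} :=
  ext_map phi (din M n).

Definition ext_dlift (M : lmodType A) (W : lmodType B) (f : nat -> {linear ext phi M ->
  W}) :
  {linear ext phi (dsum M) -> W} := linext (dlift (fun n => restr_unit (f n))).

Lemma ext_dliftE (M : lmodType A) (W : lmodType B) (f : nat -> {linear ext phi M ->
  W}) n z :
  ext_dlift f (ext_din M n z) = f n z.
Proof.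
have e : lcomp (ext_dlift f) (ext_din M n) = f n.
  by apply: ext_eq => x; rewrite /= ext_mapE linextE dliftE.
exact: (congr1 (fun h : {linear _ -> _} => h z) e).
Qed.

Lemma ext_dsum_ext (M : lmodType A) (W : lmodType B) (f g : {linear ext phi (dsum M) ->
  W}) :
  (forall n z, f (ext_din M n z) = g (ext_din M n z)) -> forall x, f x = g x.
Proof.
move=> fg; suff -> : f = g by [].
apply: ext_eq; apply: (dsum_ext (f := restr_unit f) (g := restr_unit g)) => n x.
by have := fg n (tens phi 1 x); rewrite /ext_din !ext_mapE.
Qed.

Lemma ext_map_lcomp (X Y Z : lmodType A) (g : {linear Y -> Z}) (f : {linear X -> Y}) x :
  ext_map phi (lcomp g f) x = ext_map phi g (ext_map phi f x).
Proof. by rewrite ext_map_comp. Qed.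

Variable w : A.

Definition even_part (R : comPzRingType) (v : R) (X Y : mf v) (f : mf_hom X Y false) (i
  : bool) :
  {linear X i -> Y i} :=
  match i with false => f.1 | true => f.2 end.

Section Split.
Variable X : mf w.

Definition mf_dsum_d0 : {linear dsum (X false) -> dsum (X true)} :=
  dlift (fun n => lcomp (din _ n) (mf_d0 X)).
Definition mf_dsum_d1 : {linear dsum (X true) -> dsum (X false)} :=
  dlift (fun n => lcomp (din _ n) (mf_d1 X)).
Lemma mf_dsum_d0E n x : mf_dsum_d0 (din _ n x) = din _ n (mf_d0 X x).
Proof. by rewrite [LHS]dliftE. Qed.
Lemma mf_dsum_d1E n x : mf_dsum_d1 (din _ n x) = din _ n (mf_d1 X x).
Proof. by rewrite [LHS]dliftE. Qed.
Fact mf_dsum_d10 x : mf_dsum_d1 (mf_dsum_d0 x) = w *: x.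
Proof.
apply: (dsum_ext (f := lcomp mf_dsum_d1 mf_dsum_d0) (g := lscale w (lid _))) => n y.
rewrite -[LHS]/(mf_dsum_d1 (mf_dsum_d0 (din _ n y))) mf_dsum_d0E mf_dsum_d1E mf_d10.
exact: linearZ.
Qed.
Fact mf_dsum_d01 x : mf_dsum_d0 (mf_dsum_d1 x) = w *: x.
Proof.
apply: (dsum_ext (f := lcomp mf_dsum_d0 mf_dsum_d1) (g := lscale w (lid _))) => n y.
rewrite -[LHS]/(mf_dsum_d0 (mf_dsum_d1 (din _ n y))) mf_dsum_d1E mf_dsum_d0E mf_d01.
exact: linearZ.
Qed.
Definition mf_dsum : mf w :=
  MF (fun i => dsum_projective (@mf_proj _ _ X i)) mf_dsum_d10 mf_dsum_d01.

Variable e' : mf_hom X X false.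
Hypothesis de' : mf_d e' = 0.

(** [1 - e' + (shift) e'], formed with a closed [e'] that is not assumed idempotent. *)
Definition telescope i : {linear dsum (X i) -> dsum (X i)} :=
  dlift (fun n => din _ n \+ lcomp (din _ n.+1 \- din _ n) (even_part e' i)).

Fact even_closed_d0 x : mf_d0 X (e'.1 x) = e'.2 (mf_d0 X x).
Proof. by apply/eqP; rewrite -subr_eq0;
  apply/eqP/(congr1 (fun f : mf_hom X X true => f.1 x) de'). Qed.
Fact even_closed_d1 x : mf_d1 X (e'.2 x) = e'.1 (mf_d1 X x).
Proof. by apply/eqP; rewrite -subr_eq0;
  apply/eqP/(congr1 (fun f : mf_hom X X true => f.2 x) de'). Qed.

Lemma telescopeE i n x : telescope i (din _ n x) =
  din _ n x + (din _ n.+1 (even_part e' i x) - din _ n (even_part e' i x)).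
Proof. by rewrite [LHS]dliftE. Qed.

Fact telescope_d0 x :
  mf_d0 mf_dsum (telescope false x) = telescope true (mf_d0 mf_dsum x).
Proof.
apply: (dsum_ext (f := lcomp mf_dsum_d0 (telescope false))
  (g := lcomp (telescope true) mf_dsum_d0)) => n y.
rewrite -[LHS]/(mf_dsum_d0 (telescope false (din _ n y))).
rewrite -[RHS]/(telescope true (mf_dsum_d0 (din _ n y))).
rewrite mf_dsum_d0E !telescopeE (linearD mf_dsum_d0) (linearB mf_dsum_d0).
by rewrite !mf_dsum_d0E /= even_closed_d0.
Qed.

Fact telescope_d1 x :
  mf_d1 mf_dsum (telescope true x) = telescope false (mf_d1 mf_dsum x).
Proof.
apply: (dsum_ext (f := lcomp mf_dsum_d1 (telescope true))
  (g := lcomp (telescope false) mf_dsum_d1)) => n y.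
rewrite -[LHS]/(mf_dsum_d1 (telescope true (din _ n y))).
rewrite -[RHS]/(telescope false (mf_dsum_d1 (din _ n y))).
rewrite mf_dsum_d1E !telescopeE (linearD mf_dsum_d1) (linearB mf_dsum_d1).
by rewrite !mf_dsum_d1E /= even_closed_d1.
Qed.

Definition telescope_cone : mf w :=
  @mfcone A w mf_dsum (telescope false, telescope true) telescope_d0 telescope_d1.

End Split.

(** Extension of scalars commutes with cones, by the isomorphism of [ext phi (M * N)] with the
    product of the extensions. *)
Lemma ext_mfcone (Z : mf w) (u : mf_hom Z Z false)
    (du0 : forall x, mf_d0 Z (u.1 x) = u.2 (mf_d0 Z x))
    (du1 : forall x, mf_d1 Z (u.2 x) = u.1 (mf_d1 Z x))
    (du0' : forall x, mf_d0 (mf_ext phi Z) (ext_map phi u.1 x) =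
      ext_map phi u.2 (mf_d0 (mf_ext phi Z) x))
    (du1' : forall x, mf_d1 (mf_ext phi Z) (ext_map phi u.2 x) =
      ext_map phi u.1 (mf_d1 (mf_ext phi Z) x))
    (Y : mf (phi w)) :
  @homotopy_iso (mf_dgcat (phi w)) (@mfcone _ _ (mf_ext phi Z) (ext_map phi u.1,
    ext_map phi u.2) du0' du1') Y ->
  @homotopy_iso (mf_dgcat (phi w)) (mf_ext phi (mfcone du0 du1)) Y.
Proof.
pose split (M N : lmodType A) : {linear ext phi (M * N)%type ->
  (ext phi M * ext phi N)%type} :=
  lpair (ext_map phi (lfst M N)) (ext_map phi (lsnd M N)).
pose join (M N : lmodType A) : {linear (ext phi M * ext phi N)%type ->
  ext phi (M * N)%type} :=
  lcase (ext_map phi (linl M N)) (ext_map phi (linr M N)).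
have lcomp0 (M N L : lmodType A) (p : {linear M -> N}) (q : {linear N ->
  L}) (t : {linear M -> L}) x :
    (forall y, q (p y) = t y) -> ext_map phi q (ext_map phi p x) = ext_map phi t x.
  by move=> qp; rewrite -ext_map_lcomp; congr (ext_map phi _ x); apply: linearP_ext.
have ext0 (M N : lmodType A) (x : ext phi M) : ext_map phi (\0 : {linear M -> N}) x = 0.
  have -> : ext_map phi (\0 : {linear M -> N}) = \0.
    by apply: ext_eq => y; rewrite ext_mapE tens0r.
  by [].
have extid (M : lmodType A) (x : ext phi M) : ext_map phi (lid M) x =
  x by rewrite ext_map_id.
have sj M N x : split M N (join M N x) = x.
  case: x => a b; apply: injective_projections.
    rewrite -[LHS]/(ext_map phi (lfst M N) (ext_map phi (linl M N) a +
      ext_map phi (linr M N) b)).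
    rewrite linearD (@lcomp0 _ _ _ _ _ (lid _)) // (@lcomp0 _ _ _ _ _ \0) //.
    by rewrite extid ext0 addr0.
  rewrite -[LHS]/(ext_map phi (lsnd M N) (ext_map phi (linl M N) a +
    ext_map phi (linr M N) b)).
  rewrite linearD (@lcomp0 _ _ _ _ _ \0) // (@lcomp0 _ _ _ _ _ (lid _)) //.
  by rewrite extid ext0 add0r.
have js M N x : join M N (split M N x) = x.
  have e : lcomp (join M N) (split M N) = lid _.
    apply: ext_eq => -[a b]; rewrite /= !ext_mapE -tensDr.
    by congr tens; apply: injective_projections; rewrite /= ?addr0 ?add0r.
  exact: (congr1 (fun h : {linear _ -> _} => h x) e).
have tensN (M : lmodType A) (x : M) : tens phi 1 (- x) = - tens phi 1 x.
  exact: (linearN (@ext_unit _ _ phi M)).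
pose f : mf_hom (mf_ext phi (mfcone du0 du1)) (@mfcone _ _ (mf_ext phi Z) (ext_map phi
  u.1, ext_map phi u.2) du0' du1') false :=
  (split (Z true) (Z false), split (Z false) (Z true)).
pose g : mf_hom (@mfcone _ _ (mf_ext phi Z) (ext_map phi u.1,
  ext_map phi u.2) du0' du1') (mf_ext phi (mfcone du0 du1)) false :=
  (join (Z true) (Z false), join (Z false) (Z true)).
have df : mf_d f = 0.
  apply: congr2; apply: ext_eq => -[a b]; apply: injective_projections;
    rewrite /= !ext_mapE.
  - by rewrite -[lfst _ _ (mfcone_d0 _ _)]/(- mf_d1 Z a) tensN subrr.
  - by rewrite -[lsnd _ _ (mfcone_d0 _ _)]/(u.2 a + mf_d0 Z b) tensDr subrr.
  - by rewrite -[lfst _ _ (mfcone_d1 _ _)]/(- mf_d0 Z a) tensN subrr.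
  - by rewrite -[lsnd _ _ (mfcone_d1 _ _)]/(u.1 a + mf_d1 Z b) tensDr subrr.
have gf : mf_comp g f = mf_id _ by apply: mf_hom_ext => x; exact: js.
have fg : mf_comp f g = mf_id _ by apply: mf_hom_ext => x; exact: sj.
exact: (homotopy_iso_trans df gf fg).
Qed.
(* With e := j r, the map u := 1 - e + (shift) e on a countable sum of copies of
   X_s is injective with cokernel Y, and e lifts to X up to homotopy. *)
Lemma telescope_cone_split (X : mf w) (Y : mf (phi w))
    (j : mf_hom Y (mf_ext phi X) false) (r : mf_hom (mf_ext phi X) Y false)
    (e' : mf_hom X X false) (de' : mf_d e' = 0)
    (h : mf_hom (mf_ext phi X) (mf_ext phi X) true) :
  mf_d j = 0 -> mf_d r = 0 -> mf_comp r j = mf_id Y ->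
  mf_d h = mf_ext_hom phi e' - (mf_comp j r : mf_hom _ _ false) ->
  @homotopy_iso (mf_dgcat (phi w)) (mf_ext phi (telescope_cone de')) Y.
Proof.
move=> dj dr rj dh.
have dE (P Q : mf (phi w)) (p : mf_hom P Q false) : mf_d p = 0 ->
    (forall x, mf_d0 Q (p.1 x) = p.2 (mf_d0 P x)) /\
    (forall x, mf_d1 Q (p.2 x) = p.1 (mf_d1 P x)).
  move=> dp; split=> x; apply/eqP; rewrite -subr_eq0; apply/eqP.
    exact: (congr1 (fun f : mf_hom P Q true => f.1 x) dp).
  exact: (congr1 (fun f : mf_hom P Q true => f.2 x) dp).
have [dj0 dj1] := dE _ _ _ dj; have [dr0 dr1] := dE _ _ _ dr.
pose J i := even_part j i; pose R i := even_part r i.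
have RJ i x : R i (J i x) = x.
  case: i x => x; first exact: (congr1 (fun f : mf_hom Y Y false => f.2 x) rj).
  exact: (congr1 (fun f : mf_hom Y Y false => f.1 x) rj).
pose e i : {linear ext phi (X i) -> ext phi (X i)} := lcomp (J i) (R i).
have eE i z : e i z = J i (R i z) by [].
have RE i z : R i (e i z) = R i z by rewrite eE RJ.
have ee i z : e i (e i z) = e i z by rewrite [LHS]eE RE.
have eJ i y : e i (J i y) = J i y by rewrite eE RJ.
have de0 z : mf_d0 (mf_ext phi X) (e false z) = e true (mf_d0 (mf_ext phi X) z).
  by rewrite !eE [LHS]dj0 [X in j.2 X]dr0.
have de1 z : mf_d1 (mf_ext phi X) (e true z) = e false (mf_d1 (mf_ext phi X) z).
  by rewrite !eE [LHS]dj1 [X in j.1 X]dr1.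
have dh0 z : ext_map phi e'.1 z = e false z +
    (mf_d1 (mf_ext phi X) (h.1 z) + h.2 (mf_d0 (mf_ext phi X) z)).
  have := congr1 (fun f : mf_hom (mf_ext phi X) (mf_ext phi X) false => f.1 z) dh.
  by rewrite /= => ->; rewrite addrC subrK.
have dh1 z : ext_map phi e'.2 z = e true z +
    (mf_d0 (mf_ext phi X) (h.2 z) + h.1 (mf_d1 (mf_ext phi X) z)).
  have := congr1 (fun f : mf_hom (mf_ext phi X) (mf_ext phi X) false => f.2 z) dh.
  by rewrite /= => ->; rewrite addrC subrK.
pose I i n := ext_din (X i) n.
pose Z := mf_ext phi (mf_dsum X).
have d0I n z : mf_d0 Z (I false n z) = I true n (mf_d0 (mf_ext phi X) z).
  rewrite -[LHS]/(lcomp (mf_d0 Z) (I false n) z).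
  rewrite -[RHS]/(lcomp (I true n) (mf_d0 (mf_ext phi X)) z);
    congr (GRing.Linear.sort _ z).
  by apply: ext_eq => x; rewrite /= !ext_mapE mf_dsum_d0E.
have d1I n z : mf_d1 Z (I true n z) = I false n (mf_d1 (mf_ext phi X) z).
  rewrite -[LHS]/(lcomp (mf_d1 Z) (I true n) z).
  rewrite -[RHS]/(lcomp (I false n) (mf_d1 (mf_ext phi X)) z);
    congr (GRing.Linear.sort _ z).
  by apply: ext_eq => x; rewrite /= !ext_mapE mf_dsum_d1E.
pose uh i : {linear Z i -> Z i} := ext_map phi (telescope e' i).
have uhI i n z : uh i (I i n z) = I i n z +
    (I i n.+1 (ext_map phi (even_part e' i) z) - I i n (ext_map phi (even_part e' i) z)).
  pose t := even_part e' i.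
  rewrite -[LHS]/(lcomp (uh i) (I i n) z).
  rewrite -[RHS]/((I i n \+ (lcomp (I i n.+1) (ext_map phi t) \- lcomp (I i n) (ext_map
    phi t))) z).
  congr (GRing.Linear.sort _ z); apply: ext_eq => x.
  rewrite /= !ext_mapE telescopeE !tensDr; congr (_ + (_ + _)).
  exact: (linearN (@ext_unit _ _ phi _)).
pose u i : {linear Z i -> Z i} := ext_dlift (fun n =>
  I i n \+ (lcomp (I i n.+1) (e i) \- lcomp (I i n) (e i))).
have uI i n z : u i (I i n z) = I i n z + (I i n.+1 (e i z) - I i n (e i z)).
  by rewrite [LHS]ext_dliftE.
(* [v] is [1 - e + (backward shift) e], the backward shift killing index 0. Hence [v u = 1], while
   [1 - u v] is [e] on index 0 and zero elsewhere, that is [sigma rho]. *)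
pose prev i n : {linear ext phi (X i) -> Z i} :=
  if n is m.+1 then lcomp (I i m) (e i) else \0.
pose v i : {linear Z i -> Z i} := ext_dlift (fun n =>
  I i n \+ (prev i n \- lcomp (I i n) (e i))).
have vI i n z : v i (I i n z) = I i n z + (prev i n z - I i n (e i z)).
  by rewrite [LHS]ext_dliftE.
pose rho i : {linear Z i -> Y i} := ext_dlift (fun n => if n is 0%N then R i else \0).
have rhoI i n z : rho i (I i n z) = (if n is 0%N then R i else \0) z.
  by rewrite [LHS]ext_dliftE.
pose sigma i : {linear Y i -> Z i} := lcomp (I i 0%N) (J i).
(* [uh - u] is [(shift - 1) (e' - e)], so [(shift - 1) h] is a homotopy between the two. *)
pose H0 : {linear Z false -> Z true} := ext_dlift (fun n =>
  lcomp (I true n.+1) h.1 \- lcomp (I true n) h.1).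
pose H1 : {linear Z true -> Z false} := ext_dlift (fun n =>
  lcomp (I false n.+1) h.2 \- lcomp (I false n) h.2).
have H0I n z : H0 (I false n z) = I true n.+1 (h.1 z) - I true n (h.1 z).
  by rewrite [LHS]ext_dliftE.
have H1I n z : H1 (I true n z) = I false n.+1 (h.2 z) - I false n (h.2 z).
  by rewrite [LHS]ext_dliftE.
have uhd0 x : mf_d0 Z (uh false x) = uh true (mf_d0 Z x).
  rewrite -[LHS]ext_map_lcomp -[RHS]ext_map_lcomp; congr (ext_map phi _ x).
  exact/linearP_ext/telescope_d0.
have uhd1 x : mf_d1 Z (uh true x) = uh false (mf_d1 Z x).
  rewrite -[LHS]ext_map_lcomp -[RHS]ext_map_lcomp; congr (ext_map phi _ x).
  exact/linearP_ext/telescope_d1.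
apply: (@ext_mfcone (mf_dsum X) (telescope e' false, telescope e' true)
  (telescope_d0 de') (telescope_d1 de') uhd0 uhd1 Y).
apply: (@mfcone_cokernel _ _ Z Y uh u v uhd0 uhd1 H0 H1 rho sigma).
- apply: (ext_dsum_ext (f := lcomp (mf_d0 Z) (v false)) (g :=
    lcomp (v true) (mf_d0 Z))) => n z.
  rewrite -[LHS]/(mf_d0 Z (v false (I false n z))) -[RHS]/(v true (mf_d0 Z (I false n
    z))).
  rewrite d0I !vI !linearD !linearN !d0I de0; congr (_ + (_ - _)).
  by case: n => [|n] /=;
    rewrite ?linear0 // -[LHS]/(mf_d0 Z (I false n (e false z))) d0I de0.
- apply: (ext_dsum_ext (f := lcomp (mf_d1 Z) (v true)) (g :=
    lcomp (v false) (mf_d1 Z))) => n z.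
  rewrite -[LHS]/(mf_d1 Z (v true (I true n z))) -[RHS]/(v false (mf_d1 Z (I true n z))).
  rewrite d1I !vI !linearD !linearN !d1I de1; congr (_ + (_ - _)).
  by case: n => [|n] /=;
    rewrite ?linear0 // -[LHS]/(mf_d1 Z (I true n (e true z))) d1I de1.
- apply: (ext_dsum_ext (f := lcomp (mf_d0 Y) (rho false)) (g :=
    lcomp (rho true) (mf_d0 Z))) => n z.
  rewrite -[LHS]/(mf_d0 Y (rho false (I false n z))) -[RHS]/(rho true (mf_d0 Z (I false
    n z))).
  by rewrite d0I !rhoI; case: n => [|n] /=; rewrite ?linear0 // [LHS]dr0.
- apply: (ext_dsum_ext (f := lcomp (mf_d1 Y) (rho true)) (g :=
    lcomp (rho false) (mf_d1 Z))) => n z.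
  rewrite -[LHS]/(mf_d1 Y (rho true (I true n z))) -[RHS]/(rho false (mf_d1 Z (I true n
    z))).
  by rewrite d1I !rhoI; case: n => [|n] /=; rewrite ?linear0 // [LHS]dr1.
- by move=> x; rewrite /sigma /= -/(I false 0%N _) [LHS]d0I [X in I true _ X]dj0.
- by move=> x; rewrite /sigma /= -/(I true 0%N _) [LHS]d1I [X in I false _ X]dj1.
- move=> i; apply: (ext_dsum_ext (f := lcomp (v i) (u i)) (g := lid _)) => n z.
  rewrite -[LHS]/(v i (u i (I i n z))) -[RHS]/(I i n z) uI !(linearD (v i)) !(linearN
    (v i)) !vI.
  rewrite !ee -[prev i n.+1 _]/(I i n (e i (e i z))) ee.
  have -> : prev i n (e i z) = prev i n z by case: n => [//|n];
    exact: (congr1 (I i n) (ee i z)).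
  by module.
- move=> i; apply: (ext_dsum_ext (f := lcomp (u i) (v i)) (g :=
    lid _ \- lcomp (sigma i) (rho i))) => n z.
  rewrite -[LHS]/(u i (v i (I i n z))) -[RHS]/(I i n z - sigma i (rho i (I i n z))).
  rewrite vI rhoI !(linearD (u i)) !(linearN (u i)) !uI ee; case: n => [|n].
    rewrite -[prev i 0%N z]/(0 : Z i) linear0 -[sigma i _]/(I i 0%N (e i z)); by module.
  rewrite -[prev i n.+1 z]/(I i n (e i z)) uI ee linear0; by module.
- move=> i; apply: (ext_dsum_ext (f := lcomp (rho i) (u i)) (g := \0)) => n z.
  rewrite -[LHS]/(rho i (u i (I i n z))) -[RHS]/(0 : Y i) uI linearD linearB !rhoI.
  case: n => [|n]; first by rewrite -[LHS]/(R i z + (0 - R i (e i z))) RE sub0r subrr.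
  by rewrite -[LHS]/(0 + (0 - 0)) subrr addr0.
- move=> i x; rewrite /sigma -[lcomp _ _ x]/(I i 0%N (J i x)) rhoI; exact: RJ.
- apply: (ext_dsum_ext (f := uh false)
    (g := u false \+ (lcomp (mf_d1 Z) H0 \+ lcomp H1 (mf_d0 Z)))) => n z.
  rewrite -[LHS]/(uh false (I false n z)).
  rewrite -[RHS]/(u false (I false n z) + (mf_d1 Z (H0 (I false n z)) +
    H1 (mf_d0 Z (I false n z)))).
  rewrite uhI uI d0I H0I H1I linearB !d1I dh0 !(linearD (I false _)).
  by module.
apply: (ext_dsum_ext (f := uh true)
  (g := u true \+ (lcomp (mf_d0 Z) H1 \+ lcomp H0 (mf_d1 Z)))) => n z.
rewrite -[LHS]/(uh true (I true n z)).
rewrite -[RHS]/(u true (I true n z) + (mf_d0 Z (H1 (I true n z)) +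
  H0 (mf_d1 Z (I true n z)))).
rewrite uhI uI d1I H1I H0I linearB !d0I dh1 !(linearD (I true _)).
by module.
Qed.

End Swindle.

(** The interface to geometry: it only has to supply elements that are null-homotopic on all
    factorizations on both sides and comaximal with each element of [S]. *)
Lemma mf_ext_quasi_equivalence (A B : comPzRingType) (phi : {rmorphism A -> B})
    (S : A -> Prop) (w : A) (cs : seq A) :
  is_localization phi S -> comaximal S cs ->
  (forall (X : mf w) c, c \in cs -> null_homotopic X c) ->
  (forall (Y : mf (phi w)) c, c \in cs -> null_homotopic Y (phi c)) ->
  quasi_equivalence (mf_base_change phi w).
Proof.
move=> locS comax nullA nullB.
have ff X Y : quasi_iso_on (mf_base_change phi w) X Y.
  exact: (mf_ext_quasi_iso locS comax Y (nullA X)).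
split=> [X Y|Y]; first exact: ff.
have [X [j [r [dj dr rj]]]] := mf_realization locS comax (nullB Y).
(* Fullness on cohomology lifts the projector [j r]; the index [true] selects degree [~~ true],
   which is even. *)
have [|e' de' [h hE]] := (ff X X true).2 (mf_comp j r : mf_hom _ _ false).
  apply: (etrans (mf_leibniz j r)); rewrite !dcastE dj dr.
  by apply: mf_hom_ext => x; rewrite /= linear0 addr0.
by exists (telescope_cone de'); apply: (telescope_cone_split de' dj dr rj hE).
Qed.

(** * Prime ideals and the critical locus *)

Section PrimeIdeals.
Variable R : comNzRingType.

Definition gen_ideal (G : R -> Prop) (x : R) :=
  forall P, ideal_pred P -> (forall g, G g -> P g) -> P x.

Lemma gen_ideal_pred G : ideal_pred (gen_ideal G).
Proof.
split=> [P idP _|a x y Gx Gy P idP GP]; first exact: idP.1.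
by apply: idP.2; [apply: Gx | apply: Gy].
Qed.

Lemma prime_ideal_pred (p : prime_idealr R) : ideal_pred (fun x => x \in p).
Proof. by split=> [|a x y px py]; rewrite ?idealr0 // rpredD ?idealMr. Qed.

Lemma prime_idealX (p : prime_idealr R) x n : x ^+ n \in p -> x \in p.
Proof.
elim: n => [|n IH]; first by rewrite expr0 idealr1.
by rewrite exprS prime_idealrM => /orP[|/IH].
Qed.

Definition bool_pred (M : R -> Prop) : {pred R} := fun x => `[< M x >].

Fact bool_pred_ideal (M : R -> Prop) :
  ideal_pred M -> ~ M 1 -> idealr_closed (bool_pred M).
Proof.
move=> idM M1; split; [exact/asboolP/idM.1 | by apply/asboolP |].
by move=> a x y /asboolP Mx /asboolP My; apply/asboolP/idM.2.
Qed.

Fact bool_pred_prime (M : R -> Prop) :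
  (forall u v, M (u * v) -> M u \/ M v) -> prime_idealr_closed (bool_pred M).
Proof. by move=> Mp u v /asboolP/Mp[?|?]; apply/orP; [left|right]; apply/asboolP. Qed.

Definition prime_of (M : R -> Prop) (idM : ideal_pred M) (M1 : ~ M 1)
    (primeM : forall u v, M (u * v) -> M u \/ M v) : prime_idealr R :=
  HB.pack (bool_pred M) (isIdealr.Build R (bool_pred M) (bool_pred_ideal idM M1))
    (isPrimeIdealrClosed.Build R (bool_pred M) (bool_pred_prime primeM)).

(** An ideal maximal among those that contain [I] and avoid the powers of [x] is prime: adjoining
    [u] or [v] outside it captures a power of [x], and the product of these two powers would lie in
    the ideal if [u v] did. *)
Lemma prime_avoiding (I : R -> Prop) (x : R) :
  ideal_pred I -> (forall n, ~ I (x ^+ n)) ->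
  exists p : prime_idealr R, (forall a, I a -> a \in p) /\ x \notin p.
Proof.
move=> idI Ix.
(* The union with I makes the empty chain admissible. *)
pose ok (J : set R) := ideal_pred (fun a => J a \/ I a) /\ forall n, ~ J (x ^+ n).
have [F Fok Ftot|J [[idJ Jx] Jmax]] := @Zorn_bigcup R ok.
  split; last by move=> n [J /Fok[_ Jx]]; apply: Jx.
  split=> [|a y z]; first by right; apply: idI.1.
  have up K b : F K -> K b \/ I b -> (\bigcup_(X in F) X)%classic b \/ I b.
    by move=> FK [Kb|]; [left; exists K | right].
  case=> [[K FK Ky]|Iy] [[L FL Lz]|Iz].
  - have [KL|LK] := Ftot _ _ FK FL.
      by apply: (up L) => //; apply: (Fok _ FL).1.2; left => //; apply: KL.
    by apply: (up K) => //; apply: (Fok _ FK).1.2; left => //; apply: LK.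
  - by apply: (up K) => //; apply: (Fok _ FK).1.2; [left|right].
  - by apply: (up L) => //; apply: (Fok _ FL).1.2; [right|left].
  - by right; apply: idI.2.
pose M a := J a \/ I a.
have Mx n : ~ M (x ^+ n) by case=> [/Jx|/Ix].
have big u : ~ M u -> exists n m r, x ^+ n = m + r * u /\ M m.
  move=> Mu; apply: contrapT => none.
  pose K : set R := fun a => exists m r, a = m + r * u /\ M m.
  have KJ a : J a -> K a by move=> Ja; exists a, 0; rewrite mul0r addr0; split=> //; left.
  apply: (Jmax K).
    split=> // /(_ u) KJ'; apply: Mu; left; apply: KJ'; exists 0, 1; rewrite mul1r add0r.
    by split=> //; apply: idJ.1.
  split; last by move=> n [m [r [e Mm]]]; apply: none; exists n, m, r.
  have KI a : K a \/ I a -> K a.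
    by case=> // Ia; exists a, 0; rewrite mul0r addr0; split=> //; right.
  split=> [|a y z /KI[m [r [-> Mm]]] /KI[m' [r' [-> Mm']]]].
    by left; exists 0, 0; rewrite mul0r addr0; split=> //; apply: idJ.1.
  left; exists (a * m + m'), (a * r + r'); split; first by ring.
  exact: idJ.2.
have primeM u v : M (u * v) -> M u \/ M v.
  move=> Muv; apply: contrapT => /not_orP[/big[n [m [r [e Mm]]]] /big[n' [m' [r' [e'
    Mm']]]]].
  apply: (Mx (n + n')%N); rewrite exprD e e'.
  have -> : (m + r * u) * (m' + r' * v) = (m' + r' * v) * m + (r * u * m' +
    (r * r' * (u * v) + 0)) by ring.
  by apply: idJ.2 => //; apply: idJ.2 => //; apply: idJ.2 => //; apply: idJ.1.
exists (prime_of idJ (Mx 0%N) primeM); split=> [a Ia|].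
  by rewrite -[_ \in _]/(`[< M a >]); apply/asboolP; right.
by rewrite -[_ \in _]/(`[< M x >]); apply/asboolP; have := Mx 1%N; rewrite expr1.
Qed.

End PrimeIdeals.

Section LocIn.
Variables (A : comPzRingType) (S : mulrClosed A).

Lemma frac_mulr (a : A) (t : denominator S) :
  Defs.frac (a, t) * loc_in S (sval t) = loc_in S a.
Proof.
rewrite -[LHS]/(loc_mul _ _) loc_mulE; apply: frac_eq => /=; ring.
Qed.

Lemma loc_in_localization : is_localization (loc_in S) (fun t => t \in S).
Proof.
split=> [|s t Ss St|t St|b|a].
- exact: rpred1.
- exact: rpredM.
- exists (Defs.frac (1, exist _ t St)).
  exact: (etrans (frac_mulr 1 (exist _ t St)) (rmorph1 (loc_in S))).
- elim/frac_ind: b => -[a t]; exists (sval t), a; split; first exact: valP.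
  by rewrite mulrC frac_mulr.
- by move=> /fracP[u Su /=]; rewrite !mulr1 mulr0 => ua; exists u.
Qed.
End LocIn.

(** * The critical ideal and its null-homotopies *)

Section IsolatedCriticalPoint.
Variables (k : fieldType) (R : comAlgType k) (w : R) (s : prime_idealr R).
Hypotheses (eft : essentially_of_finite_type R) (crit : isolated_critical_point w s).

(* If a1, ..., ar generate the finite type algebra of which R is a localization
   and l1, ..., lr are their residues in k, then s = (a1 - l1, ..., ar - lr). *)
Lemma point_finitely_generated : exists2 xs : seq R,
  {subset xs <= s} & forall y, y \in s -> gen_ideal (fun x => x \in xs) y.
Proof.
have [_ _ _ [res _ resK]] := crit.
have /choice[rho rhoE] : forall y : R, exists c : k, y - c%:A \in s.
  move=> y; exists (res (\pi_({ideal_quot s}) y)).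
  by rewrite Quotient.idealrBE; apply/eqP; rewrite resK.
have [A [S [f [[gens gensP] fbij fk]]]] := eft.
pose x (a : A) : R := f (loc_in S a) - (rho (f (loc_in S a)))%:A.
exists [seq x a | a <- gens]; first by move=> _ /mapP[a _ ->]; apply: rhoE.
set G := gen_ideal _; have idG : ideal_pred G by apply: gen_ideal_pred.
have GD a b : G a -> G b -> G (a + b) by move=> Ga Gb; rewrite -[a]mul1r; apply: idG.2.
have GM a b : G b -> G (a * b) by move=> Gb; rewrite -[_ * _]addr0; apply: idG.2 => //;
  apply: idG.1.
have Gs y : G y -> y \in s.
  by move=> /(_ _ (prime_ideal_pred s)); apply=> _ /mapP[a _ ->]; apply: rhoE.
have fA (c : k) (a : A) : f (loc_in S (c *: a)) = c%:A * f (loc_in S a).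
  by rewrite -fk -rmorphM -[loc_in S _ * _](rmorphM (loc_in S)) mulr_algl.
(* The elements congruent to a scalar modulo [G] form a subalgebra containing the generators, hence
   all of [A]. *)
pose Q : {pred A} := fun a => `[< exists c : k, G (f (loc_in S a) - c%:A) >].
have Qall : forall a, a \in Q.
  apply: gensP => [|a ga]; last first.
    by apply/asboolP; exists (rho (f (loc_in S a))) => P idP; apply; apply: map_f.
  split=> [|c a b /asboolP[la Ga] /asboolP[lb Gb]|a b /asboolP[la Ga] /asboolP[lb Gb]];
    apply/asboolP.
  - by exists 1; rewrite scale1r !rmorph1 subrr; apply: idG.1.
  - exists (c * la + lb);
      rewrite rmorphD rmorphD fA scalerDl -scalerA -(mulr_algl c la%:A).
    have -> : c%:A * f (loc_in S a) + f (loc_in S b) - (c%:A * la%:A + lb%:A)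
      = c%:A * (f (loc_in S a) - la%:A) + (f (loc_in S b) - lb%:A) by ring.
    exact: idG.2.
  - exists (la * lb); rewrite !rmorphM -scalerA -(mulr_algl la lb%:A).
    have -> : f (loc_in S a) * f (loc_in S b) - la%:A * lb%:A
      = f (loc_in S a) * (f (loc_in S b) - lb%:A) +
        lb%:A * (f (loc_in S a) - la%:A) by ring.
    by apply: idG.2 => //; apply: GM.
move=> y ys; have [g gf fg] := fbij.
rewrite -[y]fg in ys *; elim/frac_ind: (g y) ys => -[a t] ys.
have ats : f (Defs.frac (a, t)) * f (loc_in S (sval t)) = f (loc_in S a).
  by rewrite -rmorphM frac_mulr.
have as_ : f (loc_in S a) \in s by rewrite -ats mulrC idealMr.
have /asboolP[c Gc] := Qall a.
(* The scalar [c] lies in [s], because the image of [a] and its difference with [c] do; a nonzero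
   scalar would be a unit. *)
have c0 : c = 0.
  have [//|c0] := eqVneq c 0.
  have : c%:A \in s by rewrite -[c%:A](subKr (f (loc_in S a))) rpredB // Gs.
  by move/(@idealMr _ s (c^-1)%:A); rewrite mulr_algl scalerA mulVf // scale1r idealr1.
have Ga : G (f (loc_in S a)) by move: Gc; rewrite c0 scale0r subr0.
have -> : f (Defs.frac (a, t)) = f (Defs.frac (1, t)) * f (loc_in S a).
  rewrite -rmorphM; congr (f _); rewrite -[RHS]/(loc_mul _ _) loc_mulE.
  by apply: frac_eq => /=; ring.
exact: GM.
Qed.

Definition critical_ideal := gen_ideal (fun x : R =>
  x = w \/ exists f : {linear kahler R -> R^o}, x = f (kahler_d w)).

Lemma critical_generators : exists2 cs : seq R,
  (forall c, c \in cs -> critical_ideal c) & comaximal (fun t => t \in compl s) cs.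
Proof.
have [_ crits smax _] := crit.
have idI : ideal_pred critical_ideal by apply: gen_ideal_pred.
have [xs xss sxs] := point_finitely_generated.
have /choice[N NE] : forall x : R, exists N, x \in xs -> critical_ideal (x ^+ N).
  move=> x; have [xsx|] := boolP (x \in xs); last by exists 0%N.
  apply: contrapT => none.
  (* If no power of [x] were in the ideal, some prime above the ideal would miss [x]; but that prime
     is [s]. *)
  have [|p [Ip xp]] := prime_avoiding idI (x := x).
    by move=> n In; apply: none; exists n.
  have /crits ps : spec_quot w p /\ zero_locus (kahler_d w) p.
    split=> [|f]; first by apply: Ip => P idP; apply; left.
    by apply: Ip => P idP; apply; right; exists f.
  by move: xp; rewrite ps xss.
exists [seq x ^+ N x | x <- xs] => [_ /mapP[x xsx ->]|t P ts idP Pt Pc]; first exact: NE.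
apply: contrapT => P1.
(* A proper ideal [P] would lie in a prime [p], which contains the powers of the generators of [s],
   hence [s], hence equals [s] by maximality, although [t] is in [p] and not in [s]. *)
have [|p [Pp p1]] := prime_avoiding idP (x := 1); first by move=> n; rewrite expr1n.
have sp : {subset s <= p}.
  move=> y /sxs/(_ _ (prime_ideal_pred p)); apply=> x xsx.
  by apply: (@prime_idealX _ p x (N x)); apply/Pp/Pc/map_f.
move: ts; rewrite -[_ \in _]/(t \notin s) -(smax p sp) => /negP; apply.
exact: Pp.
Qed.

Lemma kahler_derivation (f : {linear kahler R -> R^o}) :
  derivation (fun a => f (kahler_d a) : R).
Proof.
split=> a b.
  have -> : kahler_d (a + b) = kahler_d a + kahler_d b.
    rewrite /kahler_d /gen (comb_rel (kahlerD a b)).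
    by rewrite -cat1s combD.
  exact: linearD.
have -> : kahler_d (a * b) = a *: kahler_d b + b *: kahler_d a.
  rewrite /kahler_d /gen (comb_rel (kahlerM a b)) -cat1s combD -!combZ /=.
  by rewrite !mulr1.
by rewrite linearD !linearZ.
Qed.

Lemma critical_null_homotopic (X : mf w) c : critical_ideal c -> null_homotopic X c.
Proof.
apply=> [|_ [->|[f ->]]]; last exact: (null_homotopic_der X (kahler_derivation f)).
  split=> [|a x y hx hy]; first exact: null_homotopic0.
  by apply: null_homotopicD => //; apply: null_homotopicM.
exact: null_homotopic_w.
Qed.

(** The ideal is still that of [R], generated by [w] and the D(w) for derivations of [R]; each of
    these derivations extends to the localization. *)
Lemma critical_null_homotopic_loc (Y : mf (loc_in (compl s) w)) c :
  critical_ideal c -> null_homotopic Y (loc_in (compl s) c).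
Proof.
move=> /(_ (fun c => null_homotopic Y (loc_in (compl s) c))).
apply=> [|_ [->|[f ->]]]; last 1 first.
- have [D derD DE] :=
    der_localization (kahler_derivation f) (loc_in_localization (compl s)).
  by rewrite -DE; apply: null_homotopic_der.
- split=> [|a x y hx hy]; first by rewrite rmorph0; apply: null_homotopic0.
  by rewrite rmorphD rmorphM; apply: null_homotopicD => //; apply: null_homotopicM.
exact: null_homotopic_w.
Qed.

End IsolatedCriticalPoint.

Theorem theorem4p11 (k : fieldType) (R : comAlgType k) (w : R) (n : nat)
    (s : prime_idealr R) :
  essentially_of_finite_type R ->
  equidimensional R n ->
  locally_free n (kahler R) ->
  isolated_critical_point w s ->
  quasi_equivalence
    (mf_base_change (@loc_in R (compl s)) w
      : dgfunctor (mf_dgcat w) (mf_dgcat (@loc_in R (compl s) w))).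
Proof.
move=> eft _ _ crit; have [cs csI comax] := critical_generators eft crit.
apply: (mf_ext_quasi_equivalence (loc_in_localization (compl s)) comax).
  by move=> X c /csI; apply: critical_null_homotopic.
by move=> Y c /csI; apply: critical_null_homotopic_loc.
Qed.
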